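(* Let $\Omega$ be a bounded domain in $\mathbb{R}^n$, let $s\in(0,1)$, let $L$ be a stable operator of order $2s$ with spectral measure $\mu$ satisfying the ellipticity condition (as in the context), and let $a\in C^{0,\alpha}_{\mathrm{loc}}(\mathbb{R}^n)$ for some $\alpha\in(0,1)$ satisfy $0<a^-\le a(x)\le a^+$ for all $x\in\mathbb{R}^n$. Put $\mathcal{E}u=Lu-\operatorname{div}(a(x)\nabla u)$. Assume that $u\in H^1(\mathbb{R}^n)$ satisfies $\mathcal{E}u\ge 0$ in $\Omega$ weakly. If $u\ge 0$ in $\mathbb{R}^n\setminus\Omega$, then $u\ge 0$ almost everywhere in $\Omega$.
   Context: Operator $L$: for $s\in(0,1)$ and a nonnegative finite measure $\mu$ on the unit sphere $S^{n-1}$ (the spectral measure), $$Lu(x)=\int_{S^{n-1}}\int_{-\infty}^{+\infty}\frac{2u(x)-u(x+\theta r)-u(x-\theta r)}{|r|^{1+2s}}\,dr\,d\mu(\theta).$$ Ellipticity condition: there are constants $\lambda_1,\Lambda_1$ with $$0<\lambda_1\le\inf_{\nu\in S^{n-1}}\int_{S^{n-1}}|\nu\cdot\theta|\,d\mu(\theta),\qquad \int_{S^{n-1}}d\mu\le\Lambda_1<\infty.$$ $\mathcal{E}u\ge0$ weakly in $\Omega$ means $$\int_{\mathbb{R}^n}u\,Lv\,dx+\int_{\mathbb{R}^n}a(x)\nabla u\cdot\nabla v\,dx\ge 0\quad\text{for every }v\in C_0^\infty(\Omega)\text{ with }v\ge 0.$$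
   Formalization: ''u ≥ 0 in R^n∖Ω'' is taken for the quasi-continuous representative of u (boundary of Ω included), not merely almost everywhere; with the a.e. reading the claim fails for domains such as a ball minus a hyperplane slit. *)

(* Defs.v *)
From HB Require Import structures.
From mathcomp Require Import all_boot all_order all_algebra.
From mathcomp Require Import all_classical all_reals all_analysis.

Set Implicit Arguments.
Unset Strict Implicit.
Unset Printing Implicit Defensive.

Import Order.TTheory GRing.Theory Num.Theory.
Import numFieldNormedType.Exports.

Local Open Scope classical_set_scope.
Local Open Scope ring_scope.

(* R^n is 'rV[R]_n.  The library gives it the topology of the sup norm, which
   is the Euclidean topology.  Its sigma-algebra is generated by the
   coordinate maps (as the library does for n.-tuple); it is the Borel one. *)

Definition measure_rV_display (R : realType) : measure_display.
Proof. exact. Qed.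

Section measurable_rV.
Context {R : realType}.
Variable n : nat.

Definition rV_coord (i : 'I_n) (x : 'rV[R]_n) : measurableTypeR R := x 0 i.

Let rV_set0 : g_sigma_preimage rV_coord set0.
Proof. exact: sigma_algebra0. Qed.

Let rV_setC A : g_sigma_preimage rV_coord A -> g_sigma_preimage rV_coord (~` A).
Proof. exact: sigma_algebraC. Qed.

Let rV_bigcup (F : (set 'rV[R]_n)^nat) :
  (forall i, g_sigma_preimage rV_coord (F i)) ->
  g_sigma_preimage rV_coord (\bigcup_i (F i)).
Proof. exact: sigma_algebra_bigcup. Qed.

HB.instance Definition _ := @isMeasurable.Build (measure_rV_display R)
  'rV[R]_n (g_sigma_preimage rV_coord) rV_set0 rV_setC rV_bigcup.

End measurable_rV.

Lemma measurable_rV_coord (R : realType) n (i : 'I_n) :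
  measurable_fun [set: 'rV[R]_n] (@rV_coord R n i).
Proof.
move=> _ Y mY; rewrite setTI; apply: sub_sigma_algebra => /=.
rewrite -bigcup_seq/=; exists i => /=; first by rewrite mem_index_enum.
by exists Y => //; rewrite setTI.
Qed.

Lemma measurable_fun_rVP (R : realType) d (T : measurableType d) n
    (f : T -> 'rV[R]_n) :
  (forall i, measurable_fun [set: T] (@rV_coord R n i \o f)) ->
  measurable_fun [set: T] f.
Proof.
move=> mf.
have prefS : g_sigma_preimage (fun i => @rV_coord R n i \o f) `<=` measurable.
  apply: smallest_sub; first exact: sigma_algebra_measurable.
  case: n => [|n] in f mf *; first by rewrite big_ord0.
  rewrite -bigcup_mkord_ord; apply: bigcup_sub => i Ii.
  by move=> A [B mB <-]; exact: mf.
move=> _ A mA; apply: prefS; rewrite g_sigma_preimage_comp.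
by exists A.
Qed.

Definition rV_cons (R : realType) n (p : measurableTypeR R * 'rV[R]_n) :
    'rV[R]_n.+1 :=
  row_mx (p.1 : R)%:M p.2.

Lemma rV_consE0 (R : realType) n (p : measurableTypeR R * 'rV[R]_n) :
  rV_cons p 0 ord0 = p.1.
Proof.
have -> : ord0 = lshift n (ord0 : 'I_1) by apply/val_inj.
by apply: etrans (row_mxEl (p.1 : R)%:M p.2 _ _) _; rewrite mxE eqxx mulr1n.
Qed.

Lemma rV_consES (R : realType) n (p : measurableTypeR R * 'rV[R]_n) (i : 'I_n) :
  rV_cons p 0 (lift ord0 i) = p.2 0 i.
Proof.
have -> : lift ord0 i = rshift 1 i by apply/val_inj.
exact: (row_mxEr (p.1 : R)%:M p.2).
Qed.

Lemma measurable_rV_cons (R : realType) n :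
  measurable_fun [set: measurableTypeR R * 'rV[R]_n] (@rV_cons R n).
Proof.
apply: measurable_fun_rVP => i; case: (unliftP ord0 i) => [j ->|->].
- rewrite (_ : _ \o _ = @rV_coord R n j \o snd).
    by apply: measurableT_comp => //; exact: measurable_rV_coord.
  by apply/funext => p; rewrite /= /rV_coord rV_consES.
- rewrite (_ : _ \o _ = fst)//.
  by apply/funext => p; rewrite /= /rV_coord rV_consE0.
Qed.

Section lebesgue_rV_step.
Context {R : realType}.
Variables (n : nat) (m : {sigma_finite_measure set 'rV[R]_n -> \bar R}).

Definition lebesgue_rV_step : set 'rV[R]_n.+1 -> \bar R :=
  pushforward (@lebesgue_measure R \x m)%E (@rV_cons R n).

Let lebesgue_rV_step0 : lebesgue_rV_step set0 = 0%E.
Proof. by rewrite /lebesgue_rV_step /pushforward preimage_set0 measure0. Qed.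

Let lebesgue_rV_step_ge0 A : (0 <= lebesgue_rV_step A)%E.
Proof.
by apply: integral_ge0 => x _; exact: (measure_ge0 m).
Qed.

Let lebesgue_rV_step_sigma_additive : semi_sigma_additive lebesgue_rV_step.
Proof.
move=> F mF tF mUF; rewrite /lebesgue_rV_step /pushforward preimage_bigcup.
apply: measure_semi_sigma_additive.
- by move=> k; rewrite -[X in measurable X]setTI; exact: measurable_rV_cons.
- apply/trivIsetP => /= i j _ _ ij; rewrite -preimage_setI.
  by move/trivIsetP : tF => /(_ _ _ _ _ ij) ->//; rewrite preimage_set0.
- by rewrite -preimage_bigcup -[X in measurable X]setTI;
    exact: measurable_rV_cons.
Qed.

HB.instance Definition _ := isMeasure.Build _ _ _ lebesgue_rV_step
  lebesgue_rV_step0 lebesgue_rV_step_ge0 lebesgue_rV_step_sigma_additive.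

Definition rV_uncons (x : 'rV[R]_n.+1) : measurableTypeR R * 'rV[R]_n :=
  (x 0 ord0, \row_i x 0 (lift ord0 i)).

Lemma rV_consK : cancel (@rV_cons R n) rV_uncons.
Proof.
move=> [x y]; rewrite /rV_uncons rV_consE0; congr pair.
by apply/rowP => i; rewrite mxE rV_consES.
Qed.

Lemma measurable_rV_uncons : measurable_fun [set: 'rV[R]_n.+1] rV_uncons.
Proof.
apply/measurable_fun_pairP; split.
  exact: (@measurable_rV_coord R n.+1 ord0).
apply: measurable_fun_rVP => i.
rewrite (_ : _ \o _ = @rV_coord R n.+1 (lift ord0 i)).
  exact: measurable_rV_coord.
by apply/funext => p; rewrite /= /rV_coord mxE.
Qed.

Let lebesgue_rV_step_sigma_finite : sigma_finite setT lebesgue_rV_step.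
Proof.
have /sigma_finiteP[F [TF ndF Foo]] := sigma_finiteT (@lebesgue_measure R).
have /sigma_finiteP[G [TG ndG Goo]] := sigma_finiteT m.
exists (fun k => rV_uncons @^-1` (F k `*` G k)).
  apply/esym; rewrite -subTset => x _.
  have [k _ Fkx] : (\bigcup_k F k) (rV_uncons x).1 by rewrite -TF.
  have [l _ Glx] : (\bigcup_k G k) (rV_uncons x).2 by rewrite -TG.
  exists (maxn k l) => //; split.
    by move: Fkx; exact/subsetPset/ndF/leq_maxl.
  by move: Glx; exact/subsetPset/ndG/leq_maxr.
move=> k; have [mF Fkoo] := Foo k; have [mG Gkoo] := Goo k; split.
  rewrite -[X in measurable X]setTI.
  by apply: measurable_rV_uncons => //; exact: measurableX.
rewrite /lebesgue_rV_step /pushforward -comp_preimage.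
rewrite (_ : _ @^-1` _ = F k `*` G k); last first.
  by rewrite (_ : _ \o _ = id)//; apply/funext => p /=; rewrite rV_consK.
by rewrite product_measure1E// lte_mul_pinfty// ge0_fin_numE.
Qed.

HB.instance Definition _ := Measure_isSigmaFinite.Build _ _ _ lebesgue_rV_step
  lebesgue_rV_step_sigma_finite.

End lebesgue_rV_step.

(* Lebesgue measure on R^n: the n-fold product of the one on R. *)
Fixpoint lebesgue_rV {R : realType} n :
    {sigma_finite_measure set 'rV[R]_n -> \bar R} :=
  match n with
  | 0 => dirac (0 : 'rV[R]_0)
  | n'.+1 => lebesgue_rV_step (lebesgue_rV n')
  end.

Lemma lebesgue_rV_box (R : realType) n (A : 'I_n -> set (measurableTypeR R)) :
  (forall i, measurable (A i)) ->
  lebesgue_rV n [set x : 'rV[R]_n | forall i, A i (x 0 i)] =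
  (\prod_(i < n) lebesgue_measure (A i))%E.
Proof.
elim: n A => [|n IH] A mA.
  by rewrite big_ord0 /= diracE mem_set// => -[].
rewrite big_ord_recl -IH// -product_measure1E//.
  rewrite /= /lebesgue_rV_step /pushforward; congr (_ _).
  apply/seteqP; split=> [p Ap|p [A0 AS] i].
    split; first by move: (Ap ord0); rewrite rV_consE0.
    by move=> i; move: (Ap (lift ord0 i)); rewrite rV_consES.
  case: (unliftP ord0 i) => [j ->|->].
    by rewrite rV_consES; exact: AS.
  by rewrite rV_consE0.
rewrite (_ : [set x | _] = \big[setI/setT]_(i < n)
    (@rV_coord R n i @^-1` A (lift ord0 i))).
  apply: bigsetI_measurable => i _; rewrite -[X in measurable X]setTI.
  exact: measurable_rV_coord.
by apply/seteqP; split=> x; rewrite -bigcap_seq/= => Ax i;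
  [move=> _; exact: Ax|apply: Ax => /=; rewrite mem_index_enum].
Qed.

Section functions_on_rV.
Context {R : realType}.
Variable n : nat.
Local Notation Rn := 'rV[R]_n.
Local Notation leb := (@lebesgue_rV R n).
Implicit Types (Omega A : set Rn) (u v a phi : Rn -> R) (g : Rn -> Rn).

Definition dotrv (x y : Rn) : R := \sum_(i < n) x 0 i * y 0 i.

Definition enorm (x : Rn) : R := Num.sqrt (dotrv x x).

Definition sphere : set Rn := [set x | enorm x = 1].

Definition bounded_domain Omega :=
  [/\ open Omega, connected Omega, Omega !=set0 & bounded_set Omega].

Definition partial (i : 'I_n) v : Rn -> R := fun x => 'D_(delta_mx 0 i) v x.

Definition gradient v : Rn -> Rn := fun x => \row_i partial i v x.

Fixpoint Ck (k : nat) v : Prop :=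
  match k with
  | 0 => continuous v
  | k'.+1 => [/\ continuous v,
               forall i x, derivable v x (delta_mx 0 i)
             & forall i, Ck k' (partial i v)]
  end.

Definition Coo v := forall k, Ck k v.

Definition test_function Omega v :=
  [/\ Coo v, compact (closure [set x | v x != 0])
    & closure [set x | v x != 0] `<=` Omega].

Definition holder_loc (alpha : R) a :=
  forall K : set Rn, compact K -> exists C : R,
    forall x y, K x -> K y -> `|a x - a y| <= C * enorm (x - y) `^ alpha.

Definition is_weak_gradient u g :=
  forall (i : 'I_n) phi, test_function [set: Rn] phi ->
    \int[leb]_x (u x * partial i phi x) = - \int[leb]_x (g x 0 i * phi x).

Definition H1_gradient u g :=
  (forall i : 'I_n, (fun x => g x 0 i) \in Lfun leb 2%:E) /\ is_weak_gradient u g.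

Definition H1 u := u \in Lfun leb 2%:E /\ exists g, H1_gradient u g.

(* A version of the weak gradient of u in H1 (0 if there is none). *)
Definition wgrad u : Rn -> Rn := xget (fun=> 0) (H1_gradient u).

Definition H1_normsq u : \bar R :=
  (\int[leb]_x (u x ^+ 2 + enorm (wgrad u x) ^+ 2)%:E)%E.

(* Continuity off open sets of arbitrarily small capacity, where the capacity
   of an open set G is the infimum of the squared H1 norms of the functions
   phi in H1 with phi >= 1 a.e. on G.  Every function in H1 is a.e. equal to a
   quasi-continuous one, which is unique outside a set of capacity zero. *)
Definition quasi_continuous v :=
  forall eps : R, 0 < eps -> exists G : set Rn, open G /\
    {within ~` G, continuous v} /\
    exists phi, [/\ H1 phi, {ae leb, forall x, G x -> 1 <= phi x}
                  & (H1_normsq phi < eps%:E)%E].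

(* Pointwise nonnegativity on A of the H1 class of u, through its
   quasi-continuous representative.  It implies u >= 0 a.e. on A, and is
   equivalent to it when A is open, or when A is the complement of, say, a
   Lipschitz domain.  For the complement of a general domain the a.e. inequality
   is too weak: for Omega a ball minus a hyperplane slit it says nothing on
   the slit, and the weak maximum principle fails. *)
Definition H1_nonneg_on A u :=
  exists v, [/\ quasi_continuous v, {ae leb, forall x, v x = u x}
              & forall x, A x -> 0 <= v x].

(* The measure mu lives on R^n; only its restriction to the sphere is used. *)
Definition elliptic (mu : {finite_measure set Rn -> \bar R}) :=
  exists lambda1 Lambda1 : R,
    [/\ 0 < lambda1,
        (lambda1%:E <= ereal_inf
          [set \int[mu]_(theta in sphere) `|dotrv nu theta|%:E
          | nu in sphere])%E
      & (\int[mu]_(theta in sphere) 1 <= Lambda1%:E)%E].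

Definition stable_op (s : R) (mu : {finite_measure set Rn -> \bar R}) v x : R :=
  \int[mu]_(theta in sphere)
    \int[@lebesgue_measure R]_r
      ((2 * v x - v (x + r *: theta) - v (x - r *: theta))
       / `|r| `^ (1 + 2 * s)).

Definition weak_supersolution (s : R) (mu : {finite_measure set Rn -> \bar R})
    a Omega u :=
  forall v, test_function Omega v -> (forall x, 0 <= v x) ->
    0 <= \int[leb]_x (u x * stable_op s mu v x)
       + \int[leb]_x (a x * dotrv (wgrad u x) (gradient v x)).

End functions_on_rV.

Arguments sphere {R} n.

(* Main.v *)
From HB Require Import structures.
Require Import Defs.
From mathcomp Require Import all_boot all_order all_algebra.
From mathcomp Require Import all_classical all_reals all_analysis.
From mathcomp Require Import measurable_realfun.
From mathcomp Require Import ring lra.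
Import Order.TTheory GRing.Theory Num.Def Num.Theory.
Import numFieldNormedType.Exports.
Local Open Scope classical_set_scope.
Local Open Scope ring_scope.
Set Implicit Arguments.
Unset Strict Implicit.
Unset Printing Implicit Defensive.

(* Fix d > 0 and let F be a nonincreasing bounded C^1 function on the real line with
   F = 0 on [-d, +oo[ and F > 0 below; the point is to show F(u) = 0.

   F(u) is the limit of admissible test functions.  Take an open set G of
   capacity at most e off which a quasi-continuous representative w of u is
   continuous, and phi in H1 of norm at most e with phi >= 1 on G.  For a
   C^1 function H with H(0) = 1 and H = 0 on [1, +oo[, the function H(phi) F(u)
   vanishes a.e. off the set where w <= -d outside G, which is compact and
   lies in Omega because w >= 0 off Omega.  Mollifying gives nonnegative test
   functions in Omega, with gradients close to
   H'(phi) F(u) grad phi + H(phi) F'(u) grad u, whose first term is small.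

   Fubini and translation invariance give
     \int u L v = \int |r|^(-1-2s) (\int (tau_h u - u)(tau_h v - v) dx)
   with h = r theta, the outer integral being over r and theta; the inner one
   is O(min(1, r^2)), uniformly for v bounded in H1, so that one can pass to
   the limit v -> F(u), where it is nonpositive since F is nonincreasing.
   Hence 0 <= \int a F'(u) |grad u|^2 <= 0, that is, F(u) has zero weak
   gradient.  It vanishes off the bounded set Omega, and so it is zero.

   Derivatives of H1 functions are handled through the L2 difference quotients
   of translations: the weak and the strong L2 derivative agree (WD_SD), and
   along a fast sequence of steps the quotients converge a.e. and are dominated
   in L2 (SD_HasD2), which reduces the chain and product rules to pointwise
   ones. *)

(** * Square-integrable functions *)

Section L2.
Context d (T : measurableType d) (R : realType) (m : {measure set T -> \bar R}).
Implicit Types f g G : T -> R.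

Definition ig f := m.-integrable setT (EFin \o f).
Definition L2 f := measurable_fun setT f /\ ig (fun x => f x ^+ 2).
Definition nsq f : R := \int[m]_x (f x ^+ 2).

Lemma ig_meas f : ig f -> measurable_fun setT f.
Proof. by move=> /measurable_int /measurable_EFinP. Qed.

Lemma ig_meas_E f : ig f -> measurable_fun setT (EFin \o f).
Proof. exact: measurable_int. Qed.

Lemma ig_le f G : measurable_fun setT f -> ig G -> (forall x, `|f x| <= G x) ->
  ig f.
Proof.
move=> mf iG fG; apply: (le_integrable measurableT _ _ iG).
  exact/measurable_EFinP.
by move=> x _ /=; rewrite lee_fin (le_trans (fG x))// ler_norm.
Qed.

Lemma igD f g : ig f -> ig g -> ig (fun x => f x + g x).
Proof. by move=> /(integrableD measurableT) h /h; apply: eq_integrable. Qed.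

Lemma igB f g : ig f -> ig g -> ig (fun x => f x - g x).
Proof. by move=> /(integrableB measurableT) h /h; apply: eq_integrable. Qed.

Lemma igZ c f : ig f -> ig (fun x => c * f x).
Proof. by move=> /(integrableZl measurableT c); apply: eq_integrable. Qed.

Lemma ig_norm f : ig f -> ig (fun x => `|f x|).
Proof. by move=> /integrable_norm. Qed.

Lemma ig0 : ig (fun=> 0).
Proof. exact: integrable0. Qed.

Lemma ig_sum (I : Type) (s : seq I) (F : I -> T -> R) :
  (forall i, ig (F i)) -> ig (fun x => \sum_(i <- s) F i x).
Proof.
move=> iF; elim: s => [|i s IH].
  by under eq_fun do rewrite big_nil; exact: ig0.
by under eq_fun do rewrite big_cons; exact: igD.
Qed.

Lemma IntD f g : ig f -> ig g ->
  \int[m]_x (f x + g x) = \int[m]_x f x + \int[m]_x g x.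
Proof. exact: RintegralD. Qed.

Lemma IntB f g : ig f -> ig g ->
  \int[m]_x (f x - g x) = \int[m]_x f x - \int[m]_x g x.
Proof. exact: RintegralB. Qed.

Lemma IntZ c f : ig f -> \int[m]_x (c * f x) = c * \int[m]_x f x.
Proof. exact: RintegralZl. Qed.

Lemma Int_sum (I : Type) (s : seq I) (F : I -> T -> R) :
  (forall i, ig (F i)) ->
  \int[m]_x (\sum_(i <- s) F i x) = \sum_(i <- s) \int[m]_x F i x.
Proof.
move=> iF; elim: s => [|i s IH].
  under eq_Rintegral do rewrite big_nil.
  by rewrite big_nil Rintegral_cst// mul0r.
under eq_Rintegral do rewrite big_cons.
by rewrite big_cons IntD ?IH//; exact: ig_sum.
Qed.

Lemma Int_le f g : ig f -> ig g -> (forall x, f x <= g x) ->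
  \int[m]_x f x <= \int[m]_x g x.
Proof. by move=> ? ? h; apply: le_Rintegral. Qed.

Lemma Int_ge0 f : (forall x, 0 <= f x) -> 0 <= \int[m]_x f x.
Proof. by move=> h; apply: Rintegral_ge0 => x _. Qed.

Lemma EFin_Int f : ig f -> (\int[m]_x f x)%:E = (\int[m]_x (f x)%:E)%E.
Proof. by move=> h; rewrite fineK//; exact: integrable_fin_num. Qed.

Lemma Int_ae f g : measurable_fun setT f -> measurable_fun setT g ->
  {ae m, forall x, f x = g x} -> \int[m]_x f x = \int[m]_x g x.
Proof.
move=> mf mg h; congr fine; apply: ae_eq_integral => //.
- exact/measurable_EFinP.
- exact/measurable_EFinP.
- by apply: filterS h => x -> _.
Qed.

Lemma ig_ae f g : measurable_fun setT g -> ig f ->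
  {ae m, forall x, f x = g x} -> ig g.
Proof.
move=> mg /integrableP[mf fi] h; apply/integrableP; split.
  exact/measurable_EFinP.
rewrite (_ : (\int[m]_x _)%E = (\int[m]_x `|(EFin \o f) x|)%E)//.
apply: ae_eq_integral => //.
- by apply: measurableT_comp => //; exact/measurable_EFinP.
- exact: measurableT_comp.
- by apply: filterS h => x /= -> _.
Qed.

Lemma Int_ae0 f : ig f -> (forall x, 0 <= f x) -> \int[m]_x f x = 0 ->
  {ae m, forall x, f x = 0}.
Proof.
move=> fi f0 f00.
have h : (\int[m]_x `|(f x)%:E| = 0)%E.
  under eq_integral do rewrite gee0_abs ?lee_fin//.
  by rewrite -EFin_Int// f00.
have [/(_ h) e _] := ae_eq_integral_abs m measurableT (ig_meas_E fi).
by apply: filterS e => x /(_ I) [].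
Qed.

Lemma dct (F : nat -> T -> R) f G : (forall k, measurable_fun setT (F k)) ->
  measurable_fun setT f -> ig G ->
  {ae m, forall x, F k x @[k --> \oo] --> f x} ->
  {ae m, forall x k, `|F k x| <= G x} ->
  ig f /\ \int[m]_x F k x @[k --> \oo] --> \int[m]_x f x.
Proof.
move=> mF mf iG FF FG.
have [||||i _ c] := @dominated_convergence _ _ _ m _ measurableT
   (fun k x => (F k x)%:E) (EFin \o f) (EFin \o G) _ _ _ iG.
- by move=> k; exact/measurable_EFinP.
- exact/measurable_EFinP.
- by apply: filterS FF => x h _; apply: cvg_EFin => //; exact: nearW.
- by apply: filterS FG => x h k _; rewrite lee_fin.
split=> //.
have iF k : ig (F k).
  apply/integrableP; split; first exact/measurable_EFinP.
  have /integrableP[_] := iG; apply: le_lt_trans.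
  apply: ae_ge0_le_integral => //.
  - by apply: measurableT_comp => //; exact/measurable_EFinP.
  - apply: measurableT_comp => //; exact: measurable_int iG.
  - apply: filterS FG => x h _ /=; rewrite lee_fin (le_trans (h k))//.
    exact: ler_norm.
apply: fine_cvg; rewrite fineK; first exact: c.
exact: integrable_fin_num.
Qed.

Lemma L2M f g : L2 f -> L2 g -> ig (fun x => f x * g x).
Proof.
move=> [mf f2] [mg g2]; apply: (ig_le _ (igD f2 g2)).
  exact: measurable_funM.
move=> x; rewrite ler_norml; apply/andP; split; nra.
Qed.

Lemma L2_le c f g : measurable_fun setT f -> L2 g ->
  (forall x, `|f x| <= c * `|g x|) -> L2 f.
Proof.
move=> mf [mg g2] fg; split => //; apply: (ig_le _ (igZ (c ^+ 2) g2)).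
  exact: measurable_funX.
move=> x; rewrite ger0_norm ?sqr_ge0// -[f x ^+ 2]real_normK ?num_real//.
rewrite -[g x ^+ 2]real_normK ?num_real// -exprMn lerXn2r ?nnegrE//.
exact: le_trans (fg x).
Qed.

Lemma L2D f g : L2 f -> L2 g -> L2 (fun x => f x + g x).
Proof.
move=> [mf f2] [mg g2]; split; first exact: measurable_funD.
apply: (ig_le _ (igD (igZ 2 f2) (igZ 2 g2))).
  by apply: measurable_funX; exact: measurable_funD.
move=> x /=; rewrite ger0_norm ?sqr_ge0//.
have := sqr_ge0 (f x - g x); nra.
Qed.

Lemma L2Z c f : L2 f -> L2 (fun x => c * f x).
Proof.
move=> h; apply: (@L2_le `|c| _ f) => //.
  by apply: measurable_funM => //; exact: h.1.
by move=> x; rewrite normrM.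
Qed.

Lemma L2B f g : L2 f -> L2 g -> L2 (fun x => f x - g x).
Proof.
move=> f2 g2; have /(L2D f2) := L2Z (-1) g2.
by under eq_fun do rewrite mulN1r.
Qed.

Lemma L20 : L2 (fun=> 0).
Proof. by split=> //; under eq_fun do rewrite expr0n; exact: ig0. Qed.

Lemma L2_sum (I : Type) (s : seq I) (F : I -> T -> R) :
  (forall i, L2 (F i)) -> L2 (fun x => \sum_(i <- s) F i x).
Proof.
move=> iF; elim: s => [|i s IH].
  by under eq_fun do rewrite big_nil; exact: L20.
by under eq_fun do rewrite big_cons; exact: L2D.
Qed.

Lemma nsq_ge0 f : 0 <= nsq f.
Proof. by apply: Int_ge0 => x; exact: sqr_ge0. Qed.

Lemma nsq0 : nsq (fun=> 0) = 0.
Proof. by rewrite /nsq /Rintegral integral0_eq// => x _; rewrite expr0n. Qed.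

Lemma nsqZ c f : L2 f -> nsq (fun x => c * f x) = c ^+ 2 * nsq f.
Proof. by move=> [_ f2]; rewrite /nsq -IntZ//; apply: eq_Rintegral => x _; exact: exprMn. Qed.

Lemma eq_nsq f g : f =1 g -> nsq f = nsq g.
Proof. by move=> /funext ->. Qed.

Lemma nsq_le f g : L2 f -> L2 g -> (forall x, `|f x| <= `|g x|) ->
  nsq f <= nsq g.
Proof.
move=> [_ f2] [_ g2] fg; apply: Int_le => // x.
rewrite -[f x ^+ 2]real_normK ?num_real// -[g x ^+ 2]real_normK ?num_real//.
by rewrite lerXn2r ?nnegrE.
Qed.

Lemma nsqD_le f g : L2 f -> L2 g ->
  nsq (fun x => f x + g x) <= 2 * nsq f + 2 * nsq g.
Proof.
move=> f2 g2; rewrite -IntZ ?(f2.2)// -IntZ ?(g2.2)// -IntD.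
- apply: Int_le; [exact: (L2D f2 g2).2| |by move=> x /=; have := sqr_ge0 (f x - g x); nra].
  by apply: igD; apply: igZ; [exact: f2.2|exact: g2.2].
- exact: igZ f2.2.
- exact: igZ g2.2.
Qed.

Lemma nsqB_le f g : L2 f -> L2 g ->
  nsq (fun x => f x - g x) <= 2 * nsq f + 2 * nsq g.
Proof.
move=> f2 g2; have := nsqD_le f2 (L2Z (-1) g2).
rewrite nsqZ// expr2 mulN1r opprK mul1r.
by rewrite (@eq_nsq _ (fun x => f x - g x))// => x; rewrite mulN1r.
Qed.

Lemma CS f g : L2 f -> L2 g ->
  (\int[m]_x (f x * g x)) ^+ 2 <= nsq f * nsq g.
Proof.
move=> f2 g2; set B := \int[m]_x _.
have q t : 0 <= nsq f - 2 * t * B + t ^+ 2 * nsq g.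
  rewrite -[X in _ - X]IntZ; last exact: L2M.
  rewrite -[X in _ + X]IntZ; last exact: g2.2.
  rewrite -IntB; [|exact: f2.2|by apply: igZ; exact: L2M].
  rewrite -IntD; last 2 first.
  - by apply: igB; [exact: f2.2|by apply: igZ; exact: L2M].
  - exact: igZ g2.2.
  apply: Int_ge0 => x.
  rewrite [leRHS](_ : _ = (f x - t * g x) ^+ 2) ?sqr_ge0//; ring.
have [g0|g0] := eqVneq (nsq g) 0.
  have := q ((nsq f + 1) / (2 * B)); rewrite g0 mulr0 addr0 mulr0.
  have [->|B0] := eqVneq B 0; first by rewrite expr0n.
  rewrite [X in _ - X](_ : _ = nsq f + 1); last by field.
  lra.
have gp : 0 < nsq g by rewrite lt_neqAle eq_sym g0 nsq_ge0.
have := q (B / nsq g).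
rewrite [leRHS](_ : _ = nsq f - B ^+ 2 / nsq g); last by field.
by rewrite subr_ge0 ler_pdivrMr.
Qed.

Lemma CS_norm f g : L2 f -> L2 g ->
  `|\int[m]_x (f x * g x)| <= Num.sqrt (nsq f * nsq g).
Proof.
move=> f2 g2; rewrite -sqrtr_sqr ler_sqrt; first exact: CS.
by rewrite mulr_ge0// nsq_ge0.
Qed.

Lemma sqr_sum_le (k : nat) (x : 'I_k -> R) :
  (\sum_(i < k) x i) ^+ 2 <= k%:R * \sum_(i < k) x i ^+ 2.
Proof.
elim: k x => [|k IH] x; first by rewrite !big_ord0 expr0n mul0r.
rewrite !big_ord_recr/=; move: (IH (fun i => x (widen_ord (leqnSn k) i))).
set S := \sum_(i < k) _; set Q := \sum_(i < k) _; set y := x _.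
have Q0 : 0 <= Q by apply: sumr_ge0 => i _; exact: sqr_ge0.
rewrite -natr1 -/S => h.
have [k0|k0] := eqVneq (k%:R : R) 0.
  have S0 : S = 0 by apply/eqP; rewrite -sqrf_eq0 eq_le sqr_ge0 andbT; move: h; rewrite k0 mul0r.
  by rewrite S0 k0; nra.
have kp : 0 < k%:R :> R by rewrite lt_neqAle eq_sym k0 ler0n.
have h1 : k%:R * S ^+ 2 <= k%:R * (k%:R * Q) by rewrite ler_pM2l.
have h2 := sqr_ge0 (S - k%:R * y).
rewrite -(ler_pM2l kp); nra.
Qed.

Lemma nsq_sum (k : nat) (F : 'I_k -> T -> R) : (forall i, L2 (F i)) ->
  nsq (fun x => \sum_(i < k) F i x) <= k%:R * \sum_(i < k) nsq (F i).
Proof.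
move=> F2; rewrite /nsq -Int_sum; last by move=> i; exact: (F2 i).2.
rewrite -IntZ; last by apply: ig_sum => i; exact: (F2 i).2.
apply: Int_le => [|| x]; last exact: sqr_sum_le.
- by have [] := L2_sum (index_enum 'I_k) F2.
- by apply: igZ; apply: ig_sum => i; exact: (F2 i).2.
Qed.

End L2.

(** * Boxes and open sets of R^n *)

Section rV_borel.
Context {R : realType} {n : nat}.
Local Notation Rn := 'rV[R]_n.

Lemma coord_le_norm (x : Rn) j : `|x 0 j| <= `|x|.
Proof.
rewrite (_ : `|x| = mx_norm x)// mx_normrE.
exact: (@le_bigmax _ _ _ 0 (fun ij => `|x ij.1 ij.2|) (0, j)).
Qed.

Lemma rV_norm_le (x : Rn) c : 0 <= c -> (forall j, `|x 0 j| <= c) -> `|x| <= c.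
Proof.
move=> c0 xc; rewrite (_ : `|x| = mx_norm x)// mx_normrE; apply/bigmax_leP; split=> //.
by move=> [i j] _ /=; rewrite ord1.
Qed.

Lemma rV_norm_lt (x : Rn) c : 0 < c -> (forall j, `|x 0 j| < c) -> `|x| < c.
Proof.
move=> c0 xc; rewrite (_ : `|x| = mx_norm x)// mx_normrE; apply/bigmax_ltP; split=> //.
by move=> [i j] _ /=; rewrite ord1.
Qed.

Lemma nbhs_rVP (x : Rn) (U : set Rn) : nbhs x U ->
  exists2 e : R, 0 < e & forall y : Rn, `|y - x| < e -> U y.
Proof.
move=> /nbhs_ballP[e e0 xe]; exists e => // y yx; apply: xe.
by rewrite -ball_normE/= distrC.
Qed.

Lemma dist_lt_half (a b c d e : R) : d < e / 2 -> `|a - b| < d ->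
  `|c - b| < d -> `|a - c| < e.
Proof. by rewrite !ltr_norml; lra. Qed.

Definition rcube (q : 'rV[rat]_n) (k : nat) : set Rn :=
  [set x | forall j, `|x 0 j - ratr (q 0 j)| < k.+1%:R^-1].

Lemma measurable_rV_forall (A : 'I_n -> set R) :
  (forall j, measurable (A j : set (measurableTypeR R))) ->
  measurable [set x : Rn | forall j, A j (x 0 j)].
Proof.
move=> mA; rewrite (_ : mkset _ = \bigcap_(j in [set: 'I_n])
    (@rV_coord R n j @^-1` A j)).
  apply: fin_bigcap_measurable => // j _; rewrite -[X in measurable X]setTI.
  exact: measurable_rV_coord.
by apply/seteqP; split => [x h j _|x h j]; [exact: h|exact: (h j I)].
Qed.

Lemma measurable_rcube q k : measurable (rcube q k).
Proof.
apply: (@measurable_rV_forall (fun j => [set t | `|t - ratr (q 0 j)| < k.+1%:R^-1])).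
move=> j; rewrite (_ : mkset _ = `](ratr (q 0 j) - k.+1%:R^-1), (ratr (q 0 j) + k.+1%:R^-1)[%classic)//.
by apply/seteqP; split => t /=; rewrite in_itv/= ltr_distl.
Qed.

Lemma open_measurable_rV (U : set Rn) : open U -> measurable U.
Proof.
move=> oU.
rewrite (_ : U = \bigcup_(p : 'rV[rat]_n * nat)
   (if `[< rcube p.1 p.2 `<=` U >] then rcube p.1 p.2 else set0)).
  apply: countable_bigcupT_measurable => // p.
  by case: ifPn => // _; exact: measurable_rcube.
apply/seteqP; split => [x Ux|x [p _]]; last first.
  by case: asboolP => // h; exact: h.
have /nbhs_rVP[e e0 xe] : nbhs x U by exact: open_nbhs_nbhs.
have [k ke] : exists k : nat, k.+1%:R^-1 < e / 2.
  exists (truncn (e / 2)^-1); rewrite invf_plt ?posrE ?divr_gt0//.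
  exact: truncnS_gt.
have k0 : (0 : R) < k.+1%:R^-1 by [].
have /choice[q xq] : forall j, exists q : rat, `|x 0 j - ratr q| < k.+1%:R^-1.
  move=> j.
  have /rat_in_itvoo[q] : x 0 j - k.+1%:R^-1 < x 0 j + k.+1%:R^-1.
    by rewrite ltrBlDr -addrA ltrDl addr_gt0.
  by rewrite in_itv/= => qx; exists q; rewrite distrC ltr_distl.
exists (\row_j q j, k) => //=; case: asboolP => [_|[]].
  by move=> j; rewrite mxE.
move=> y yq; apply: xe; apply: rV_norm_lt => // j.
rewrite !mxE; have h1 := xq j; have := yq j; rewrite mxE => h2.
exact: dist_lt_half ke h2 h1.
Qed.

Lemma continuous_measurable_rV (f : Rn -> R) : continuous f ->
  measurable_fun [set: Rn] f.
Proof.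
move=> cf; apply: (@measurability _ _ _ (measurableTypeR R) _ _ _ (RGenOInfty.measurableE R)).
move=> _ [_ [x ->] <-]; rewrite setTI; apply: open_measurable_rV.
apply: open_comp => // y _; exact: cf.
Qed.

Definition obox (a b : Rn) : set Rn :=
  [set x | forall j, `]a 0 j, b 0 j]%classic (x 0 j)].

Definition oboxes : set (set Rn) := [set B | exists a b, B = obox a b].

Lemma measurable_obox a b : measurable (obox a b).
Proof.
by apply: (@measurable_rV_forall (fun j => `]a 0 j, b 0 j]%classic)) => j.
Qed.

Definition bigbox (k : nat) : set Rn := obox (const_mx (- k%:R)) (const_mx k%:R).

Lemma bigbox_norm (k : nat) (x : Rn) : `|x| < k%:R -> bigbox k x.
Proof.
move=> xk j; rewrite /= in_itv/= !mxE.
have : `|x 0 j| < k%:R by exact: le_lt_trans (coord_le_norm _ _) xk.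
by rewrite ltr_norml => /andP[-> /ltW ->].
Qed.

Lemma bigbox_cover : \bigcup_k bigbox k = setT.
Proof.
apply/seteqP; split=> // x _; exists (truncn `|x|).+1 => //.
by apply: bigbox_norm; exact: truncnS_gt.
Qed.

Lemma oboxesI : setI_closed oboxes.
Proof.
move=> _ _ [a [b ->]] [c [d ->]].
exists (\row_j Num.max (a 0 j) (c 0 j)), (\row_j Num.min (b 0 j) (d 0 j)).
apply/seteqP; split=> x.
  move=> [h1 h2] j; move: (h1 j) (h2 j); rewrite /= !in_itv/= !mxE.
  move=> /andP[h11 h12] /andP[h21 h22].
  by rewrite gt_max le_min h11 h12 h21 h22.
move=> h; split=> j; move: (h j); rewrite /= !in_itv/= !mxE gt_max le_min;
  by move=> /andP[/andP[h1 h2] /andP[h3 h4]]; rewrite ?h1 ?h2 ?h3 ?h4.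
Qed.

Lemma measurable_oboxesE : measurable = <<s oboxes >>.
Proof.
apply/seteqP; split; last first.
  apply: smallest_sub; first exact: sigma_algebra_measurable.
  by move=> _ [a [b ->]]; exact: measurable_obox.
apply: smallest_sub; first exact: smallest_sigma_algebra.
move=> A; rewrite -bigcup_seq/= => -[i _ [B mB <-]]; rewrite setTI.
suff : measurable_fun [set: g_sigma_algebraType oboxes]
    (fun x : g_sigma_algebraType oboxes => rV_coord i x).
  by move=> /(_ measurableT _ mB); rewrite setTI.
apply: (@measurability _ _ (g_sigma_algebraType oboxes) (measurableTypeR R)
  setT (fun x => rV_coord i x) (@ocitv R)) => //.
move=> _ [_ [[a b] _ <-] <-]; rewrite setTI.
rewrite [X in measurable X](_ : _ = \bigcup_k
  obox (\row_j if j == i then a else - k%:R) (\row_j if j == i then b else k%:R)).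
  apply: bigcupT_measurable => k; apply: sub_sigma_algebra.
  by eexists; eexists; reflexivity.
apply/seteqP; split=> [x|x [k _]]; last first.
  by move=> /(_ i); rewrite !mxE eqxx.
move=> /= h; exists (truncn `|x|).+1 => // j; rewrite !mxE; case: eqP => [->//|_].
have := @bigbox_norm (truncn `|x|).+1 x (truncnS_gt _).
by move=> /(_ j); rewrite !mxE.
Qed.

Lemma lebesgue_obox_lty (a b : Rn) : (lebesgue_rV n (obox a b) < +oo)%E.
Proof.
rewrite (@lebesgue_rV_box R n (fun j => `]a 0 j, b 0 j]%classic))//.
rewrite ltey_eq prode_fin_num// => j _.
by rewrite lebesgue_measure_itv/=; case: ifPn.
Qed.

End rV_borel.

Section L2dct.
Context d (T : measurableType d) (R : realType) (m : {measure set T -> \bar R}).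
Implicit Types f g G : T -> R.

Lemma dctL2 (F : nat -> T -> R) f G : (forall k, measurable_fun setT (F k)) ->
  measurable_fun setT f -> L2 m G ->
  {ae m, forall x, F k x @[k --> \oo] --> f x} ->
  {ae m, forall x k, `|F k x| <= G x} ->
  L2 m f /\ nsq m (fun x => F k x - f x) @[k --> \oo] --> (0 : R).
Proof.
move=> mF mf [mG G2] FF FG.
have FG2 : {ae m, forall x k, `|F k x ^+ 2| <= G x ^+ 2}.
  apply: filterS FG => x h k; rewrite normrX lerXn2r ?nnegrE//.
  exact: le_trans (h k).
have f2 : L2 m f.
  split => //; apply: (proj1 (@dct _ _ _ m (fun k x => F k x ^+ 2) _ _ _ _ G2 _ FG2)).
  - by move=> k; exact: measurable_funX.
  - exact: measurable_funX.
  - by apply: filterS FF => x h; rewrite expr2; under eq_fun do rewrite expr2; exact: cvgM.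
split => //; rewrite [X in _ --> X](_ : 0 = \int[m]_x (cst 0 x)); last first.
  by rewrite Rintegral_cst// mul0r.
apply: (proj2 (@dct _ _ _ m (fun k x => (F k x - f x) ^+ 2) _ (fun x => 2 * G x ^+ 2 + 2 * f x ^+ 2) _ _ _ _ _)).
- by move=> k; apply: measurable_funX; exact: measurable_funB.
- exact: measurable_cst.
- by apply: igD; apply: igZ => //; exact: f2.2.
- apply: filterS FF => x h.
  rewrite (_ : cst 0 x = (f x - f x) * (f x - f x)); last by rewrite subrr mulr0.
  by under eq_fun do rewrite expr2; apply: cvgM; apply: cvgB => //; exact: cvg_cst.
- apply: filterS FG2 => x h k; rewrite ger0_norm ?sqr_ge0//.
  have := h k; rewrite ger0_norm ?sqr_ge0//.
  have := sqr_ge0 (F k x + f x); nra.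
Qed.

Lemma L2_indic (A : set T) : measurable A -> (m A < +oo)%E -> L2 m \1_A.
Proof.
move=> mA Aoo; split; first exact: measurable_indic.
have : m.-integrable setT (EFin \o \1_A : T -> \bar R).
  apply/integrableP; split; first exact/measurable_EFinP/measurable_indic.
  under eq_integral do rewrite /= ger0_norm ?ler0n//.
  by rewrite integral_indic// setIT.
apply: eq_integrable => // x _ /=; rewrite indicE; case: (x \in A) => //=;
  by rewrite ?expr1n ?expr0n.
Qed.

Lemma nsq_indic (A : set T) : measurable A -> nsq m \1_A = fine (m A).
Proof.
move=> mA; rewrite /nsq (@eq_Rintegral _ _ _ m setT (\1_A : T -> R)).
  by rewrite /Rintegral integral_indic// setIT.
by move=> x _; rewrite indicE; case: (x \in A); rewrite ?expr1n ?expr0n.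
Qed.

End L2dct.

Section translation.
Context {R : realType} {n : nat}.
Local Notation Rn := 'rV[R]_n.
Local Notation leb := (lebesgue_rV n : {measure set Rn -> \bar R}).
Local Notation L2 := (L2 leb).
Local Notation nsq := (nsq leb).
Local Notation ig := (ig leb).
Implicit Types (f g : Rn -> R) (h : Rn).

Definition tr h f : Rn -> R := fun x => f (x + h).

Lemma measurable_shift h : measurable_fun [set: Rn] (fun x : Rn => x + h).
Proof.
apply: measurable_fun_rVP => i.
rewrite (_ : _ \o _ = fun x => rV_coord i x + h 0 i); last first.
  by apply/funext => x; rewrite /= /rV_coord mxE.
by apply: (@measurable_funD _ _ _ _ (fun x : Rn => rV_coord i x : R)) => //;
  exact: measurable_rV_coord.
Qed.

Lemma measurable_tr h f : measurable_fun setT f -> measurable_fun setT (tr h f).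
Proof. by move=> mf; apply: measurableT_comp mf _; exact: measurable_shift. Qed.

Lemma lebesgue_obox (a b : Rn) :
  leb (obox a b) = (\prod_j (Num.max 0 (b 0 j - a 0 j)))%:E.
Proof.
rewrite -prodEFin.
apply: etrans (@lebesgue_rV_box R n (fun j => `]a 0 j, b 0 j]%classic) _) _ => //.
apply: eq_bigr => j _; rewrite lebesgue_measure_itv/= lte_fin.
case: ltP => ab; first by rewrite max_r ?subr_ge0 ?ltW.
by rewrite max_l ?subr_le0.
Qed.

Lemma shift_obox h (a b : Rn) :
  (fun x : Rn => x + h) @^-1` obox a b = obox (a - h) (b - h).
Proof.
by apply/seteqP; split => x H j; have := H j; rewrite /= !in_itv/= !mxE ltrBlDr lerBrDr.
Qed.

Lemma lebesgue_shift h (A : set Rn) : measurable A ->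
  pushforward leb (fun x : Rn => x + h) A = leb A.
Proof.
apply: (measure_unique oboxes bigbox); rewrite ?measurable_oboxesE//.
- exact: oboxesI.
- by move=> k; eexists; eexists; reflexivity.
- exact: bigbox_cover.
- exact: measurable_shift.
- move=> mh _ [a [b ->]]; transitivity (leb (obox (a - h) (b - h))).
    by congr (leb _); exact: shift_obox.
  rewrite !lebesgue_obox; congr (_%:E); apply: eq_bigr => j _; rewrite !mxE.
  by congr (Num.max 0 _); ring.
- move=> mh k; apply: le_lt_trans (lebesgue_obox_lty (const_mx (- k%:R) - h) (const_mx k%:R - h)).
  by rewrite -shift_obox.
Qed.

Lemma ge0_integral_shift h (f : Rn -> \bar R) : measurable_fun setT f ->
  (forall x, 0 <= f x)%E -> (\int[leb]_x f (x + h)%R = \int[leb]_x f x)%E.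
Proof.
move=> mf f0; rewrite -[LHS]/(\int[leb]_(x in (fun x : Rn => (x + h)%R) @^-1` setT) (f \o (fun x : Rn => (x + h)%R)) x)%E.
rewrite -(@ge0_integral_pushforward _ _ _ _ _ _ (measurable_shift h))//.
apply: eq_measure_integral; first exact: measurable_shift.
by move=> mphi A mA _; exact: lebesgue_shift.
Qed.

Lemma ig_shift h f : ig f -> ig (tr h f).
Proof.
move=> /[dup] /ig_meas mf /integrableP[_ fi]; apply/integrableP; split.
  by apply/measurable_EFinP; exact: measurable_tr.
rewrite (_ : (\int[_]_x _)%E = (\int[leb]_x `|(f (x + h)%R)%:E|)%E)//.
rewrite (@ge0_integral_shift h (fun x => `|(f x)%:E|%E))//.
by apply: measurableT_comp => //; exact/measurable_EFinP.
Qed.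

Lemma Int_shift h f : ig f -> \int[leb]_x f (x + h) = \int[leb]_x f x.
Proof.
move=> fi; congr fine.
rewrite -[LHS]/(\int[leb]_(x in (fun x : Rn => (x + h)%R) @^-1` setT) ((EFin \o f) \o (fun x : Rn => (x + h)%R)) x)%E.
rewrite -(@integral_pushforward _ _ _ _ _ _ (measurable_shift h))//.
- apply: eq_measure_integral; first exact: measurable_shift.
by move=> mphi A mA _; exact: lebesgue_shift.
- exact: measurable_int fi.
- exact: (ig_shift h fi).
Qed.

Lemma L2_tr h f : L2 f -> L2 (tr h f).
Proof. by move=> [mf f2]; split; [exact: measurable_tr|exact: (ig_shift h f2)]. Qed.

Lemma nsq_tr h f : L2 f -> nsq (tr h f) = nsq f.
Proof. by move=> [_ f2]; exact: (Int_shift h f2). Qed.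

Definition dtr h f : Rn -> R := fun x => f (x + h) - f x.

Lemma L2_dtr h f : L2 f -> L2 (dtr h f).
Proof. by move=> f2; apply: L2B => //; exact: L2_tr. Qed.

Lemma nsq_dtr_le h f : L2 f -> nsq (dtr h f) <= 4 * nsq f.
Proof.
move=> f2; have := nsqB_le (L2_tr h f2) f2; rewrite nsq_tr// => H.
apply: le_trans H _; lra.
Qed.

Definition tcont f := forall e : R, 0 < e ->
  exists2 r : R, 0 < r & forall h, `|h| < r -> nsq (dtr h f) <= e.

Lemma tcontD f g : L2 f -> L2 g -> tcont f -> tcont g ->
  tcont (fun x => f x + g x).
Proof.
move=> f2 g2 cf cg e e0; have e4 : 0 < e / 4 by rewrite divr_gt0.
have [r r0 fr] := cf _ e4; have [s s0 gs] := cg _ e4.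
exists (Num.min r s); first by rewrite lt_min r0.
move=> h; rewrite lt_min => /andP[hr hs].
have := nsqD_le (L2_dtr h f2) (L2_dtr h g2).
rewrite (@eq_nsq _ _ _ _ (fun x => dtr h f x + dtr h g x) (dtr h (fun x => f x + g x))).
  move=> H; apply: le_trans H _; move: (fr _ hr) (gs _ hs); lra.
by move=> x; rewrite /dtr; ring.
Qed.

Lemma tcontZ c f : L2 f -> tcont f -> tcont (fun x => c * f x).
Proof.
move=> f2 cf e e0; have c1 : 0 < c ^+ 2 + 1 by rewrite ltr_wpDl// sqr_ge0.
have [r r0 fr] := cf (e / (c ^+ 2 + 1)) (divr_gt0 e0 c1).
exists r => // h /fr H.
rewrite (@eq_nsq _ _ _ _ _ (fun x => c * dtr h f x)); last first.
  by move=> x; rewrite /dtr; ring.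
rewrite nsqZ; last exact: L2_dtr.
apply: (@le_trans _ _ ((c ^+ 2 + 1) * nsq (dtr h f))).
  by rewrite ler_wpM2r ?nsq_ge0// lerDl.
by rewrite -ler_pdivlMl// mulrC.
Qed.

Lemma tcontB f g : L2 f -> L2 g -> tcont f -> tcont g ->
  tcont (fun x => f x - g x).
Proof.
move=> f2 g2 cf cg; have := tcontD f2 (L2Z (-1) g2) cf (tcontZ (-1) g2 cg).
by under eq_fun do rewrite mulN1r.
Qed.

Lemma tcont_sum (I : Type) (s : seq I) (F : I -> Rn -> R) :
  (forall i, L2 (F i)) -> (forall i, tcont (F i)) ->
  tcont (fun x => \sum_(i <- s) F i x).
Proof.
move=> F2 cF; elim: s => [|i s IH].
  move=> e e0; exists 1 => // h _.
  rewrite (@eq_nsq _ _ _ _ _ (fun=> 0 * 0)); last by move=> x; rewrite /dtr !big_nil subrr mul0r.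
  by rewrite nsqZ ?expr0n ?mul0r ?ltW//; exact: L20.
by under eq_fun do rewrite big_cons; apply: tcontD => //; exact: L2_sum.
Qed.

Lemma tcont_lim f (F : nat -> Rn -> R) : L2 f -> (forall k, L2 (F k)) ->
  (forall k, tcont (F k)) ->
  nsq (fun x => F k x - f x) @[k --> \oo] --> (0 : R) -> tcont f.
Proof.
move=> f2 F2 cF /cvgrPdist_lt Ff e e0.
have e16 : 0 < e / 32 by rewrite divr_gt0.
have [k _ /(_ k (leqnn k))] := Ff _ e16.
rewrite sub0r normrN ger0_norm ?nsq_ge0// => Fk.
have [r r0 Fr] := cF k (e / 4) (divr_gt0 e0 (ltr0n _ 4)).
exists r => // h /Fr H.
have D2 : L2 (fun x => F k x - f x) by exact: L2B.
have := nsqB_le (L2_dtr h (F2 k)) (L2_dtr h D2).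
rewrite (@eq_nsq _ _ _ _ _ (dtr h f)); last by move=> x; rewrite /dtr; ring.
have := nsq_dtr_le h D2; move: Fk H; lra.
Qed.

End translation.

(** * Continuity of translations in L2 *)

Section translation_continuity.
Context {R : realType} {n : nat}.
Local Notation Rn := 'rV[R]_n.
Local Notation leb := (lebesgue_rV n : {measure set Rn -> \bar R}).
Local Notation L2 := (L2 leb).
Local Notation nsq := (nsq leb).
Local Notation ig := (ig leb).
Implicit Types (f g : Rn -> R) (h : Rn).

(* The layer around the face [x j = c] in which translating by less than [r]
   may change membership. *)
Definition slab (a b : Rn) (j : 'I_n) (c r : R) : set Rn :=
  obox (\row_i if i == j then c - r else a 0 i - 1)
       (\row_i if i == j then c + r else b 0 i + 1).

Lemma fine_slab a b j c r : 0 <= r -> fine (leb (slab a b j c r)) =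
  2 * r * \prod_(i | i != j) Num.max 0 (b 0 i - a 0 i + 2).
Proof.
move=> r0; rewrite lebesgue_obox/= (bigD1 j)//= !mxE eqxx max_r; last by lra.
congr (_ * _); first by lra.
by apply: eq_bigr => i /negPf ij; rewrite !mxE ij; congr (Num.max 0 _); lra.
Qed.

Lemma indic_obox_dtr (a b : Rn) r h (x : Rn) : 0 < r -> r <= 1 -> `|h| < r ->
  (dtr h \1_(obox a b) x) ^+ 2 <=
  \sum_(j < n) (\1_(slab a b j (a 0 j) (2 * r)) x + \1_(slab a b j (b 0 j) (2 * r)) x).
Proof.
move=> r0 r1 hr; rewrite /dtr.
have s0 : 0 <= \sum_(j < n) (\1_(slab a b j (a 0 j) (2 * r)) x + \1_(slab a b j (b 0 j) (2 * r)) x) :> R.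
  by apply: sumr_ge0 => j _; rewrite addr_ge0.
have hj j : `|h 0 j| < r by apply: le_lt_trans hr; exact: coord_le_norm.
have [xx|] := eqVneq (\1_(obox a b) (x + h) : R) (\1_(obox a b) x).
  by rewrite xx subrr expr0n.
rewrite !indicE => ne.
have near y : obox a b y -> (y = x \/ y = x + h) ->
    forall i, a 0 i - 1 < x 0 i <= b 0 i + 1.
  move=> yab yx i; have := yab i; have := hj i; rewrite ltr_norml /= in_itv/=.
  by case: yx => ->; rewrite ?mxE; lra.
have xQ i : a 0 i - 1 < x 0 i <= b 0 i + 1.
  have [/set_mem h1|h1] := boolP (x \in obox a b); first by apply: (near x); auto.
  have [/set_mem h2|h2] := boolP (x + h \in obox a b); first by apply: (near (x + h)); auto.
  by move: ne; rewrite (negPf h1) (negPf h2) eqxx.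
have [j jP] : exists j, (x 0 j \in `]a 0 j, b 0 j]) != (x 0 j + h 0 j \in `]a 0 j, b 0 j]).
  apply: contrapT => /forallNP H; move: ne => /negP; apply.
  rewrite (_ : (x + h \in obox a b) = (x \in obox a b))//.
  apply/idP/idP; rewrite !inE => H1 i; have := H1 i; have /negP := H i;
    by rewrite negbK /= mxE => /eqP->.
rewrite (bigD1 j)//=; apply: (@le_trans _ _ 1).
  by case: (_ \in _); case: (_ \in _); rewrite /= ?subrr ?subr0 ?sub0r ?sqrrN ?expr0n ?expr1n.
have s1 : 0 <= \sum_(i < n | i != j) (\1_(slab a b i (a 0 i) (2 * r)) x + \1_(slab a b i (b 0 i) (2 * r)) x) :> R.
  by apply: sumr_ge0 => i _; rewrite addr_ge0.
suff H : slab a b j (a 0 j) (2 * r) x \/ slab a b j (b 0 j) (2 * r) x.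
  by case: H => H; rewrite !indicE (mem_set H); case: (_ \in _) => /=; move: s1; lra.
have hh := hj j; move: hh jP; rewrite ltr_norml !in_itv/= => /andP[hh1 hh2] jP.
have inslab c : c - 2 * r < x 0 j <= c + 2 * r -> slab a b j c (2 * r) x.
  by move=> cP i; rewrite /= in_itv/= !mxE; case: eqP => [->|_].
have [h1|h1] := boolP (a 0 j - 2 * r < x 0 j <= a 0 j + 2 * r).
  by left; exact: inslab.
right; apply: inslab; apply/andP.
move: jP h1; rewrite !negb_and -!ltNge -!leNgt.
case: (ltP (a 0 j) (x 0 j)) => ax; case: (leP (x 0 j) (b 0 j)) => xb;
 case: (ltP (a 0 j) (x 0 j + h 0 j)) => axh; case: (leP (x 0 j + h 0 j) (b 0 j)) => xhb //= _ /orP[]; split; lra.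
Qed.

Lemma L2_obox (a b : Rn) : L2 \1_(obox a b).
Proof. by apply: L2_indic; [exact: measurable_obox|exact: lebesgue_obox_lty]. Qed.

Lemma tcont_obox (a b : Rn) : tcont \1_(obox a b).
Proof.
move=> e e0; pose C : R := \sum_(j < n) 8 * \prod_(i | i != j) Num.max 0 (b 0 i - a 0 i + 2).
have C0 : 0 <= C.
  by apply: sumr_ge0 => j _; rewrite mulr_ge0// prodr_ge0// => i _; rewrite le_max lexx.
pose r := Num.min 1 (e / (C + 1)).
have C1 : 0 < C + 1 by rewrite ltr_wpDl.
have r0 : 0 < r by rewrite lt_min ltr01 divr_gt0.
have r1 : r <= 1 by rewrite ge_min lexx.
exists r => // h hr.
have si j c : ig (\1_(slab a b j c (2 * r))).
  have [mi] := L2_obox (\row_i if i == j then c - 2 * r else a 0 i - 1) (\row_i if i == j then c + 2 * r else b 0 i + 1).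
  by apply: eq_integrable => // x _; rewrite /= indicE; case: (_ \in _); rewrite ?expr0n ?expr1n.
have iS j : ig (fun x => \1_(slab a b j (a 0 j) (2 * r)) x + \1_(slab a b j (b 0 j) (2 * r)) x).
  by apply: igD; exact: si.
apply: (@le_trans _ _ (\int[leb]_x \sum_(j < n) (\1_(slab a b j (a 0 j) (2 * r)) x + \1_(slab a b j (b 0 j) (2 * r)) x))).
  apply: Int_le.
  - exact: (L2_dtr h (L2_obox a b)).2.
  - exact: ig_sum.
  - by move=> x; exact: indic_obox_dtr.
rewrite Int_sum//.
under eq_bigr => j _.
  rewrite IntD ?si// /Rintegral !integral_indic ?setIT//; last 2 first.
  - exact: measurable_obox.
  - exact: measurable_obox.
  rewrite !fine_slab ?mulr_ge0 ?ltW// (_ : _ + _ = r * (8 * \prod_(i | i != j) Num.max 0 (b 0 i - a 0 i + 2))); last by ring.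
  over.
rewrite -mulr_sumr -/C; apply: (@le_trans _ _ (e / (C + 1) * C)).
  by rewrite ler_wpM2r// ge_min lexx orbT.
rewrite mulrAC ler_pdivrMr// ler_wpM2l ?ltW//; lra.
Qed.

Lemma lebesgue_bigboxI_lty (A : set Rn) k : measurable A ->
  (leb (A `&` bigbox k) < +oo)%E.
Proof.
move=> mA; apply: le_lt_trans (lebesgue_obox_lty (const_mx (- k%:R)) (const_mx k%:R)).
by apply: le_measure; rewrite ?inE//; [apply: measurableI => //|]; exact: measurable_obox.
Qed.

Lemma L2_bigboxI (A : set Rn) k : measurable A -> L2 \1_(A `&` bigbox k).
Proof.
move=> mA; apply: L2_indic; last exact: lebesgue_bigboxI_lty.
by apply: measurableI => //; exact: measurable_obox.
Qed.

Lemma tcont_indic (A : set Rn) k : measurable A -> tcont \1_(A `&` bigbox k).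
Proof.
pose P := [set A : set Rn | measurable A /\ tcont \1_(A `&` bigbox k)].
suff : <<s oboxes >> `<=` P by rewrite -measurable_oboxesE => H /H [].
apply: lambda_system_subset => //.
- exact: oboxesI.
- split => //.
  + by split => //; rewrite setTI; exact: tcont_obox.
  + move=> D B BD [mD cD] [mB cB]; split; first exact: measurableD.
    rewrite (_ : \1_(_ `&` _) = fun x => \1_(D `&` bigbox k) x - \1_(B `&` bigbox k) x); last first.
      apply/funext => x; rewrite setDE !indicE !in_setI in_setC.
      have [xB|xB] := boolP (x \in B); last by rewrite andbT subr0.
      have -> : x \in D by apply/mem_set/BD/set_mem.
      by rewrite andbF subrr.
    by apply: tcontB => //; exact: L2_bigboxI.
  + move=> F ndF FP; have mF i : measurable (F i) by have [] := FP i.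
    split; first exact: bigcupT_measurable.
    have mU : measurable (\bigcup_i F i) by exact: bigcupT_measurable.
    apply: (@tcont_lim _ _ _ (fun i => \1_(F i `&` bigbox k))).
    * exact: L2_bigboxI.
    * by move=> i; exact: L2_bigboxI.
    * by move=> i; have [] := FP i.
    * apply: (proj2 (@dctL2 _ _ _ _ (fun i => \1_(F i `&` bigbox k)) _ (\1_(setT `&` bigbox k)) _ _ _ _ _)).
      - by move=> i; exact: (L2_bigboxI _ _).1.
      - exact: (L2_bigboxI _ _).1.
      - exact: L2_bigboxI.
      - apply: aeW => x; rewrite indicE in_setI.
        have [xU|xU] := boolP (x \in \bigcup_i F i); last first.
          rewrite (_ : (fun _ => _) = cst 0); first exact: cvg_cst.
          apply/funext => i; rewrite indicE in_setI (_ : x \in F i = false)//.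
          by apply: contraNF xU; rewrite !inE => Fx; exists i.
        move: xU; rewrite inE => -[i _ Fx]; apply: cvg_near_cst.
        exists i => // j /= ij; rewrite indicE in_setI (_ : x \in F j)//.
        by rewrite inE; move: Fx; exact/subsetPset/ndF.
      - apply: aeW => x i; rewrite ger0_norm// !indicE !in_setI in_setT.
        by case: (x \in F i).
- move=> B [a [b ->]]; split; first exact: measurable_obox.
  have [c [d ->]] := oboxesI (ex_intro _ a (ex_intro _ b erefl)) (ex_intro _ (const_mx (- k%:R)) (ex_intro _ (const_mx k%:R) erefl)).
  exact: tcont_obox.
Qed.

End translation_continuity.

Section tcont_L2.
Context {R : realType} {n : nat}.
Local Notation Rn := 'rV[R]_n.
Local Notation leb := (lebesgue_rV n : {measure set Rn -> \bar R}).
Local Notation L2 := (L2 leb).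
Local Notation nsq := (nsq leb).
Local Notation ig := (ig leb).
Implicit Types (f g : Rn -> R) (h : Rn).

Import HBNNSimple.

Lemma tcont_nnsfun (g : {nnsfun Rn >-> R}) k :
  L2 (fun x => g x * \1_(bigbox k) x) /\ tcont (fun x => g x * \1_(bigbox k) x).
Proof.
rewrite (_ : (fun x => _) = fun x => \sum_(y <- finmap.enum_fset (fset_set (range g)))
    (y * \1_(g @^-1` [set y] `&` bigbox k) x)).
  split; first by apply: L2_sum => y; apply: L2Z; exact: L2_bigboxI.
  apply: tcont_sum => y; first by apply: L2Z; exact: L2_bigboxI.
  by apply: tcontZ; [exact: L2_bigboxI|exact: tcont_indic].
apply/funext => x; rewrite {1}(fimfunE g x) fsbig_finite//= big_distrl/=.
by apply: eq_bigr => y _; rewrite indicI -mulrA.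
Qed.

Lemma tcont_ge0 f : L2 f -> (forall x, 0 <= f x) -> tcont f.
Proof.
move=> [mf f2] f0; have mEf : measurable_fun setT (EFin \o f) by exact/measurable_EFinP.
pose g k := nnsfun_approx measurableT mEf k.
pose F k x := g k x * \1_(bigbox k) x.
have gf k x : g k x <= f x.
  by rewrite -lee_fin /g nnsfun_approxE; apply: le_approx => // y _; rewrite lee_fin.
have F2 k := tcont_nnsfun (g k) k.
apply: (@tcont_lim _ _ _ F) => //; [by move=> k; exact: (F2 k).1|by move=> k; exact: (F2 k).2|].
apply: (proj2 (@dctL2 _ _ _ _ F _ f _ _ _ _ _)) => //.
- by move=> k; exact: (F2 k).1.1.
- apply: aeW => x; rewrite -[X in _ --> X]mulr1; apply: cvgM.
    have := @cvg_nnsfun_approx _ _ _ _ measurableT _ mEf (fun y _ => f0 y) x I.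
    by move=> /fine_cvg.
  apply: cvg_near_cst; exists (truncn `|x|).+1 => // k /= kx.
  rewrite indicE mem_set//; apply: bigbox_norm.
  by rewrite (lt_le_trans (truncnS_gt _))// ler_nat.
- apply: aeW => x k; rewrite /F ger0_norm ?mulr_ge0//.
  by rewrite (le_trans _ (gf k x))// ler_piMr// indicE; case: (_ \in _).
Qed.

Lemma tcont_L2 f : L2 f -> tcont f.
Proof.
move=> [mf f2].
have p2 : L2 (fun x => Num.max (f x) 0).
  apply: (@L2_le _ _ _ _ 1 _ f) => //; first exact: measurable_maxr.
  by move=> x; rewrite mul1r; case: (leP (f x) 0) => fx; rewrite ?normr0.
have n2 : L2 (fun x => Num.max (- f x) 0).
  apply: (@L2_le _ _ _ _ 1 _ f) => //.
    by apply: measurable_maxr => //; exact: measurableT_comp.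
  by move=> x; rewrite mul1r; case: (leP (- f x) 0) => fx; rewrite ?normr0// normrN.
have -> : f = fun x => Num.max (f x) 0 - Num.max (- f x) 0.
  apply/funext => x; case: (leP (f x) 0) => fx; case: (leP (- f x) 0) => fx'; lra.
by apply: tcontB => //; apply: tcont_ge0 => // x; rewrite le_max lexx orbT.
Qed.

End tcont_L2.

Lemma measurable_Int d1 d2 (T1 : measurableType d1) (T2 : measurableType d2)
    (R : realType) (m2 : {sigma_finite_measure set T2 -> \bar R}) (f : T1 * T2 -> R) :
  measurable_fun setT f -> measurable_fun setT (fun x => \int[m2]_y f (x, y)).
Proof.
move=> mf; have mEf : measurable_fun setT (EFin \o f) by exact/measurable_EFinP.
apply: measurableT_comp => //.
rewrite (_ : (fun x => _) = (fun x => (\int[m2]_y (EFin \o f)^\+ (x, y) - \int[m2]_y (EFin \o f)^\- (x, y))%E)).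
  by apply: emeasurable_funB; apply: measurable_fun_fubini_tonelli_F => //;
    [exact: measurable_funepos|exact: measurable_funeneg].
apply/funext => x; rewrite [LHS](_ : _ = (\int[m2]_y (EFin \o f) (x, y))%E)//.
rewrite [LHS]integralE.
under eq_integral do rewrite funepos_comp/=.
by under [X in (_ - X)%E = _]eq_integral do rewrite funeneg_comp/=.
Qed.

Section young.
Context {R : realType} {n : nat}.
Local Notation Rn := 'rV[R]_n.
Local Notation leb := (lebesgue_rV n : {measure set Rn -> \bar R}).
Local Notation L2 := (L2 leb).
Local Notation nsq := (nsq leb).
Local Notation ig := (ig leb).
Implicit Types (f g k : Rn -> R) (h : Rn).

Lemma nsq_Int_le (F : Rn * Rn -> R) (w : Rn -> R) (W B : R) :
  measurable_fun setT F -> ig w -> (forall y, 0 <= w y) ->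
  \int[leb]_y w y <= W -> 0 < W -> 0 <= B ->
  (forall y, w y != 0 -> L2 (fun x => F (x, y)) /\ nsq (fun x => F (x, y)) <= B) ->
  let Phi x := \int[leb]_y (F (x, y) * w y) in
  L2 Phi /\ nsq Phi <= W ^+ 2 * B.
Proof.
move=> mF wi w0 wW W0 B0 FB Phi.
have mw := ig_meas wi.
have mFw : measurable_fun setT (fun z : Rn * Rn => F z * w z.2).
  by apply: measurable_funM => //; apply: measurableT_comp.
have mPhi : measurable_fun setT Phi by exact: (measurable_Int (lebesgue_rV n) mFw).
have mG : measurable_fun setT (fun z : Rn * Rn => (F z ^+ 2 * w z.2)%:E).
  apply/measurable_EFinP; apply: measurable_funM; first exact: measurable_funX.
  exact: measurableT_comp.
have G0 z : (0 <= (F z ^+ 2 * w z.2)%:E)%E by rewrite lee_fin mulr_ge0// sqr_ge0.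
have PhiE x : ((Phi x ^+ 2)%:E <= W%:E * \int[leb]_y (F (x, y) ^+ 2 * w y)%:E)%E.
  have mFx : measurable_fun setT (fun y => F (x, y)) by exact: measurableT_comp.
  have mx2 : measurable_fun setT (fun y => F (x, y) ^+ 2 * w y).
    by apply: measurable_funM => //; exact: measurable_funX.
  have [/[dup] ix|ix] := pselect (ig (fun y => F (x, y) ^+ 2 * w y)); last first.
    rewrite [X in (_ * X)%E](_ : _ = +oo%E); first by rewrite (gt0_muley (x := W%:E)) ?lte_fin//; exact: leey.
    apply: contrapT => /eqP noo; apply: ix; apply/integrableP; split; first exact/measurable_EFinP.
    rewrite lt_neqAle leey andbT; apply: contra noo => /eqP <-; apply/eqP.
    by apply: eq_integral => y _ /=; rewrite ger0_norm// mulr_ge0// sqr_ge0.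
  move=> _; rewrite -EFin_Int// -EFinM lee_fin.
  have ms : measurable_fun setT (fun y => Num.sqrt (w y)).
    by apply: measurableT_comp => //; by apply: continuous_measurable_fun; exact: sqrt_continuous.
  have h1 : L2 (fun y => F (x, y) * Num.sqrt (w y)).
    split; first exact: measurable_funM.
    apply: eq_integrable ix => // y _ /=; by rewrite exprMn sqr_sqrtr.
  have h2 : L2 (fun y => Num.sqrt (w y)).
    split => //; apply: eq_integrable wi => // y _ /=; by rewrite sqr_sqrtr.
  have := CS h1 h2.
  rewrite (@eq_Rintegral _ _ _ _ _ (fun y => F (x, y) * w y)); last first.
    by move=> y _; rewrite -mulrA -expr2 sqr_sqrtr.
  move=> H; apply: le_trans H _; rewrite mulrC.
  rewrite /nsq (@eq_Rintegral _ _ _ _ _ w); last by move=> y _; rewrite sqr_sqrtr.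
  rewrite [X in _ * X](@eq_Rintegral _ _ _ _ _ (fun y => F (x, y) ^+ 2 * w y)); last first.
    by move=> y _; rewrite exprMn sqr_sqrtr.
  by apply: ler_wpM2r => //; apply: Int_ge0 => y; rewrite mulr_ge0// sqr_ge0.
have le1 : (\int[leb]_x (Phi x ^+ 2)%:E <= (W ^+ 2 * B)%:E)%E.
  apply: (@le_trans _ _ (\int[leb]_x (W%:E * \int[leb]_y (F (x, y) ^+ 2 * w y)%:E))%E).
    apply: ge0_le_integral => //.
    - by move=> x _; rewrite lee_fin sqr_ge0.
    - by apply/measurable_EFinP; exact: measurable_funX.
    - apply: measurable_funeM.
      exact: (measurable_fun_fubini_tonelli_F (m2 := lebesgue_rV n) (fun z : Rn * Rn => (F z ^+ 2 * w z.2)%:E)).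
  rewrite ge0_integralZl//; last 3 first.
  - exact: (measurable_fun_fubini_tonelli_F (m2 := lebesgue_rV n) (fun z : Rn * Rn => (F z ^+ 2 * w z.2)%:E)).
  - by move=> x _; exact: integral_ge0.
  - by rewrite lee_fin ltW.
  rewrite expr2 -mulrA EFinM; apply: lee_wpmul2l; first by rewrite lee_fin ltW.
  rewrite (@fubini_tonelli _ _ _ _ _ (lebesgue_rV n) (lebesgue_rV n) (fun z : Rn * Rn => (F z ^+ 2 * w z.2)%:E))//=.
  apply: (@le_trans _ _ (\int[leb]_y (B * w y)%:E)%E).
    apply: ge0_le_integral => //.
    - by move=> y _; apply: integral_ge0.
    - exact: (measurable_fun_fubini_tonelli_G (m1 := lebesgue_rV n) (fun z : Rn * Rn => (F z ^+ 2 * w z.2)%:E)).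
    - by apply/measurable_EFinP; exact: measurable_funM.
    move=> y _; have [wy|wy] := eqVneq (w y) 0.
      by rewrite wy mulr0 (eq_integral (cst 0%E)) ?integral0// => x _; rewrite mulr0.
    have [[_ F2] FyB] := FB _ wy.
    have iFw : ig (fun x => w y * F (x, y) ^+ 2) by exact: igZ.
    rewrite (eq_integral (fun x => (w y * F (x, y) ^+ 2)%:E)); last by move=> x _; rewrite mulrC.
    rewrite -EFin_Int// IntZ// lee_fin mulrC; exact: ler_wpM2r.
  by rewrite -EFin_Int; [rewrite IntZ// lee_fin mulrC ler_wpM2r|exact: igZ].
have P2 : L2 Phi.
  split => //; apply/integrableP; split; first by apply/measurable_EFinP; exact: measurable_funX.
  apply: le_lt_trans (ltry (W ^+ 2 * B)); apply: le_trans le1.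
  by rewrite le_eqVlt; apply/orP; left; apply/eqP/eq_integral => x _ /=; rewrite ger0_norm ?sqr_ge0.
split => //; rewrite -lee_fin /nsq EFin_Int//; exact: P2.2.
Qed.

End young.

(** * Convolution *)

Section cvl.
Context {R : realType} {n : nat}.
Local Notation Rn := 'rV[R]_n.
Local Notation leb := (lebesgue_rV n : {measure set Rn -> \bar R}).
Local Notation L2 := (L2 leb).
Local Notation nsq := (nsq leb).
Local Notation ig := (ig leb).
Implicit Types (f g k rho : Rn -> R) (h : Rn).

Definition kern (c : R) (N : nat) k :=
  measurable_fun setT k /\ forall x, `|k x| <= c * \1_(bigbox N) x.

Definition bvol (N : nat) : R := fine (leb (bigbox N)) + 1.

Lemma bvol_gt0 N : 0 < bvol N.
Proof. by rewrite ltr_wpDl// fine_ge0. Qed.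

Lemma L2_bigbox N : L2 \1_(bigbox N).
Proof. exact: L2_obox. Qed.

Lemma ig_bigbox N : ig \1_(bigbox N).
Proof.
have [_] := L2_bigbox N; apply: eq_integrable => // x _.
by rewrite /= indicE; case: (_ \in _); rewrite ?expr0n ?expr1n.
Qed.

Lemma kern_L2 c N k : kern c N k -> L2 k.
Proof.
move=> [mk kc]; apply: (@L2_le _ _ _ _ c _ \1_(bigbox N)) => //.
  exact: L2_bigbox.
by move=> x; rewrite [X in _ * X]ger0_norm.
Qed.

Lemma kern_ig c N k : kern c N k -> ig k.
Proof.
by move=> [mk kc]; apply: (ig_le mk (igZ c (ig_bigbox N))).
Qed.

Definition cvl f k : Rn -> R := fun x => \int[leb]_y (f (x + y) * k y).

Lemma measurable_rV_add : measurable_fun [set: Rn * Rn] (fun z => z.1 + z.2).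
Proof.
apply: measurable_fun_rVP => i.
rewrite (_ : _ \o _ = fun z => rV_coord i z.1 + rV_coord i z.2); last first.
  by apply/funext => z; rewrite /= /rV_coord mxE.
by apply: (@measurable_funD _ _ _ _ (fun z : Rn * Rn => rV_coord i z.1 : R)) => //;
  apply: measurableT_comp => //; exact: measurable_rV_coord.
Qed.

Lemma ig_conv f k x : L2 f -> L2 k -> ig (fun y => f (x + y) * k y).
Proof.
move=> f2 k2; rewrite (_ : (fun y => _) = fun y => tr x f y * k y).
  by apply: L2M => //; exact: L2_tr.
by apply/funext => y; rewrite /tr addrC.
Qed.

Lemma convE f k x : L2 f -> L2 k ->
  cvl f k x = \int[leb]_y (f y * k (y - x)).
Proof.
move=> f2 k2; have /(Int_shift x) <- : ig (fun y => f y * k (y - x)).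
  by apply: L2M => //; exact: (L2_tr (- x) k2).
by apply: eq_Rintegral => y _; rewrite addrK addrC.
Qed.

Lemma conv_tr h f k x : cvl (tr h f) k x = cvl f k (x + h).
Proof. by apply: eq_Rintegral => y _; rewrite /tr addrAC. Qed.

Lemma convZ c f k x : L2 f -> L2 k ->
  cvl (fun x => c * f x) k x = c * cvl f k x.
Proof.
move=> f2 k2; rewrite -IntZ; last exact: ig_conv.
by apply: eq_Rintegral => y _; rewrite mulrA.
Qed.

Lemma convB f g k x : L2 f -> L2 g -> L2 k ->
  cvl (fun x => f x - g x) k x = cvl f k x - cvl g k x.
Proof.
move=> f2 g2 k2; rewrite -IntB; [|exact: ig_conv|exact: ig_conv].
by apply: eq_Rintegral => y _; rewrite mulrBl.
Qed.

Lemma conv_dtr h f k x : L2 f -> L2 k -> cvl (dtr h f) k x = dtr h (cvl f k) x.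
Proof.
by move=> f2 k2; rewrite /dtr (convB _ (L2_tr h f2))// conv_tr.
Qed.

Lemma conv_kern f c N k : L2 f -> kern c N k ->
  L2 (cvl f k) /\ nsq (cvl f k) <= (c * bvol N) ^+ 2 * nsq f.
Proof.
move=> f2 [mk kc].
have kE y : k y * \1_(bigbox N) y = k y.
  rewrite indicE; have [yN|yN] := boolP (y \in bigbox N); first by rewrite mulr1.
  have := kc y; rewrite indicE (negPf yN) mulr0 normr_le0 => /eqP ->.
  by rewrite mul0r.
have -> : cvl f k = fun x => \int[leb]_y ((f (x + y) * k y) * \1_(bigbox N) y).
  by apply/funext => x; apply: eq_Rintegral => y _; rewrite -mulrA kE.
have -> : (c * bvol N) ^+ 2 * nsq f = bvol N ^+ 2 * (c ^+ 2 * nsq f) by ring.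
apply: (@nsq_Int_le _ _ (fun z => f (z.1 + z.2) * k z.2) (\1_(bigbox N)) (bvol N)).
- apply: measurable_funM; last exact: measurableT_comp.
  by apply: measurableT_comp; [exact: f2.1|exact: measurable_rV_add].
- exact: ig_bigbox.
- by [].
- by rewrite /Rintegral integral_indic ?setIT ?lerDl//; exact: measurable_obox.
- exact: bvol_gt0.
- by rewrite mulr_ge0 ?nsq_ge0 ?sqr_ge0.
- move=> y /=; rewrite indicE; have [yN _|_] := boolP (y \in bigbox N); last by rewrite eqxx.
  split.
    by under eq_fun do rewrite mulrC; apply: L2Z; exact: (L2_tr y f2).
  rewrite (@eq_nsq _ _ _ _ _ (fun x => k y * tr y f x)); last by move=> x; rewrite mulrC.
  rewrite nsqZ ?nsq_tr//; last exact: L2_tr.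
  rewrite ler_wpM2r ?nsq_ge0// -[k y ^+ 2]real_normK ?num_real//.
  have kyc : `|k y| <= c by have := kc y; rewrite indicE yN mulr1.
  by rewrite lerXn2r ?nnegrE//; exact: le_trans kyc.
Qed.

Lemma conv_avg_le f rho c N : L2 f -> kern c N rho -> (forall y, 0 <= rho y) ->
  \int[leb]_y rho y = 1 -> nsq (cvl f rho) <= nsq f.
Proof.
move=> f2 k0 rho0 rho1; rewrite -[leRHS]mul1r -[X in X * _](expr1n _ 2).
apply: (proj2 (@nsq_Int_le _ _ (fun z => f (z.1 + z.2)) rho 1 (nsq f) _ _ _ _ _ _ _)) => //.
- by apply: measurableT_comp; [exact: f2.1|exact: measurable_rV_add].
- exact: kern_ig k0.
- by rewrite rho1.
- exact: nsq_ge0.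
- by move=> y _; split; [exact: (L2_tr y f2)|rewrite -[leRHS](nsq_tr y f2)].
Qed.

Lemma conv_approx f rho c N (r B : R) : L2 f -> kern c N rho -> (forall y, 0 <= rho y) ->
  \int[leb]_y rho y = 1 -> (forall y, rho y != 0 -> `|y| < r) ->
  0 <= B -> (forall h, `|h| < r -> nsq (dtr h f) <= B) ->
  nsq (fun x => cvl f rho x - f x) <= B.
Proof.
move=> f2 k0 rho0 rho1 rhor B0 fB; rewrite -[leRHS]mul1r -[X in X * _](expr1n _ 2).
have ri := kern_ig k0; have r2 := kern_L2 k0.
rewrite (@eq_nsq _ _ _ _ _ (fun x : Rn => \int[leb]_y ((f (x + y) - f x) * rho y))); last first.
  move=> x; under [RHS]eq_Rintegral do rewrite mulrBl.
  rewrite IntB; [|exact: ig_conv|exact: igZ].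
  by rewrite IntZ// rho1 mulr1.
apply: (proj2 (@nsq_Int_le _ _ (fun z => f (z.1 + z.2) - f z.1) rho 1 B _ _ _ _ _ _ _)) => //.
- apply: measurable_funB; last by apply: measurableT_comp => //; exact: f2.1.
  by apply: measurableT_comp; [exact: f2.1|exact: measurable_rV_add].
- by rewrite rho1.
- by move=> y /rhor yr; split; [exact: (L2_dtr y f2)|exact: fB].
Qed.

End cvl.

(** * Smooth functions *)

Lemma is_deriveP (R : realType) (V : normedModType R) (f : V -> R) (x v : V) (df : R) :
  is_derive x v f df <-> forall e : R, 0 < e -> exists2 r : R, 0 < r &
    forall t, `|t| < r -> `|f (x + t *: v) - f x - t * df| <= e * `|t|.
Proof.
have key : (h^-1 *: ((f \o shift x) (h *: v) - f x)) @[h --> 0^'] --> df <->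
  forall e : R, 0 < e -> exists2 r : R, 0 < r &
    forall t, `|t| < r -> `|f (x + t *: v) - f x - t * df| <= e * `|t|.
  have qE t : t != 0 -> t^-1 *: ((f \o shift x) (t *: v) - f x) - df =
      t^-1 * (f (x + t *: v) - f x - t * df).
    by move=> t0; rewrite /= [t *: v + x]addrC mulrBr mulrA mulVf// mul1r.
  split=> [/cvgrPdist_le H e e0|H].
    have /nbhs_ballP[r r0 Hr] := H e e0; exists r => // t tr.
    have [->|t0] := eqVneq t 0.
      by rewrite scale0r addr0 subrr mul0r subr0 normr0 mulr0.
    have : `|df - t^-1 *: ((f \o shift x) (t *: v) - f x)| <= e.
      by apply: Hr => //; rewrite -ball_normE/= sub0r normrN.
    by rewrite distrC qE// normrM normfV ler_pdivrMl ?normr_gt0// [leRHS]mulrC.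
  apply/cvgrPdist_le => e e0; have [r r0 Hr] := H e e0.
  exists r => //= t /=; rewrite sub0r normrN => tr t0.
  rewrite distrC qE// normrM normfV ler_pdivrMl ?normr_gt0// [leRHS]mulrC.
  exact: Hr.
split=> [[/cvg_ex[l fl] dfE]|/key H].
  apply/key; rewrite -dfE /derive; have -> := cvg_lim _ fl => //.
by split; [apply/cvg_ex; exists df|exact: cvg_lim].
Qed.

Section Ck_theory.
Context {R : realType} {n : nat}.
Local Notation Rn := 'rV[R]_n.
Implicit Types (u v : Rn -> R).

Definition e_ (i : 'I_n) : Rn := delta_mx 0 i.

Lemma cont_add u v : continuous u -> continuous v -> continuous (fun x => u x + v x).
Proof. by move=> cu cv x; apply: continuousD; [exact: cu|exact: cv]. Qed.

Lemma cont_mul u v : continuous u -> continuous v -> continuous (fun x => u x * v x).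
Proof. by move=> cu cv x; apply: continuousM; [exact: cu|exact: cv]. Qed.

Lemma cont_tr u (h : Rn) : continuous u -> continuous (fun x : Rn => u (x + h)).
Proof.
move=> cu x; apply: (@continuous_comp _ _ _ (fun x : Rn => x + h) u); last exact: cu.
by apply: (@continuousD _ _ _ id (cst h)) => //; exact: cst_continuous.
Qed.

Lemma CkW k v : Ck k.+1 v -> Ck k v.
Proof.
elim: k v => [v [cv _ _]//|k IH v [cv dv pv]]; split => // i.
by apply: IH; exact: pv.
Qed.

Lemma partialE u i x df : is_derive x (e_ i) u df -> partial i u x = df.
Proof. by move=> [_]. Qed.

Lemma derivable_partial u i x : derivable u x (e_ i) -> is_derive x (e_ i) u (partial i u x).
Proof. by move=> du; split. Qed.

Lemma Ck_add k u v : Ck k u -> Ck k v -> Ck k (fun x => u x + v x).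
Proof.
elim: k u v => [u v|k IH u v [cu du pu] [cv dv pv]].
  exact: cont_add.
split => [|i x|i]; first exact: cont_add.
  exact: (derivableD (du i x) (dv i x)).
rewrite (_ : partial i _ = fun x => partial i u x + partial i v x).
  by apply: IH; [exact: pu|exact: pv].
by apply/funext => x; exact: (deriveD (du i x) (dv i x)).
Qed.

Lemma Ck_mul k u v : Ck k u -> Ck k v -> Ck k (fun x => u x * v x).
Proof.
elim: k u v => [u v|k IH u v /[dup] Cu [cu du pu] /[dup] Cv [cv dv pv]].
  exact: cont_mul.
split => [|i x|i]; first exact: cont_mul.
  exact: (derivableM (du i x) (dv i x)).
rewrite (_ : partial i _ = fun x => u x * partial i v x + v x * partial i u x).
  by apply: Ck_add; apply: IH; [exact: CkW|exact: pv|exact: CkW|exact: pu].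
by apply/funext => x; exact: (deriveM (du i x) (dv i x)).
Qed.

Lemma Ck_cst k (c : R) : Ck k (fun _ : Rn => c).
Proof.
elim: k c => [c|k IH c]; first exact: cst_continuous.
split => [|i x|i]; [exact: cst_continuous|exact: derivable_cst|].
rewrite (_ : partial i _ = fun=> 0); first exact: IH.
by apply/funext => x; exact: derive_cst.
Qed.

Lemma Ck_prod k (I : Type) (s : seq I) (F : I -> Rn -> R) :
  (forall i, Ck k (F i)) -> Ck k (fun x => \prod_(i <- s) F i x).
Proof.
move=> FC; elim: s => [|i s IH].
  by under eq_fun do rewrite big_nil; exact: Ck_cst.
by under eq_fun do rewrite big_cons; exact: Ck_mul.
Qed.

Lemma is_derive_tr u (h x v : Rn) df :
  is_derive (x + h) v u df <-> is_derive x v (fun y : Rn => u (y + h)) df.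
Proof.
split => /is_deriveP H; apply/is_deriveP => e /H[r r0 Hr]; exists r => // t /Hr.
  by rewrite /= [x + t *: v + h]addrAC.
by rewrite /= [x + t *: v + h]addrAC.
Qed.

Lemma partial_tr u h i x : derivable u (x + h) (e_ i) ->
  partial i (fun y : Rn => u (y + h)) x = partial i u (x + h).
Proof. by move=> du; apply/partialE/is_derive_tr; exact: derivable_partial. Qed.

Lemma Ck_tr k u h : Ck k u -> Ck k (fun x : Rn => u (x + h)).
Proof.
elim: k u => [u|k IH u [cu du pu]]; first exact: cont_tr.
split => [|i x|i]; first exact: cont_tr.
  have [//] : is_derive x (e_ i) (fun x : Rn => u (x + h)) (partial i u (x + h)).
  by apply/is_derive_tr; exact: derivable_partial.
rewrite (_ : partial i _ = fun x : Rn => partial i u (x + h)).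
  by apply: IH; exact: pu.
by apply/funext => x; exact: partial_tr.
Qed.

End Ck_theory.

Section bump.
Context {R : realType}.

Definition bm (m : nat) (t : R) : R :=
  if 0 < t then t^-1 ^+ m * expR (- t^-1) else 0.

Lemma bm_ge0 m t : 0 <= bm m t.
Proof.
by rewrite /bm; case: ifPn => // t0; rewrite mulr_ge0 ?expR_ge0// exprn_ge0// invr_ge0 ltW.
Qed.

Lemma bm_le m t : bm m t <= (m.+2)`!%:R * t ^+ 2.
Proof.
rewrite /bm; case: ifPn => t0; last by rewrite mulr_ge0// sqr_ge0.
have s0 : 0 < t^-1 by rewrite invr_gt0.
have := @expR_ge1Dxn _ _ m.+1 (ltW s0) => H.
have f0 : (0 : R) < (m.+2)`!%:R by rewrite ltr0n fact_gt0.
have {H} : t^-1 ^+ m.+2 <= (m.+2)`!%:R * expR t^-1.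
  rewrite mulrC -ler_pdivrMr//; apply: le_trans H; lra.
have E0 := expR_gt0 t^-1.
rewrite expRN ler_pdivrMr// 2!exprSr => H.
have t2 : 0 < t ^+ 2 by rewrite exprn_gt0.
rewrite -(ler_pM2r t2) in H; apply: le_trans (le_trans _ H) _.
  have tV : t^-1 * t = 1 by rewrite mulVf// gt_eqF.
  rewrite (_ : _ * t ^+ 2 = t^-1 ^+ m * (t^-1 * t) * (t^-1 * t)); last by ring.
  by rewrite tV !mulr1.
by rewrite mulrAC.
Qed.

Lemma is_derive_bm (m : nat) (t : R) : is_derive t 1 (bm m) (- m%:R * bm m.+1 t + bm m.+2 t).
Proof.
have [t0|t0|->] := ltrgtP t 0.
- have -> : - m%:R * bm m.+1 t + bm m.+2 t = 0.
    by rewrite /bm ltNge (ltW t0)/= mulr0 addr0.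
  apply/is_deriveP => e e0; exists (- t); first by rewrite oppr_gt0.
  move=> s; rewrite ltr_norml opprK => /andP[_ st].
  have st0 : t + s *: 1 <= 0 by rewrite /GRing.scale/= mulr1; move: st; lra.
  by rewrite /bm !ltNge st0 (ltW t0)/= mulr0 !subr0 normr0 mulr_ge0// ltW.
- apply: (@near_eq_is_derive R R R (fun t => t^-1 ^+ m * expR (- t^-1))).
    near=> s; rewrite /bm (_ : 0 < s)//.
    by near: s; exact: lt_nbhsr.
  have tn0 : t != 0 by rewrite gt_eqF.
  rewrite /bm t0.
  have dV : is_derive t 1 (fun s : R => s^-1) (- t ^- 2 *: 1).
    exact: (@is_deriveV _ id).
  have dN : is_derive t 1 (fun s : R => - s^-1) (- (- t ^- 2 *: 1)).
    exact: is_deriveN.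
  have dE := @is_derive1_comp _ expR (fun s : R => - s^-1) t _ _ (is_derive_expR (- t^-1)) dN.
  have dX : is_derive t 1 (fun s : R => s^-1 ^+ m) ((m%:R * t^-1 ^+ m.-1) *: (- t ^- 2 *: 1)).
    have := @is_deriveX _ _ _ m _ _ _ dV.
    by rewrite (_ : (fun _ : R => _) ^+ m = (fun s : R => s^-1 ^+ m))//;
      apply/funext => s; rewrite fctE.
  apply: (is_derive_eq (is_deriveM dX dE)).
  rewrite /= /GRing.scale/= !mulr1; case: m {dX} => [|m]; rewrite /= ?expr0 ?mul0r.
    by field.
  by rewrite !exprS; field.
- have -> : - m%:R * bm m.+1 0 + bm m.+2 0 = 0.
    by rewrite /bm ltxx mulr0 addr0.
  apply/is_deriveP => e e0.
  have f0 : (0 : R) < (m.+2)`!%:R by rewrite ltr0n fact_gt0.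
  exists (e / (m.+2)`!%:R); first by rewrite divr_gt0.
  move=> s hs; rewrite mulr0 subr0 add0r [bm m 0]/bm ltxx subr0 /GRing.scale/= mulr1.
  rewrite ger0_norm ?bm_ge0// (le_trans (bm_le _ _))//.
  rewrite -[s ^+ 2]real_normK ?num_real// expr2 mulrA ler_wpM2r//.
  by move: hs; rewrite ltr_pdivlMr// mulrC => /ltW.
Unshelve. all: by end_near. Qed.

Lemma continuous_bm (m : nat) : continuous (bm m : R -> R).
Proof.
move=> t; apply: differentiable_continuous; apply/derivable1_diffP.
by have [] := is_derive_bm m t.
Qed.

Context {n : nat}.
Local Notation Rn := 'rV[R]_n.

Lemma Ck_bm k m (c d : R) (j : 'I_n) : Ck k (fun x : Rn => bm m (c * x 0 j + d)).
Proof.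
have cc m' : continuous (fun x : Rn => bm m' (c * x 0 j + d)).
  move=> x; apply: (@continuous_comp _ _ _ (fun x : Rn => c * x 0 j + d) (bm m')); last exact: continuous_bm.
  apply: cont_add; last exact: cst_continuous.
  by apply: cont_mul; [exact: cst_continuous|exact: coord_continuous].
have db m' i x : is_derive x (e_ i) (fun x : Rn => bm m' (c * x 0 j + d))
    (c * (i == j)%:R * (- m'%:R * bm m'.+1 (c * x 0 j + d) + bm m'.+2 (c * x 0 j + d))).
  apply/is_deriveP => e e0; set a := c * (i == j)%:R.
  have a1 : 0 < `|a| + 1 by rewrite ltr_wpDl.
  have /is_deriveP/(_ (e / (`|a| + 1)) (divr_gt0 e0 a1))[r r0 Hr] := is_derive_bm m' (c * x 0 j + d).
  exists (r / (`|a| + 1)); first by rewrite divr_gt0.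
  move=> t; rewrite ltr_pdivlMr// => tr.
  have ar : `|a * t| < r.
    by apply: le_lt_trans tr; rewrite normrM mulrC ler_wpM2l// lerDl.
  have := Hr _ ar.
  rewrite !mxE eqxx/= /GRing.scale/= mulr1 [j == i]eq_sym.
  rewrite (_ : c * x 0 j + d + a * t = c * (x 0 j + t * (i == j)%:R) + d); last by rewrite /a; ring.
  rewrite (_ : a * t * _ = t * (a * (- m'%:R * bm m'.+1 (c * x 0 j + d) + bm m'.+2 (c * x 0 j + d)))); last by ring.
  move=> H; apply: (le_trans H).
  have q : e / (`|a| + 1) * `|a| <= e by rewrite mulrAC ler_pdivrMr// ler_pM2l// lerDl.
  have -> : `|a * t| = `|a| * `|t| by exact: normrM.
  by rewrite mulrA ler_wpM2r.
elim: k m => [m|k IH m]; first exact: cc.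
split => [|i x|i]; [exact: cc|by have [] := db m i x|].
rewrite (_ : partial i _ = fun x => c * (i == j)%:R * (- m%:R * bm m.+1 (c * x 0 j + d) + bm m.+2 (c * x 0 j + d))).
  apply: Ck_mul; first exact: Ck_cst.
  apply: Ck_add => //; apply: Ck_mul => //; exact: Ck_cst.
by apply/funext => x; apply: partialE.
Qed.

Definition psi (r : R) : Rn -> R :=
  fun x => \prod_(j < n) (bm 0 (1 * x 0 j + 0) * bm 0 (-1 * x 0 j + r)).

Lemma Coo_psi (r : R) : Coo (psi r).
Proof. by move=> k; apply: Ck_prod => j; apply: Ck_mul; exact: Ck_bm. Qed.

Lemma psi_ge0 (r : R) (x : Rn) : 0 <= psi r x.
Proof. by apply: prodr_ge0 => j _; rewrite mulr_ge0// bm_ge0. Qed.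

Lemma psi_gt0 (r : R) (x : Rn) : (forall j, 0 < x 0 j < r) -> 0 < psi r x.
Proof.
move=> H; apply: prodr_gt0 => j _; have /andP[x0 xr] := H j.
rewrite mul1r addr0 mulN1r addrC /bm x0 subr_gt0 xr expr0 !mul1r.
by rewrite mulr_gt0 ?expR_gt0.
Qed.

Lemma psi_neq0 (r : R) (x : Rn) : psi r x != 0 -> forall j, 0 < x 0 j < r.
Proof.
move=> H j; move: H; rewrite /psi (bigD1 j)//= mulf_eq0 negb_or => /andP[+ _].
rewrite mulf_eq0 negb_or mul1r addr0 mulN1r addrC => /andP[h1 h2].
apply/andP; split.
  by move: h1; rewrite /bm; case: ifPn => //; rewrite eqxx.
by move: h2; rewrite /bm subr_gt0; case: ifPn => //; rewrite eqxx.
Qed.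

End bump.

Lemma continuous_eps (R : realType) n (u : 'rV[R]_n -> R) :
  (forall x (e : R), 0 < e -> exists2 r : R, 0 < r &
     forall y, `|y - x| < r -> `|u y - u x| <= e) -> continuous u.
Proof.
move=> H x.
apply: (proj2 (@cvgrPdist_le _ _ _ (nbhs x) (nbhs_filter x) u (u x))) => e e0.
have [r r0 Hr] := H x e e0.
apply/nbhs_ballP; exists r => // y; rewrite -ball_normE/= => xy.
by rewrite distrC; apply: Hr; rewrite distrC.
Qed.

Section test_functions.
Context {R : realType} {n : nat}.
Local Notation Rn := 'rV[R]_n.
Local Notation leb := (lebesgue_rV n : {measure set Rn -> \bar R}).
Local Notation L2 := (L2 leb).
Local Notation nsq := (nsq leb).
Local Notation ig := (ig leb).
Local Notation bvol := (@bvol R n).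
Implicit Types (f phi rho : Rn -> R).

Definition Tst (M : R) phi := Coo phi /\ forall x, phi x != 0 -> `|x| <= M.

Lemma norm_e_ i (t : R) : `|t *: (e_ i : Rn)| <= `|t|.
Proof.
apply: rV_norm_le => // j; rewrite !mxE eqxx/=.
by case: (j == i); rewrite ?mulr1 ?mulr0 ?normr0.
Qed.

Lemma test_Tst phi : test_function setT phi -> exists M, Tst M phi.
Proof.
move=> [Cphi /compact_bounded[M [_ HM]] _]; exists (M + 1); split => // x px.
by apply: (HM (M + 1)); [rewrite ltrDl|exact: subset_closure].
Qed.

Lemma closed_norm_le (M : R) : closed [set x : Rn | `|x| <= M].
Proof.
rewrite (_ : mkset _ = (fun x : Rn => `|x|) @^-1` [set r | r <= M])//.
apply: closed_comp; last exact: closed_le.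
by move=> x _; exact: norm_continuous.
Qed.

Lemma Tst_supp M phi : Tst M phi ->
  closure [set x | phi x != 0] `<=` [set x | `|x| <= M].
Proof.
move=> [_ H]; rewrite [X in _ `<=` X]((closure_id _).1 (@closed_norm_le M)).
exact: closure_subset.
Qed.

Lemma compact_norm_le (M : R) (A : set Rn) : closed A ->
  A `<=` [set x | `|x| <= M] -> compact A.
Proof.
move=> cA AM; apply: bounded_closed_compact => //.
by exists M; split; [exact: num_real|move=> N MN x /AM/le_trans; apply; exact: ltW].
Qed.

Lemma Tst_compact M phi : Tst M phi -> compact (closure [set x | phi x != 0]).
Proof. by move=> /Tst_supp; apply: compact_norm_le; exact: closed_closure. Qed.

Lemma Tst_test M phi : Tst M phi -> test_function setT phi.
Proof. by move=> T; split => //; [exact: T.1|exact: Tst_compact T]. Qed.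

Lemma Tst_continuous M phi : Tst M phi -> continuous phi.
Proof. move=> [/(_ 0%N) c _]; exact: c. Qed.

Lemma Tst_derivable M phi x i : Tst M phi -> derivable phi x (e_ i).
Proof. move=> [/(_ 1%N)[_ d _] _]; exact: d. Qed.

Lemma Tst_measurable M phi : Tst M phi -> measurable_fun setT phi.
Proof. by move=> /Tst_continuous; exact: continuous_measurable_rV. Qed.

Lemma Tst_bound M phi : Tst M phi -> exists2 c : R, 0 <= c & forall x, `|phi x| <= c.
Proof.
move=> T; have : compact (phi @` closure [set x | phi x != 0]).
  apply: continuous_compact; last exact: Tst_compact T.
  by apply: continuous_subspaceT; exact: Tst_continuous T.
move=> /compact_bounded[c [_ Hc]]; exists (`|c| + 1); first by rewrite addr_ge0.
move=> x; have [->|px] := eqVneq (phi x) 0; first by rewrite normr0 addr_ge0.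
apply: (Hc (`|c| + 1)); first by rewrite (le_lt_trans (ler_norm c))// ltrDl.
by exists x => //; exact: subset_closure.
Qed.

Lemma Tst_out M phi x : Tst M phi -> M < `|x| -> phi x = 0.
Proof. by move=> [_ H]; rewrite ltNge => xM; apply/eqP; apply: contraNT xM => /H. Qed.

Lemma Tst_partial M phi i : Tst M phi -> Tst M (partial i phi).
Proof.
move=> T; split=> [k|x]; first by have [/(_ k.+1)[_ _ /(_ i)]] := T.
apply: contraNT; rewrite -ltNge => xM; apply/eqP/partialE/is_deriveP => e e0.
exists (`|x| - M); first by rewrite subr_gt0.
move=> t tM; rewrite (Tst_out T xM) (Tst_out T); last first.
  have := norm_e_ i t; have := lerB_normD x (t *: e_ i); move: tM; lra.
by rewrite subr0 mulr0 subr0 normr0 mulr_ge0// ltW.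
Qed.

Lemma Tst_tr M phi (h : Rn) : Tst M phi -> Tst (M + `|h|) (tr h phi).
Proof.
move=> [C H]; split => [k|x /H]; first exact: Ck_tr.
by move=> xM; have := ler_normB (x + h) h; rewrite addrK; move: xM; lra.
Qed.

Lemma Tst_le M M' phi : M <= M' -> Tst M phi -> Tst M' phi.
Proof. by move=> MM' [C H]; split => // x /H /le_trans; exact. Qed.

Lemma TstD M phi rho : Tst M phi -> Tst M rho -> Tst M (fun x => phi x + rho x).
Proof.
move=> T T'; split => [k|x]; first by apply: Ck_add; [exact: T.1|exact: T'.1].
apply: contraNT; rewrite -ltNge => xM.
by rewrite (Tst_out T xM) (Tst_out T' xM) addr0.
Qed.

Lemma TstZ M phi c : Tst M phi -> Tst M (fun x => c * phi x).
Proof.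
move=> T; split => [k|x]; first by apply: Ck_mul; [exact: Ck_cst|exact: T.1].
apply: contraNT; rewrite -ltNge => xM.
by rewrite (Tst_out T xM) mulr0.
Qed.

Lemma mvt_line phi i (x : Rn) t : (forall y, derivable phi y (e_ i)) ->
  exists2 s : R, `|s| <= `|t| &
    phi (x + t *: e_ i) - phi x = t * partial i phi (x + s *: e_ i).
Proof.
move=> d; pose g s := phi (x + s *: e_ i).
have dg s : is_derive s (1 : R) g (partial i phi (x + s *: e_ i)).
  have /is_deriveP H := derivable_partial (d (x + s *: e_ i)).
  apply/is_deriveP => e /H[r r0 Hr]; exists r => // t' /Hr.
  rewrite /g (_ : x + (s + t' *: 1) *: e_ i = x + s *: e_ i + t' *: e_ i)//.
  by rewrite -addrA -scalerDl [t' *: 1]mulr1.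
have cg : continuous g.
  move=> s; apply: differentiable_continuous; apply/derivable1_diffP.
  by have [] := dg s.
have g0 : phi x = g 0 by rewrite /g scale0r addr0.
rewrite g0 -/(g t); have [t0|t0|->] := ltrgtP t 0.
- have [s] := MVT t0 (fun s (_ : s \in `]t, 0[) => dg s) (continuous_subspaceT cg).
  rewrite in_itv/= => /andP[ts s0]; rewrite sub0r mulrN => E; exists s.
    by rewrite !ltr0_norm// lerN2 ltW.
  by rewrite -opprB E opprK mulrC.
- have [s] := MVT t0 (fun s (_ : s \in `]0, t[) => dg s) (continuous_subspaceT cg).
  rewrite in_itv/= => /andP[s0 st]; rewrite subr0 => E; exists s.
    by rewrite !gtr0_norm// ltW.
  by rewrite E mulrC.
- by exists 0 => //; rewrite subrr mul0r.
Qed.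

Lemma Tst_diff1 M phi i : Tst M phi -> exists2 c : R, 0 <= c &
  forall (x : Rn) t, `|phi (x + t *: e_ i) - phi x| <= c * `|t|.
Proof.
move=> T; have [c c0 Hc] := Tst_bound (Tst_partial i T); exists c => // x t.
have [s _ ->] := mvt_line x t (fun y => @Tst_derivable _ _ y i T).
by rewrite normrM mulrC ler_wpM2r.
Qed.

Lemma Tst_diff2 M phi i : Tst M phi -> exists2 c : R, 0 <= c &
  forall (x : Rn) t, `|phi (x + t *: e_ i) - phi x - t * partial i phi x| <= c * t ^+ 2.
Proof.
move=> T; have [c c0 Hc] := Tst_diff1 i (Tst_partial i T); exists c => // x t.
have [s st ->] := mvt_line x t (fun y => @Tst_derivable _ _ y i T).
rewrite -mulrBr normrM -[t ^+ 2]real_normK ?num_real// expr2 [leRHS]mulrCA.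
rewrite ler_wpM2l// (le_trans (Hc _ _))// ler_wpM2l//.
Qed.

Definition nbox (M : R) : nat := (truncn M).+1.

Lemma nbox_norm M (x : Rn) : `|x| <= M -> bigbox (nbox M) x.
Proof. by move=> xM; apply: bigbox_norm; rewrite (le_lt_trans xM)// truncnS_gt. Qed.

Lemma kern_supp c M phi : 0 <= c -> measurable_fun setT phi ->
  (forall x, `|phi x| <= c) -> (forall x, phi x != 0 -> `|x| <= M) ->
  kern c (nbox M) phi.
Proof.
move=> c0 mp pc pM; split => // x; have [->|px] := eqVneq (phi x) 0.
  by rewrite normr0 mulr_ge0.
by rewrite indicE mem_set ?mulr1//; apply: nbox_norm; exact: pM.
Qed.

Lemma Tst_kern M phi : Tst M phi -> exists c, kern c (nbox M) phi.
Proof.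
move=> T; have [c c0 Hc] := Tst_bound T; exists c; apply: kern_supp => //.
  exact: Tst_measurable T.
by have [] := T.
Qed.

Lemma Tst_L2 M phi : Tst M phi -> L2 phi.
Proof. by move=> /Tst_kern[c]; exact: kern_L2. Qed.

Lemma Tst_ig M phi : Tst M phi -> ig phi.
Proof. by move=> /Tst_kern[c]; exact: kern_ig. Qed.

Definition rem2 (i : 'I_n) (t : R) phi : Rn -> R :=
  fun x => phi (x + t *: e_ i) - phi x - t * partial i phi x.

Lemma rem2_kern M phi i : Tst M phi -> exists2 c : R, 0 <= c &
  forall t, `|t| <= 1 -> kern (c * t ^+ 2) (nbox (M + 1)) (rem2 i t phi).
Proof.
move=> T; have [c c0 Hc] := Tst_diff2 i T; exists c => // t t1; apply: kern_supp => //.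
- by rewrite mulr_ge0// sqr_ge0.
- apply: measurable_funB; first apply: measurable_funB.
  + exact: (measurable_tr (t *: e_ i) (Tst_measurable T)).
  + exact: Tst_measurable T.
  + by apply: measurable_funM => //; exact: Tst_measurable (Tst_partial i T).
- by move=> x; exact: Hc.
- move=> x; apply: contraNT; rewrite -ltNge => xM.
  have xM' : M < `|x| by move: xM; lra.
  rewrite /rem2 (Tst_out T xM') (Tst_out (Tst_partial i T) xM') (Tst_out T); last first.
    have := norm_e_ i t; have := lerB_normD x (t *: e_ i); move: xM t1; lra.
  by rewrite mulr0 !subr0.
Qed.

Lemma conv_shift f (k : Rn -> R) (x h : Rn) : L2 f -> L2 k ->
  cvl f k (x + h) = cvl f (tr (- h) k) x.
Proof.
move=> f2 k2; rewrite convE// convE//; last exact: L2_tr.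
by apply: eq_Rintegral => y _; rewrite /tr opprD addrA.
Qed.

Lemma conv_rem2 M f phi i (x : Rn) (t : R) : L2 f -> Tst M phi ->
  cvl f phi (x + t *: e_ i) - cvl f phi x + t * cvl f (partial i phi) x =
  cvl f (rem2 i (- t) phi) x.
Proof.
move=> f2 T; have p2 := Tst_L2 T; have d2 := Tst_L2 (Tst_partial i T).
rewrite conv_shift// -IntB; [|by apply: ig_conv => //; exact: L2_tr|exact: ig_conv].
rewrite -IntZ; last exact: ig_conv.
rewrite -IntD; last 2 first.
- by apply: igB; apply: ig_conv => //; exact: L2_tr.
- by apply: igZ; exact: ig_conv.
by apply: eq_Rintegral => y _; rewrite /rem2 /tr scaleNr; ring.
Qed.

Lemma conv_pointwise f (k : Rn -> R) (x : Rn) : L2 f -> L2 k ->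
  `|cvl f k x| <= Num.sqrt (nsq f * nsq k).
Proof.
move=> f2 k2; have := CS_norm (L2_tr x f2) k2; rewrite nsq_tr//.
by under eq_Rintegral do rewrite /tr addrC.
Qed.

Lemma nsq_kern c N (k : Rn -> R) : kern c N k -> nsq k <= c ^+ 2 * bvol N.
Proof.
move=> kk; have [mk kc] := kk; apply: (@le_trans _ _ (nsq (fun x => c * \1_(bigbox N) x))).
  apply: nsq_le; [exact: kern_L2 kk|by apply: L2Z; exact: L2_bigbox|].
  by move=> x; rewrite (le_trans (kc x))// ler_norm.
rewrite nsqZ; last exact: L2_bigbox.
by rewrite ler_wpM2l ?sqr_ge0// nsq_indic ?lerDl//; exact: measurable_obox.
Qed.

Lemma is_derive_conv M f phi i (x : Rn) : L2 f -> Tst M phi ->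
  is_derive x (e_ i) (cvl f phi) (- cvl f (partial i phi) x).
Proof.
move=> f2 T; have [c c0 Hc] := rem2_kern i T; apply/is_deriveP => e e0.
pose C := c * Num.sqrt (nsq f * bvol (nbox (M + 1))).
have C0 : 0 <= C by rewrite mulr_ge0// sqrtr_ge0.
have C1 : 0 < C + 1 by rewrite ltr_wpDl.
exists (Num.min 1 (e / (C + 1))); first by rewrite lt_min ltr01 divr_gt0.
move=> t; rewrite lt_min => /andP[/ltW t1 te].
rewrite mulrN opprK (conv_rem2 _ _ _ f2 T).
have tN1 : `|- t| <= 1 by rewrite normrN.
have kt := Hc _ tN1; apply: (le_trans (conv_pointwise x f2 (kern_L2 kt))).
apply: (@le_trans _ _ (C * t ^+ 2)).
  apply: (@le_trans _ _ (Num.sqrt (nsq f * ((c * (- t) ^+ 2) ^+ 2 * bvol (nbox (M + 1)))))).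
    rewrite ler_wsqrtr// ler_wpM2l ?nsq_ge0//; exact: nsq_kern kt.
  rewrite sqrrN mulrCA sqrtrM ?sqr_ge0// sqrtr_sqr ger0_norm; last by rewrite mulr_ge0// sqr_ge0.
  by rewrite /C mulrAC.
rewrite -[t ^+ 2]real_normK ?num_real// expr2 mulrA ler_wpM2r//.
apply: (@le_trans _ _ ((C + 1) * `|t|)); first by rewrite ler_wpM2r// lerDl.
by move: te; rewrite ltr_pdivlMr// mulrC => /ltW.
Qed.

Lemma continuous_conv M f phi : L2 f -> Tst M phi -> continuous (cvl f phi).
Proof.
move=> f2 T; have p2 := Tst_L2 T; apply: continuous_eps => x e e0.
have f1 : 0 < nsq f + 1 by rewrite ltr_wpDl// nsq_ge0.
have [r r0 Hr] := tcont_L2 p2 (e := e ^+ 2 / (nsq f + 1)) (divr_gt0 (exprn_gt0 2 e0) f1).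
exists r => // y xy; rewrite (_ : y = x + (y - x)); last by rewrite addrC subrK.
rewrite conv_shift// -IntB; [|by apply: ig_conv => //; exact: L2_tr|exact: ig_conv].
rewrite (@eq_Rintegral _ _ _ _ _ (fun z => f (x + z) * dtr (- (y - x)) phi z)); last first.
  by move=> z _; rewrite /tr /dtr mulrBr.
apply: le_trans (conv_pointwise x f2 (L2_dtr _ p2)) _.
have eE : e = Num.sqrt (e ^+ 2) by rewrite sqrtr_sqr ger0_norm// ltW.
rewrite [leRHS]eE ler_wsqrtr//.
apply: (@le_trans _ _ ((nsq f + 1) * nsq (dtr (- (y - x)) phi))).
  by rewrite ler_wpM2r ?nsq_ge0// lerDl.
by rewrite mulrC -ler_pdivlMr//; apply: Hr; rewrite normrN.
Qed.

Lemma Coo_conv M f phi : L2 f -> Tst M phi -> Coo (cvl f phi).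
Proof.
move=> f2 T k; elim: k M phi T => [|k IH] M phi T; first exact: continuous_conv T.
split => [|i x|i]; first exact: continuous_conv T.
  by have [] := is_derive_conv i x f2 T.
rewrite (_ : partial i _ = fun x => (-1) * cvl f (partial i phi) x).
  by apply: Ck_mul; [exact: Ck_cst|exact: IH (Tst_partial i T)].
by apply/funext => x; rewrite mulN1r; apply: partialE; exact: is_derive_conv T.
Qed.

Definition mollifier (r : R) rho :=
  [/\ exists M, Tst M rho, forall y, 0 <= rho y, \int[leb]_y rho y = 1
    & forall y, rho y != 0 -> `|y| < r].

Lemma mollifier_exists (r : R) : 0 < r -> exists rho, mollifier r rho.
Proof.
move=> r0; pose p : Rn -> R := psi (r / 2).
have pr x : p x != 0 -> `|x| <= r / 2.
  move=> /psi_neq0 H; apply: rV_norm_le; first by rewrite ltW// divr_gt0.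
  by move=> j; have /andP[x0 xr] := H j; rewrite gtr0_norm// ltW.
have Tp : Tst (r / 2) p by split => //; exact: Coo_psi.
have ip := Tst_ig Tp.
have I0 : 0 < \int[leb]_x p x.
  rewrite lt_neqAle Int_ge0 ?andbT; last by move=> x; exact: psi_ge0.
  apply/eqP => /esym I0.
  have /(_ (fun x => psi_ge0 _ x)) := Int_ae0 ip; move=> /(_ I0) [N [mN N0 HN]].
  pose B : set Rn := obox (const_mx (r / 8)) (const_mx (r / 4)).
  have BN : B `<=` N.
    move=> x Bx; apply: HN => /= /eqP; rewrite gt_eqF//; apply: psi_gt0 => j.
    by have := Bx j; rewrite /= in_itv/= !mxE => /andP[h1 h2]; apply/andP; split;
      move: r0 h1 h2; lra.
  have : (leb B <= leb N)%E by apply: le_measure => //; rewrite inE//; exact: measurable_obox.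
  rewrite N0 lebesgue_obox lee_fin leNgt => /negP; apply.
  by apply: prodr_gt0 => j _; rewrite lt_max !mxE; apply/orP; right; move: r0; lra.
exists (fun x => (\int[leb]_x p x)^-1 * p x); split.
- by exists (r / 2); exact: TstZ.
- by move=> y; rewrite mulr_ge0 ?psi_ge0// invr_ge0 ltW.
- by rewrite IntZ// mulVf// gt_eqF.
- move=> y; rewrite mulf_eq0 negb_or => /andP[_ /pr]; move: r0; lra.
Qed.

Lemma mollifier_kern (r : R) rho : mollifier r rho -> exists c N, kern c N rho.
Proof. by move=> [[M /Tst_kern[c k]] _ _ _]; exists c, (nbox M). Qed.

Lemma mollifier_contract (r : R) rho f : mollifier r rho -> L2 f ->
  L2 (cvl f rho) /\ nsq (cvl f rho) <= nsq f.
Proof.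
move=> mr f2; have [c [N k]] := mollifier_kern mr; have [_ r0 r1 _] := mr.
by split; [exact: (conv_kern f2 k).1|exact: conv_avg_le k _ _].
Qed.

Lemma mollifier_approx f (e : R) : L2 f -> 0 < e -> exists2 r : R, 0 < r &
  forall r' rho, r' <= r -> mollifier r' rho -> nsq (fun x => cvl f rho x - f x) <= e.
Proof.
move=> f2 e0; have [r r0 Hr] := tcont_L2 f2 e0; exists r => // r' rho r'r mr.
have [c [N k]] := mollifier_kern mr; have [_ rho0 rho1 rhor] := mr.
apply: (conv_approx f2 k rho0 rho1 _ (ltW e0) Hr) => y /rhor/lt_le_trans; exact.
Qed.

End test_functions.

(** * Strong L2 derivatives *)

Section strong_derivative.
Context {R : realType} {n : nat}.
Local Notation Rn := 'rV[R]_n.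
Local Notation leb := (lebesgue_rV n : {measure set Rn -> \bar R}).
Local Notation L2 := (L2 leb).
Local Notation nsq := (nsq leb).
Local Notation ig := (ig leb).
Local Notation bvol := (@bvol R n).
Implicit Types (f g c phi rho : Rn -> R).

Definition rem1 (i : 'I_n) (t : R) f g : Rn -> R :=
  fun x => f (x + t *: e_ i) - f x - t * g x.

Definition SD i f g := [/\ L2 f, L2 g & forall e : R, 0 < e ->
  exists2 r : R, 0 < r & forall t, `|t| < r -> nsq (rem1 i t f g) <= e * t ^+ 2].

Lemma L2_rem1 i t f g : L2 f -> L2 g -> L2 (rem1 i t f g).
Proof. by move=> f2 g2; apply: L2B; [exact: (L2_dtr (t *: e_ i) f2)|exact: L2Z]. Qed.

(* Split the step [t] into [k] equal ones and telescope: the remainders cost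
   [o(1)] as [k] grows, and only the translates of [g] are left. *)
Lemma SD_gen i f g c t B : SD i f g -> L2 c -> 0 <= B ->
  (forall s : R, `|s| <= `|t| -> nsq (fun x => g (x + s *: e_ i) - c x) <= B) ->
  nsq (rem1 i t f c) <= 2 * t ^+ 2 * B.
Proof.
move=> [f2 g2 fg] c2 B0 HB; apply/ler_addgt0Pr => e e0.
have t1 : 0 < 2 * (t ^+ 2 + 1) by rewrite mulr_gt0// ltr_wpDl// sqr_ge0.
have [r r0 Hr] := fg (e / (2 * (t ^+ 2 + 1))) (divr_gt0 e0 t1).
pose k := (truncn (`|t| / r)).+1.
have k0 : (0 : R) < k%:R by rewrite ltr0n.
have kn0 : (k%:R : R) != 0 by rewrite gt_eqF.
pose s := t / k%:R.
have ks : k%:R * s = t by rewrite /s mulrC divfK.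
have st : s ^+ 2 * k%:R ^+ 2 = t ^+ 2 by rewrite -ks; ring.
have sr : `|s| < r.
  rewrite normrM normfV (gtr0_norm k0) ltr_pdivrMr// mulrC -ltr_pdivrMr//.
  exact: truncnS_gt.
pose F (j : 'I_k) := tr ((j%:R * s) *: e_ i) (rem1 i s f g).
pose G (j : 'I_k) := fun x => g (x + (j%:R * s) *: e_ i) - c x.
have F2 j : L2 (F j) by apply: L2_tr; exact: L2_rem1.
have G2 j : L2 (G j) by apply: L2B => //; exact: L2_tr.
have E x : rem1 i t f c x = \sum_j F j x + s * \sum_j G j x.
  have T : \sum_(j < k) (f (x + (j.+1%:R * s) *: e_ i) - f (x + (j%:R * s) *: e_ i)) =
      f (x + t *: e_ i) - f x.
    rewrite -(big_mkord xpredT (fun j => f (x + (j.+1%:R * s) *: e_ i) - f (x + (j%:R * s) *: e_ i))).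
    by rewrite telescope_sumr// ks mul0r scale0r addr0.
  rewrite /rem1 -T mulr_sumr -big_split/= -ks -mulrA mulr_natl.
  have -> : (s * c x) *+ k = \sum_(j < k) s * c x by rewrite sumr_const card_ord.
  rewrite -sumrB; apply: eq_bigr => j _.
  have -> : x + (j.+1%:R * s) *: e_ i = x + (j%:R * s) *: e_ i + s *: e_ i.
    by rewrite -addrA -scalerDl -natr1 mulrDl mul1r.
  rewrite /F /G /tr /rem1; ring.
rewrite (eq_nsq _ E).
have SF2 : L2 (fun x => \sum_j F j x) by exact: L2_sum.
have SG2 : L2 (fun x => \sum_j G j x) by exact: L2_sum.
apply: (le_trans (nsqD_le SF2 (L2Z s SG2))).
rewrite nsqZ//.
have hF : nsq (fun x => \sum_j F j x) <= e / (2 * (t ^+ 2 + 1)) * t ^+ 2.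
  apply: (le_trans (nsq_sum F2)).
  apply: (@le_trans _ _ (k%:R * \sum_(j < k) (e / (2 * (t ^+ 2 + 1)) * s ^+ 2))).
    rewrite ler_wpM2l//; apply: ler_sum => j _.
    by rewrite nsq_tr; [exact: Hr|exact: L2_rem1].
  rewrite sumr_const card_ord -mulr_natl -st le_eqVlt; apply/orP; left; apply/eqP; ring.
have hG : s ^+ 2 * nsq (fun x => \sum_j G j x) <= t ^+ 2 * B.
  apply: (@le_trans _ _ (s ^+ 2 * (k%:R * \sum_(j < k) B))).
    rewrite ler_wpM2l ?sqr_ge0//; apply: (le_trans (nsq_sum G2)).
    rewrite ler_wpM2l//; apply: ler_sum => j _; apply: HB.
    have ns (m : nat) : `|m%:R * s| = m%:R * `|s| by rewrite normrM ger0_norm.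
    by rewrite -ks !ns ler_wpM2r// ler_nat ltnW.
  rewrite sumr_const card_ord -mulr_natl -st le_eqVlt; apply/orP; left; apply/eqP; ring.
have he : e / (2 * (t ^+ 2 + 1)) * t ^+ 2 <= e / 2.
  rewrite mulrAC ler_pdivrMr// (_ : e / 2 * _ = e * t ^+ 2 + e); last by field.
  by rewrite lerDl ltW.
move: hF hG he; lra.
Qed.

Lemma SD_bound i f g t : SD i f g -> nsq (dtr (t *: e_ i) f) <= 2 * t ^+ 2 * nsq g.
Proof.
move=> /[dup] D [f2 g2 _].
have := @SD_gen i f g (fun=> 0) t (nsq g) D (L20 _) (nsq_ge0 _ _).
rewrite (@eq_nsq _ _ _ _ (rem1 i t f (fun=> 0)) (dtr (t *: e_ i) f)).
  apply => s _; rewrite (@eq_nsq _ _ _ _ _ (tr (s *: e_ i) g)); last by move=> x; rewrite subr0.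
  by rewrite nsq_tr.
by move=> x; rewrite /rem1 mulr0 subr0.
Qed.

Lemma nsq_dtr_all f (A : R) (h : Rn) : L2 f -> 0 <= A ->
  (forall i (t : R), nsq (dtr (t *: e_ i) f) <= A * t ^+ 2) ->
  nsq (dtr h f) <= n%:R ^+ 2 * A * `|h| ^+ 2.
Proof.
move=> f2 A0 HA.
pose p (k : nat) : Rn := \sum_(i < n | (i < k)%N) h 0 i *: e_ i.
have pn : p n = h.
  rewrite [RHS]row_sum_delta /p; apply: eq_bigl => i; exact: ltn_ord.
have p0 : p 0%N = 0 by rewrite /p big_pred0.
have pS (i : 'I_n) : p i.+1 = p i + h 0 i *: e_ i.
  rewrite /p (bigD1 i)//= addrC; congr (_ + _); apply: eq_bigl => j.
  by rewrite ltnS ltn_neqAle andbC.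
pose F (i : 'I_n) := tr (p i) (dtr (h 0 i *: e_ i) f).
have F2 i : L2 (F i) by apply: L2_tr; exact: L2_dtr.
rewrite (@eq_nsq _ _ _ _ _ (fun x => \sum_i F i x)); last first.
  move=> x; rewrite (eq_bigr (fun i : 'I_n => f (x + p i.+1) - f (x + p i))); last first.
    by move=> i _; rewrite pS addrA.
  rewrite -(big_mkord xpredT (fun i => f (x + p i.+1) - f (x + p i))).
  by rewrite telescope_sumr// p0 pn addr0.
apply: (le_trans (nsq_sum F2)); rewrite expr2 -!mulrA ler_wpM2l//.
apply: (@le_trans _ _ (\sum_(i < n) A * `|h| ^+ 2)).
  apply: ler_sum => i _; rewrite nsq_tr; last exact: L2_dtr.
  apply: (le_trans (HA _ _)); rewrite ler_wpM2l// -[h 0 i ^+ 2]real_normK ?num_real//.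
  by rewrite lerXn2r ?nnegrE// coord_le_norm.
by rewrite sumr_const card_ord mulr_natl.
Qed.

Definition WD i f g := forall phi, test_function setT phi ->
  \int[leb]_x (f x * partial i phi x) = - \int[leb]_x (g x * phi x).

Lemma WD_cvl i f g M phi x : L2 f -> L2 g -> WD i f g -> Tst M phi ->
  cvl g phi x = - cvl f (partial i phi) x.
Proof.
move=> f2 g2 fg T; have p2 := Tst_L2 T; have d2 := Tst_L2 (Tst_partial i T).
have Tx := Tst_tr (- x) T.
rewrite (convE x g2 p2) (convE x f2 d2) -[LHS]opprK; congr (- _).
transitivity (\int[leb]_y (f y * partial i (tr (- x) phi) y)).
  by rewrite (fg _ (Tst_test Tx)).
apply: eq_Rintegral => y _; congr (_ * _); apply: partial_tr.
exact: Tst_derivable T.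
Qed.

Lemma SD_cvl i f g M phi : L2 f -> L2 g -> WD i f g -> Tst M phi ->
  SD i (cvl f phi) (cvl g phi).
Proof.
move=> f2 g2 fg T; have [k kk] := Tst_kern T.
split; [exact: (conv_kern f2 kk).1|exact: (conv_kern g2 kk).1|move=> e e0].
have [c c0 Hc] := rem2_kern i T; set V := bvol (nbox (M + 1)) in Hc *.
pose C := (c * V) ^+ 2 * nsq f + 1.
have C0 : 0 < C by rewrite ltr_wpDl// mulr_ge0 ?nsq_ge0 ?sqr_ge0.
exists (Num.min 1 (e / C)); first by rewrite lt_min ltr01 divr_gt0.
move=> t; rewrite lt_min => /andP[t1 te].
have tN : `|- t| <= 1 by rewrite normrN ltW.
rewrite (@eq_nsq _ _ _ _ _ (cvl f (rem2 i (- t) phi))); last first.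
  move=> x; rewrite -(conv_rem2 i x t f2 T) /rem1 (WD_cvl x f2 g2 fg T); ring.
apply: (le_trans (conv_kern f2 (Hc _ tN)).2).
have t2 : t ^+ 2 <= `|t|.
  rewrite -[t ^+ 2]real_normK ?num_real// expr2; apply: ler_piMl => //; exact: ltW.
rewrite (_ : _ * nsq f = ((c * V) ^+ 2 * nsq f * t ^+ 2) * t ^+ 2); last by rewrite /V; ring.
rewrite ler_wpM2r ?sqr_ge0//; apply: (@le_trans _ _ (C * `|t|)).
  have A0 : 0 <= (c * V) ^+ 2 * nsq f by rewrite mulr_ge0 ?nsq_ge0 ?sqr_ge0.
  by apply: ler_pM => //; rewrite ?sqr_ge0// /C lerDl.
by rewrite mulrC -ler_pdivlMr// ltW.
Qed.

Lemma SD_cst_sub i f g t : SD i f g -> forall B, 0 <= B ->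
  (forall s : R, `|s| <= `|t| -> nsq (dtr (s *: e_ i) g) <= B) ->
  nsq (rem1 i t f g) <= 2 * t ^+ 2 * B.
Proof. by move=> /[dup] D [_ g2 _] B B0 H; exact: (SD_gen D g2 B0 H). Qed.

Lemma WD_SD i f g : L2 f -> L2 g -> WD i f g -> SD i f g.
Proof.
move=> f2 g2 fg; split => // e e0.
have [r r0 Hr] := tcont_L2 g2 (e := e / 4) (divr_gt0 e0 (ltr0n _ 4)).
exists r => // t tr_; apply/ler_addgt0Pr => d d0.
have R2 : L2 (rem1 i t f g) by exact: L2_rem1.
have d2 : 0 < d / 2 by rewrite divr_gt0.
have [q q0 Hq] := mollifier_approx R2 d2.
have [rho mrho] := mollifier_exists (n := n) q0.
have {Hq} := Hq _ _ (lexx q) mrho.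
have [[M T] rho0 rho1 _] := mrho; have p2 := Tst_L2 T.
have D := SD_cvl f2 g2 fg T.
have H1 : nsq (cvl (rem1 i t f g) rho) <= 2 * t ^+ 2 * (e / 4).
  rewrite (@eq_nsq _ _ _ _ _ (rem1 i t (cvl f rho) (cvl g rho))).
    apply: (SD_cst_sub D); first by rewrite divr_ge0// ltW.
    move=> s st; rewrite (@eq_nsq _ _ _ _ _ (cvl (dtr (s *: e_ i) g) rho)); last first.
      by move=> x; rewrite conv_dtr.
    apply: le_trans (mollifier_contract mrho (L2_dtr _ g2)).2 _; apply: Hr.
    by apply: le_lt_trans (norm_e_ _ _) (le_lt_trans st tr_).
  move=> x; rewrite [LHS](convB _ (L2_dtr (t *: e_ i) f2) (L2Z t g2))// convZ//.
  by rewrite conv_dtr.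
have c2 := (mollifier_contract mrho R2).1 => H2.
have := nsqB_le c2 (L2B c2 R2).
rewrite (@eq_nsq _ _ _ _ _ (rem1 i t f g)); last by move=> x; rewrite subKr.
move=> H; apply: (le_trans H); move: H1 H2; lra.
Qed.

End strong_derivative.

Section fast_convergence.
Context d (T : measurableType d) (R : realType) (m : {measure set T -> \bar R}).

Lemma geometric_half_le (k : nat) : \sum_(0 <= j < k) ((1 / 2) ^+ j : R) <= 2.
Proof.
suff -> : \sum_(0 <= j < k) ((1 / 2) ^+ j : R) = 2 - 2 * (1 / 2) ^+ k.
  by rewrite gerBl mulr_ge0// exprn_ge0// divr_ge0.
elim: k => [|k IH]; first by rewrite big_geq// expr0; lra.
by rewrite big_nat_recr//= IH exprS; lra.
Qed.

Lemma fast_cvg (w : nat -> T -> R) : (forall k, L2 m (w k)) ->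
  (forall k, nsq m (w k) <= (1 / 2) ^+ k) ->
  (exists M, L2 m M /\ {ae m, forall x k, `|w k x| <= M x}) /\
  {ae m, forall x, w k x @[k --> \oo] --> (0 : R)}.
Proof.
move=> w2 wk; pose S x := (\sum_(0 <= k <oo) (w k x ^+ 2)%:E)%E.
have mw k : measurable_fun setT (fun x => (w k x ^+ 2)%:E).
  by apply/measurable_EFinP; apply: measurable_funX; exact: (w2 k).1.
have w0 k x : (0 <= (w k x ^+ 2)%:E)%E by rewrite lee_fin sqr_ge0.
have mS : measurable_fun setT S.
  by apply: ge0_emeasurable_sum => // k x _ _; exact: w0.
have S0 x : (0 <= S x)%E by apply: nneseries_ge0 => k _ _; exact: w0.
have iS : m.-integrable setT S.
  apply/integrableP; split => //.
  under eq_integral do rewrite gee0_abs//.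
  rewrite integral_nneseries//; apply: (@le_lt_trans _ _ 2%:E); last exact: ltry.
  apply: lime_le.
    by apply: is_cvg_nneseries => k _ _; apply: integral_ge0 => x _; exact: w0.
  apply: nearW => k; apply: (@le_trans _ _ (\sum_(0 <= j < k) ((1 / 2) ^+ j : R)%:E)%E).
    apply: lee_sum => j _; rewrite -EFin_Int; last exact: (w2 j).2.
    by rewrite lee_fin; exact: wk.
  by rewrite sumEFin lee_fin geometric_half_le.
have Sfin := integrable_ae measurableT iS.
have wS x k : S x \is a fin_num -> \sum_(0 <= j < k) w j x ^+ 2 <= fine (S x).
  move=> Sx; rewrite -lee_fin fineK// -sumEFin.
  by apply: nneseries_lim_ge => j _ _; exact: w0.
have w1 x k : S x \is a fin_num -> w k x ^+ 2 <= fine (S x).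
  move=> Sx; apply: le_trans (wS x k.+1 Sx); rewrite big_nat_recr//= lerDr.
  by apply: sumr_ge0 => j _; exact: sqr_ge0.
split.
  exists (fun x => Num.sqrt (fine (S x))); split.
    have mf : measurable_fun setT (fun x => fine (S x)) by exact: measurableT_comp.
    split.
      apply: measurableT_comp => //.
      by apply: continuous_measurable_fun; exact: sqrt_continuous.
    apply: (le_integrable measurableT _ _ iS).
      apply/measurable_EFinP; apply: measurable_funX; apply: measurableT_comp => //.
      by apply: continuous_measurable_fun; exact: sqrt_continuous.
    move=> x _ /=; rewrite sqr_sqrtr ?fine_ge0// ger0_norm ?fine_ge0// gee0_abs//.
    by case: (S x) (S0 x) => //= _; rewrite leey.
  apply: filterS Sfin => x /(_ I) Sx k.
  by rewrite -sqrtr_sqr ler_wsqrtr// w1.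
apply: filterS Sfin => x /(_ I) Sx.
have cs : cvgn (series (fun k => w k x ^+ 2)).
  apply: nondecreasing_is_cvgn.
    apply/nondecreasing_seqP => k; rewrite seriesSr lerDl; exact: sqr_ge0.
  by exists (fine (S x)) => _ [k _ <-]; rewrite /series/=; exact: wS.
have /cvgrPdist_lt H := cvg_series_cvg_0 cs.
apply/cvgrPdist_lt => e e0; have := H (e ^+ 2) (exprn_gt0 2 e0).
apply: filterS => k; rewrite !sub0r !normrN ger0_norm ?sqr_ge0//.
by rewrite -[w k x ^+ 2]real_normK ?num_real// ltr_pXn2r// nnegrE ltW.
Qed.

End fast_convergence.

Lemma seq_chain (R : realType) (F : R -> R) (a h : nat -> R) (a0 g F' : R) :
  (forall k, h k != 0) -> h k @[k --> \oo] --> (0 : R) ->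
  (a k - a0) / h k @[k --> \oo] --> g -> is_derive a0 (1 : R) F F' ->
  F (a k) @[k --> \oo] --> F a0 /\
  (F (a k) - F a0) / h k @[k --> \oo] --> F' * g.
Proof.
move=> h0 hc ac dF.
have aa : a k @[k --> \oo] --> a0.
  have : a0 + (a k - a0) / h k * h k @[k --> \oo] --> a0 + g * 0.
    by apply: cvgD; [exact: cvg_cst|exact: cvgM].
  by rewrite mulr0 addr0; under eq_fun do rewrite divfK// addrC subrK.
pose phi b := if b == a0 then F' else (F b - F a0) / (b - a0).
have phiE b : F b - F a0 = phi b * (b - a0).
  rewrite /phi; case: eqVneq => [->|ba]; first by rewrite !subrr mulr0.
  by rewrite divfK// subr_eq0.
have pa : phi (a k) @[k --> \oo] --> F'.
  apply/cvgrPdist_le => e e0; move/is_deriveP : dF => /(_ e e0)[r r0 Hr].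
  move/cvgrPdist_lt : aa => /(_ r r0); apply: filterS => k akr; rewrite /phi.
  case: eqVneq => [_|ne]; first by rewrite subrr normr0 ltW.
  have ne0 : a k - a0 != 0 by rewrite subr_eq0.
  have := Hr (a k - a0); rewrite distrC => /(_ akr).
  rewrite [(a k - a0) *: 1]mulr1 [a0 + _]addrC subrK [`|a0 - a k|]distrC => H.
  rewrite distrC (_ : _ - F' = (F (a k) - F a0 - (a k - a0) * F') / (a k - a0)); last by field.
  by rewrite normrM normfV ler_pdivrMr ?normr_gt0.
split.
  have : F a0 + phi (a k) * (a k - a0) @[k --> \oo] --> F a0 + F' * (a0 - a0).
    apply: cvgD; first exact: cvg_cst.
    by apply: cvgM => //; apply: cvgB => //; exact: cvg_cst.
  by rewrite subrr mulr0 addr0; under eq_fun do rewrite -phiE addrC subrK.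
under eq_fun do rewrite phiE -mulrA.
exact: cvgM.
Qed.

Section difference_quotients.
Context {R : realType} {n : nat}.
Local Notation Rn := 'rV[R]_n.
Local Notation leb := (lebesgue_rV n : {measure set Rn -> \bar R}).
Local Notation L2 := (L2 leb).
Local Notation nsq := (nsq leb).
Local Notation ig := (ig leb).
Implicit Types (f g phi : Rn -> R) (h : nat -> R).

Definition dq (i : 'I_n) (t : R) f : Rn -> R := fun x => (f (x + t *: e_ i) - f x) / t.

Definition HasD i h f g :=
  [/\ measurable_fun setT f, measurable_fun setT g,
      exists M, L2 M /\ {ae leb, forall x k, `|dq i (h k) f x| <= M x}
    & {ae leb, forall x, dq i (h k) f x @[k --> \oo] --> g x}].

Lemma SD_HasD i h f g : SD i f g -> (forall k, h k != 0) ->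
  (forall k, nsq (rem1 i (h k) f g) <= (1 / 2) ^+ k * h k ^+ 2) -> HasD i h f g.
Proof.
move=> [f2 g2 _] h0 hk.
pose w k x := (h k)^-1 * rem1 i (h k) f g x.
have w2 k : L2 (w k) by apply: L2Z; exact: L2_rem1.
have wk k : nsq (w k) <= (1 / 2) ^+ k.
  have hk0 : 0 < h k ^+ 2 by rewrite lt_neqAle sqr_ge0 eq_sym sqrf_eq0 h0.
  by rewrite nsqZ ?exprVn ?ler_pdivrMl// 1?mulrC//; exact: L2_rem1.
have wE k x : dq i (h k) f x = w k x + g x.
  by rewrite /dq /w /rem1; field; exact: h0.
have [[M [M2 wM]] w0] := fast_cvg w2 wk.
split; [exact: f2.1|exact: g2.1| |].
  exists (fun x => M x + `|g x|); split.
    apply: L2D => //; apply: (@L2_le _ _ _ _ 1 _ g) => //.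
      by apply: measurableT_comp => //; exact: g2.1.
    by move=> x; rewrite mul1r normr_id.
  apply: filterS wM => x wx k; rewrite wE (le_trans (ler_normD _ _))// lerD2r.
  exact: wx.
apply: filterS w0 => x wx; rewrite -[g x]add0r.
under eq_fun do rewrite wE.
by apply: cvgD => //; exact: cvg_cst.
Qed.

Lemma SD_HasD2 i f1 g1 f2 g2 : SD i f1 g1 -> SD i f2 g2 ->
  exists h, [/\ forall k, h k != 0, h k @[k --> \oo] --> (0 : R),
    HasD i h f1 g1 & HasD i h f2 g2].
Proof.
move=> D1 D2.
have ex k : exists t : R, [/\ 0 < t, t <= (1 / 2) ^+ k,
    nsq (rem1 i t f1 g1) <= (1 / 2) ^+ k * t ^+ 2
  & nsq (rem1 i t f2 g2) <= (1 / 2) ^+ k * t ^+ 2].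
  have k0 : (0 : R) < (1 / 2) ^+ k by rewrite exprn_gt0// divr_gt0.
  have [_ _ /(_ _ k0)[r1 r10 Hr1]] := D1; have [_ _ /(_ _ k0)[r2 r20 Hr2]] := D2.
  pose t := Num.min (Num.min r1 r2) ((1 / 2) ^+ k) / 2.
  have m0 : 0 < Num.min (Num.min r1 r2) ((1 / 2) ^+ k) by rewrite !lt_min r10 r20.
  have t0 : 0 < t by rewrite divr_gt0.
  have tlt : t < Num.min (Num.min r1 r2) ((1 / 2) ^+ k) by rewrite ltr_pdivrMr// ltr_pMr// ltr1n.
  move: (tlt); rewrite !lt_min => /andP[/andP[t1 t2] tk].
  by exists t; split => //; [exact: ltW|apply: Hr1; rewrite gtr0_norm|apply: Hr2; rewrite gtr0_norm].
have [h hP] := choice ex.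
have h0 k : h k != 0 by have [/lt0r_neq0] := hP k.
exists h; split => //.
- apply/cvgrPdist_le => e e0.
  have : geometric (1 : R) (1 / 2) k @[k --> \oo] --> 0.
    by apply: cvg_geometric; rewrite ger0_norm; lra.
  move/cvgrPdist_le => /(_ e e0); apply: filterS => k; rewrite !sub0r !normrN.
  have [hk0 hk _ _] := hP k; apply: le_trans; rewrite (gtr0_norm hk0) /geometric/=.
  by apply: (le_trans hk); rewrite [1 * (_ ^+ _)]mul1r; exact: ler_norm.
- by apply: SD_HasD => // k; have [] := hP k.
- by apply: SD_HasD => // k; have [] := hP k.
Qed.

Lemma HasD_prod i h f1 g1 f2 g2 (H F H' F' : R -> R) (BH BF LH LF : R) :
  (forall k, h k != 0) -> h k @[k --> \oo] --> (0 : R) ->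
  HasD i h f1 g1 -> HasD i h f2 g2 ->
  (forall t : R, is_derive t (1 : R) H (H' t)) -> (forall t : R, is_derive t (1 : R) F (F' t)) ->
  measurable_fun setT H' -> measurable_fun setT F' ->
  (forall t, `|H t| <= BH) -> (forall t, `|F t| <= BF) ->
  (forall s t, `|H s - H t| <= LH * `|s - t|) ->
  (forall s t, `|F s - F t| <= LF * `|s - t|) ->
  HasD i h (fun x => H (f1 x) * F (f2 x))
    (fun x => H' (f1 x) * g1 x * F (f2 x) + H (f1 x) * (F' (f2 x) * g2 x)).
Proof.
move=> h0 hc [mf1 mg1 [M1 [M12 fM1]] fg1] [mf2 mg2 [M2 [M22 fM2]] fg2] dH dF mH' mF' HB FB HL FL.
have cont (G G' : R -> R) : (forall t : R, is_derive t (1 : R) G (G' t)) -> measurable_fun setT G.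
  move=> dG; apply: continuous_measurable_fun => t.
  by apply: differentiable_continuous; apply/derivable1_diffP; have [] := dG t.
have mHf : measurable_fun setT (fun x => H (f1 x)) by apply: measurableT_comp => //; exact: cont dH.
have mFf : measurable_fun setT (fun x => F (f2 x)) by apply: measurableT_comp => //; exact: cont dF.
have dqE k x : dq i (h k) (fun x => H (f1 x) * F (f2 x)) x =
    (H (f1 (x + h k *: e_ i)) - H (f1 x)) / h k * F (f2 (x + h k *: e_ i)) +
    H (f1 x) * ((F (f2 (x + h k *: e_ i)) - F (f2 x)) / h k).
  by rewrite /dq; field; exact: h0.
split.
- exact: measurable_funM.
- apply: measurable_funD; apply: measurable_funM => //; apply: measurable_funM => //;
    exact: measurableT_comp.
- exists (fun x => LH * BF * M1 x + BH * LF * M2 x); split.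
    by apply: L2D; exact: L2Z.
  apply: filterS2 fM1 fM2 => x H1 H2 k; rewrite dqE (le_trans (ler_normD _ _))//.
  have := H1 k; have := H2 k; rewrite /dq !normrM !normfV.
  set a1 := f1 (x + _); set a2 := f2 (x + _) => h2 h1.
  have hi : 0 <= `|h k|^-1 by rewrite invr_ge0.
  have nLH : 0 <= LH by have := HL 1 0; rewrite subr0 normr1 mulr1; exact: le_trans.
  have nLF : 0 <= LF by have := FL 1 0; rewrite subr0 normr1 mulr1; exact: le_trans.
  have nBF : 0 <= BF by exact: le_trans (FB 0).
  have nBH : 0 <= BH by exact: le_trans (HB 0).
  apply: lerD.
    apply: (@le_trans _ _ (LH * M1 x * BF)); last by rewrite mulrAC.
    apply: ler_pM; [by apply: mulr_ge0|by []| |exact: FB].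
    apply: (@le_trans _ _ (LH * (`|a1 - f1 x| / `|h k|))); last by rewrite ler_wpM2l.
    by rewrite mulrA ler_wpM2r.
  rewrite -mulrA; apply: ler_pM; [by []|by apply: mulr_ge0|exact: HB|].
  apply: (@le_trans _ _ (LF * (`|a2 - f2 x| / `|h k|))); last by rewrite ler_wpM2l.
  by rewrite mulrA ler_wpM2r.
- apply: filterS2 fg1 fg2 => x H1 H2; under eq_fun do rewrite dqE.
  have [_ c1] := seq_chain h0 hc H1 (dH (f1 x)).
  have [c2 c3] := seq_chain h0 hc H2 (dF (f2 x)).
  apply: cvgD; first exact: cvgM.
  by apply: cvgM => //; exact: cvg_cst.
Qed.

Lemma HasD_WD i h f g : (forall k, h k != 0) -> h k @[k --> \oo] --> (0 : R) ->
  L2 f -> L2 g -> HasD i h f g -> WD i f g.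
Proof.
move=> h0 hc f2 g2 [_ _ [M [M2 fM]] fg] phi /test_Tst[N T].
have p2 := Tst_L2 T; have d2 := Tst_L2 (Tst_partial i T).
have E k : \int[leb]_x (dq i (h k) f x * phi x) =
    (- \int[leb]_x (f x * partial i phi x)) +
    (h k)^-1 * \int[leb]_x (f x * rem2 i (- h k) phi x).
  have r2 : L2 (rem2 i (- h k) phi).
    by apply: L2B; [exact: (L2_dtr (- h k *: e_ i) p2)|exact: L2Z].
  have i2 : ig (fun x => f x * phi (x - h k *: e_ i)).
    by apply: L2M => //; exact: (L2_tr (- (h k *: e_ i)) p2).
  have E1 : \int[leb]_x (f (x + h k *: e_ i) * phi x) =
      \int[leb]_x (f x * phi (x - h k *: e_ i)).
    rewrite -(Int_shift (h k *: e_ i) i2).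
    by apply: eq_Rintegral => x _; rewrite addrK.
  have i1 : ig (fun x => f (x + h k *: e_ i) * phi x).
    by apply: L2M => //; exact: (L2_tr (h k *: e_ i) f2).
  have i3 := L2M f2 p2; have i4 := L2M f2 d2.
  transitivity ((h k)^-1 * (\int[leb]_x (f (x + h k *: e_ i) * phi x) - \int[leb]_x (f x * phi x))).
    rewrite -IntB// -IntZ; last exact: igB.
    by apply: eq_Rintegral => x _; rewrite /dq; ring.
  have E2 : \int[leb]_x (f x * rem2 i (- h k) phi x) =
     \int[leb]_x (f x * phi (x - h k *: e_ i)) - \int[leb]_x (f x * phi x)
     + h k * \int[leb]_x (f x * partial i phi x).
    rewrite -IntZ// -IntB// -IntD//; [|exact: igB|exact: igZ].
    by apply: eq_Rintegral => x _; rewrite /rem2 scaleNr; ring.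
  rewrite E1 E2.
  move: (\int[leb]_x (f x * phi (x - h k *: e_ i))) (\int[leb]_x (f x * phi x)) (\int[leb]_x (f x * partial i phi x)) => A B D.
  by field; exact: h0.
have mdq k : measurable_fun setT (dq i (h k) f).
  apply: measurable_funM => //; apply: measurable_funB; last exact: f2.1.
  exact: (measurable_tr (h k *: e_ i) f2.1).
have c1 : \int[leb]_x (dq i (h k) f x * phi x) @[k --> \oo] --> \int[leb]_x (g x * phi x).
  apply: (proj2 (@dct _ _ _ _ (fun k x => dq i (h k) f x * phi x) _ (fun x => M x * `|phi x|) _ _ _ _ _)).
  - by move=> k; apply: measurable_funM => //; exact: p2.1.
  - by apply: measurable_funM; [exact: g2.1|exact: p2.1].
  - apply: L2M => //; apply: (@L2_le _ _ _ _ 1 _ phi) => //.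
      by apply: measurableT_comp => //; exact: p2.1.
    by move=> x; rewrite mul1r normr_id.
  - by apply: filterS fg => x H; apply: cvgM => //; exact: cvg_cst.
  - by apply: filterS fM => x H k; rewrite normrM ler_wpM2r.
have [c c0 Hc] := rem2_kern i T; set V := @bvol R n (nbox (N + 1)).
have c2 : (h k)^-1 * \int[leb]_x (f x * rem2 i (- h k) phi x) @[k --> \oo] --> (0 : R).
  pose C := c * Num.sqrt (nsq f * V).
  have C0 : 0 <= C by rewrite mulr_ge0// sqrtr_ge0.
  have C1 : 0 < C + 1 by rewrite ltr_wpDl.
  apply/cvgrPdist_le => e e0.
  have m0 : 0 < Num.min 1 (e / (C + 1)) by rewrite lt_min ltr01 divr_gt0.
  move/cvgrPdist_le : hc => /(_ _ m0); apply: filterS => k.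
  rewrite !sub0r !normrN le_min => /andP[h1 he].
  have hN : `|- h k| <= 1 by rewrite normrN.
  have kt := Hc _ hN.
  rewrite normrM normfV ler_pdivrMl ?normr_gt0//.
  apply: (le_trans (CS_norm f2 (kern_L2 kt))).
  apply: (@le_trans _ _ (Num.sqrt (nsq f * ((c * (- h k) ^+ 2) ^+ 2 * V)))).
    by rewrite ler_wsqrtr// ler_wpM2l ?nsq_ge0//; exact: nsq_kern kt.
  rewrite sqrrN mulrCA sqrtrM ?sqr_ge0// sqrtr_sqr ger0_norm; last by rewrite mulr_ge0// sqr_ge0.
  rewrite mulrAC -/C -[h k ^+ 2]real_normK ?num_real// expr2 mulrA [leRHS]mulrC ler_wpM2r//.
  apply: (@le_trans _ _ ((C + 1) * `|h k|)); first by rewrite ler_wpM2r// lerDl.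
  by rewrite mulrC -ler_pdivlMr.
have c3 : \int[leb]_x (dq i (h k) f x * phi x) @[k --> \oo] -->
   (- \int[leb]_x (f x * partial i phi x)) + 0.
  by under eq_fun do rewrite E; apply: cvgD => //; exact: cvg_cst.
have := cvg_unique _ c1 c3; rewrite addr0 => ->//.
by rewrite opprK.
Qed.

End difference_quotients.

(** * The nonlocal form *)

Section kernel_integrability.
Context {R : realType}.
Local Notation leb1 := (@lebesgue_measure R : {measure set (measurableTypeR R) -> \bar R}).
Implicit Types (w : R -> R) (s r rho C : R).

Lemma sum_geometric_le C rho (k : nat) : 0 <= C -> 0 <= rho < 1 ->
  \sum_(0 <= j < k) (C * rho ^+ j) <= C / (1 - rho).
Proof.
move=> C0 /andP[r0 r1]; have r10 : 0 < 1 - rho by rewrite subr_gt0.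
rewrite -mulr_sumr ler_wpM2l// -[leLHS](mulfK (lt0r_neq0 r10)) ler_pdivrMr// mulVf ?lt0r_neq0//.
have -> : (\sum_(0 <= j < k) rho ^+ j) * (1 - rho) = 1 - rho ^+ k.
  elim: k => [|k IH]; first by rewrite big_geq// mul0r expr0 subrr.
  by rewrite big_nat_recr//= mulrDl IH exprS; ring.
by rewrite gerBl exprn_ge0.
Qed.

(* Domination by countably many step functions whose integrals form a
   geometric series. *)
Lemma ig_geometric_steps w (c l : nat -> R) C rho : measurable_fun setT w ->
  (forall r, 0 <= w r) -> (forall k, 0 <= c k) -> (forall k, 0 <= l k) ->
  0 <= C -> 0 <= rho < 1 -> (forall k, c k * l k <= C * rho ^+ k) ->
  (forall r, w r = 0 \/ exists k, `|r| <= l k /\ w r <= c k) ->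
  ig leb1 w.
Proof.
move=> mw w0 c0 l0 C0 rho01 cl wcl.
pose I k : set (measurableTypeR R) := `[(- l k), (l k)]%classic.
have mI k : measurable (I k) by exact: measurable_itv.
pose S (r : R) := (\sum_(0 <= k <oo) (c k * \1_(I k) r)%:E)%E.
have t0 k r : (0 <= (c k * \1_(I k) r)%:E)%E by rewrite lee_fin mulr_ge0.
have mt k : measurable_fun setT (fun r => (c k * \1_(I k) r)%:E).
  by apply/measurable_EFinP; apply: measurable_funM => //; exact: (measurable_indic (mI k)).
have mS : measurable_fun [set: measurableTypeR R] S.
  by apply: ge0_emeasurable_sum => [k x _ _|k _]; [exact: t0|exact: mt].
apply/integrableP; split; first exact/measurable_EFinP.
apply: (@le_lt_trans _ _ (\int[leb1]_r S r)%E).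
  apply: ge0_le_integral => //.
  - by apply: measurableT_comp => //; exact/measurable_EFinP.
  - move=> r _ /=; rewrite ger0_norm//; have [->|[k [rl wc]]] := wcl r.
      by apply: nneseries_ge0 => k _ _; exact: t0.
    apply: (@le_trans _ _ (\sum_(0 <= j < k.+1) (c j * \1_(I j) r)%:E)%E); last first.
      by apply: nneseries_lim_ge => j _ _; exact: t0.
    rewrite sumEFin lee_fin big_nat_recr//= indicE mem_set ?mulr1; last first.
      by rewrite /I /= in_itv/= -ler_norml.
    by rewrite (le_trans wc)// lerDr; apply: sumr_ge0 => j _; rewrite -lee_fin; exact: t0.
rewrite integral_nneseries//; apply: (@le_lt_trans _ _ (2 * C / (1 - rho))%:E); last exact: ltry.
apply: lime_le.
  by apply: is_cvg_nneseries => k _ _; apply: integral_ge0 => x _; exact: t0.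
apply: nearW => k; apply: (@le_trans _ _ (\sum_(0 <= j < k) (2 * C * rho ^+ j)%:E)%E).
  apply: lee_sum => j _.
  under eq_integral do rewrite EFinM.
  rewrite ge0_integralZl//; last 2 first.
    by apply/measurable_EFinP; exact: (measurable_indic (mI j)).
    by rewrite lee_fin.
  rewrite integral_indic// setIT (_ : leb1 (I j) = lebesgue_measure (`[(- l j), (l j)]%classic : set R))//.
  rewrite lebesgue_measure_itv/= lte_fin.
  have := cl j; have := l0 j; have := c0 j => cj lj clj.
  have Cr : 0 <= C * rho ^+ j by rewrite (le_trans _ clj)// mulr_ge0.
  case: ifPn => _; last by rewrite mule0 lee_fin -mulrA mulr_ge0.
  rewrite -EFinD -EFinM lee_fin opprK; move: clj Cr; lra.
by rewrite sumEFin lee_fin sum_geometric_le// mulr_ge0.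
Qed.

Definition kap s r : R := (`|r| `^ (1 + 2 * s))^-1.

Lemma kap_ge0 s r : 0 <= kap s r.
Proof. by rewrite invr_ge0 powR_ge0. Qed.

Lemma measurable_kap s : measurable_fun setT (kap s).
Proof.
rewrite (_ : kap s = (@powR R)^~ (- (1 + 2 * s)) \o normr).
  by apply: measurableT_comp; [exact: measurable_powR|exact: normr_measurable].
by apply/funext => r; rewrite /kap -powRN.
Qed.

Lemma half_powR_bounds s : 0 < s < 1 ->
  1 / 8 < (1 / 2 : R) `^ (1 + 2 * s) < 1 / 2.
Proof.
move=> /andP[s0 s1].
have h2 : (0 : R) < 1 / 2 by rewrite divr_gt0.
have E a : (1 / 2 : R) `^ a = expR (a * ln (1 / 2)).
  by rewrite /powR gt_eqF.
have ln2 : ln (1 / 2 : R) < 0 by apply: ln_lt0; rewrite h2/= ltr_pdivrMr// mul1r ltr1n.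
apply/andP; split.
  have -> : (1 / 8 : R) = (1 / 2) `^ 3 by rewrite powR_mulrn ?ltW//; field.
  rewrite !E ltr_expR ltr_nM2r//; lra.
have -> : (1 / 2 : R) = (1 / 2) `^ 1 by rewrite powRr1// ltW.
rewrite [X in X `^ (1 + _)]powRr1 ?ltW// !E ltr_expR ltr_nM2r//; lra.
Qed.

Lemma dyadic_small r : 0 < r <= 1 -> exists k : nat, (1 / 2) ^+ k.+1 < r <= (1 / 2) ^+ k.
Proof.
move=> /andP[r0 r1].
have ex : exists k : nat, (1 / 2) ^+ k.+1 < r.
  have : geometric (1 : R) (1 / 2) k @[k --> \oo] --> 0.
    by apply: cvg_geometric; rewrite ger0_norm; lra.
  move/cvgrPdist_lt => /(_ r r0)[k _ /(_ k.+1 (leqnSn k))].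
  rewrite sub0r normrN /geometric/= [1 * (_ ^+ _)]mul1r => H; exists k.
  by apply: le_lt_trans H; exact: ler_norm.
exists (ex_minn ex); case: ex_minnP => k -> kmin /=.
case: k kmin => [|k] kmin; first by rewrite expr0.
by rewrite leNgt; apply/negP => /kmin; rewrite ltnn.
Qed.

Lemma powR_half (p : R) k : ((1 / 2) ^+ k) `^ p = ((1 / 2) `^ p) ^+ k.
Proof.
elim: k => [|k IH]; first by rewrite !expr0 powR1.
by rewrite !exprS powRM ?exprn_ge0 ?divr_ge0// IH.
Qed.

Lemma ig_kernel s : 0 < s < 1 -> ig leb1 (fun r => Num.min 1 (r ^+ 2) * kap s r).
Proof.
move=> s01; have /andP[s0 s1] := s01.
set p := 1 + 2 * s; set q := (1 / 2 : R) `^ p.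
have /andP[q8 q2] : 1 / 8 < q < 1 / 2 by exact: half_powR_bounds.
have q0 : 0 < q by move: q8; lra.
have p0 : 0 <= p by rewrite /p; lra.
have mk := measurable_kap s.
have mx (B : set R) : measurable (B : set (measurableTypeR R)) ->
    measurable_fun setT (fun r => \1_B r * (Num.min 1 (r ^+ 2) * kap s r)).
  move=> mB; apply: measurable_funM; first exact: (measurable_indic mB).
  apply: measurable_funM => //; apply: measurable_minr => //; exact: measurable_funX.
have m0 r : 0 <= Num.min 1 (r ^+ 2) * kap s r.
  by rewrite mulr_ge0 ?kap_ge0// le_min ler01 sqr_ge0.
have h0 k : (0 : R) < (1 / 2) ^+ k by rewrite exprn_gt0.
pose B1 : set R := `[(-1), 1]%classic; pose B2 : set R := ~` B1.
have mB1 : measurable (B1 : set (measurableTypeR R)) by exact: measurable_itv.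
have in1 r : r \in B1 = (`|r| <= 1).
  by rewrite /B1; apply/idP/idP; rewrite inE/= in_itv/= ler_norml.
have -> : (fun r => Num.min 1 (r ^+ 2) * kap s r) =
   fun r => \1_B1 r * (Num.min 1 (r ^+ 2) * kap s r) + \1_B2 r * (Num.min 1 (r ^+ 2) * kap s r).
  apply/funext => r; rewrite -mulrDl !indicE in_setC; case: (r \in B1); rewrite /= ?addr0 ?add0r mul1r//.
apply: igD.
  apply: (@ig_geometric_steps _ (fun k => ((1 / 2) ^+ k) ^+ 2 / q ^+ k.+1) (fun k => (1 / 2) ^+ k) q^-1 (1 / 8 / q)) => //.
  - exact: mx.
  - by move=> r; rewrite mulr_ge0.
  - by move=> k; rewrite divr_ge0 ?sqr_ge0// exprn_ge0// ltW.
  - by rewrite invr_ge0; exact: ltW.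
  - by apply/andP; split; [apply: divr_ge0; [lra|exact: ltW]|rewrite ltr_pdivrMr//; move: q8; lra].
  - move=> k; rewrite le_eqVlt; apply/orP; left; apply/eqP.
    have e8 : (1 / 8 : R) ^+ k = ((1 / 2) ^+ k) ^+ 3.
      by rewrite -exprM mulnC exprM; congr (_ ^+ k); field.
    rewrite (expr_div_n (1 / 8) q k) e8 [q ^+ k.+1]exprS invfM.
    move: ((1 / 2) ^+ k) (q ^+ k) => b c; ring.
  - move=> r; rewrite indicE in1; case: (leP `|r| 1) => r1; last by left; rewrite mul0r.
    have [->|rn0] := eqVneq r 0.
      by left; rewrite expr0n/= min_r// mul0r mulr0.
    right; have [|k /andP[kr rk]] := @dyadic_small `|r|.
      by rewrite normr_gt0 rn0.
    exists k; split => //; rewrite [true%:R * _]mul1r /kap -/p; apply: ler_pM.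
    + by rewrite le_min ler01 sqr_ge0.
    + by rewrite invr_ge0 powR_ge0.
    + by rewrite ge_min -[r ^+ 2]real_normK ?num_real// lerXn2r ?orbT// nnegrE ltW.
    + rewrite lef_pV2 ?posrE ?powR_gt0 ?normr_gt0// ?exprn_gt0//.
      by rewrite /q -powR_half ge0_ler_powR ?nnegrE// ltW.
apply: (@ig_geometric_steps _ (fun k => q ^+ k) (fun k => 2 ^+ k.+1) 2 (2 * q)) => //.
- by apply: mx; exact: measurableC.
- by move=> r; rewrite mulr_ge0.
- by move=> k; rewrite exprn_ge0// ltW.
- by move: q0 q2; rewrite -[X in _ < X]mul1r; move=> *; apply/andP; split; lra.
- by move=> k; rewrite exprS exprMn le_eqVlt; apply/orP; left; apply/eqP; ring.
- move=> r; rewrite indicE in_setC in1; case: (leP `|r| 1) => r1; first by left; rewrite mul0r.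
  right; have r0 : 0 < `|r| by apply: lt_trans r1.
  have [|k /andP[kr rk]] := @dyadic_small `|r|^-1.
    by rewrite invr_gt0 r0/= invf_le1// ltW.
  have hk j : (1 / 2 : R) ^+ j = (2 ^+ j)^-1 by rewrite mul1r exprVn.
  exists k; split.
    move: kr; rewrite hk ltf_pV2 ?posrE ?exprn_gt0// => /ltW; exact.
  rewrite [(~~ false)%:R * _]mul1r -[leRHS]mul1r; apply: ler_pM.
  + by rewrite le_min ler01 sqr_ge0.
  + by rewrite invr_ge0 powR_ge0.
  + by rewrite ge_min lexx.
  + have rE : `|r|^-1 `^ p = (`|r| `^ p)^-1.
      apply: (mulIf (x := `|r| `^ p)); first by rewrite gt_eqF// powR_gt0.
      by rewrite -powRM ?invr_ge0// mulVf ?gt_eqF// powR1 mulVf// gt_eqF// powR_gt0.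
    by rewrite /kap -/p -rE /q -powR_half ge0_ler_powR ?nnegrE ?invr_ge0.
Qed.

End kernel_integrability.

Section real_fubini.
Context d1 d2 (T1 : measurableType d1) (T2 : measurableType d2) (R : realType).
Variables (m1 : {sigma_finite_measure set T1 -> \bar R})
  (m2 : {sigma_finite_measure set T2 -> \bar R}).

Lemma Int_fubini1 (f : T1 * T2 -> R) : (m1 \x m2)%E.-integrable setT (EFin \o f) ->
  \int[(m1 \x m2)%E]_z f z = \int[m1]_x \int[m2]_y f (x, y).
Proof.
move=> fi; congr fine; rewrite -integral12_prod_meas1//.
have mf : measurable_fun setT f by apply/measurable_EFinP; exact: measurable_int fi.
apply: ae_eq_integral => //.
- exact: (measurable_fubini_F fi).
- by apply/measurable_EFinP; exact: measurable_Int.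
- apply: filterS (ae_integrable1 fi) => x ix _.
  by rewrite /fubini_F -EFin_Int.
Qed.

Lemma Int_fubini2 (f : T1 * T2 -> R) : (m1 \x m2)%E.-integrable setT (EFin \o f) ->
  \int[(m1 \x m2)%E]_z f z = \int[m2]_y \int[m1]_x f (x, y).
Proof.
move=> fi; congr fine; rewrite -integral21_prod_meas1//.
have mf : measurable_fun setT f by apply/measurable_EFinP; exact: measurable_int fi.
apply: ae_eq_integral => //.
- exact: (measurable_fubini_G fi).
- apply/measurable_EFinP.
  apply: (@measurable_Int _ _ T2 T1 R m1 (fun z => f (z.2, z.1))).
  by apply: measurableT_comp => //; exact: measurable_swap.
- apply: filterS (ae_integrable2 fi) => x ix _.
  by rewrite /fubini_G -EFin_Int.
Qed.

Lemma ig_fubini2 (f : T1 * T2 -> R) : (m1 \x m2)%E.-integrable setT (EFin \o f) ->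
  ig m2 (fun y => \int[m1]_x f (x, y)).
Proof.
move=> fi; have mf : measurable_fun setT f by apply/measurable_EFinP; exact: measurable_int fi.
have mG : measurable_fun setT (fun y => \int[m1]_x f (x, y)).
  apply: (@measurable_Int _ _ T2 T1 R m1 (fun z => f (z.2, z.1))).
  by apply: measurableT_comp => //; exact: measurable_swap.
apply/integrableP; split; first exact/measurable_EFinP.
apply: le_lt_trans ((integrable21ltyP _ _ (measurable_int _ fi)).1 fi).
apply: ge0_le_integral => //.
- by apply: measurableT_comp => //; exact/measurable_EFinP.
- apply: (measurable_fun_fubini_tonelli_G (m1 := m1) (abse \o (EFin \o f))).
    by apply: measurableT_comp => //; exact/measurable_EFinP.
  by move=> z; exact: abse_ge0.
move=> y _ /=; apply: (@le_trans _ _ `|\int[m1]_x (f (x, y))%:E|%E); last first.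
  by apply: le_abse_integral => //; apply/measurable_EFinP; exact: measurableT_comp.
rewrite -abse_EFin /Rintegral.
by case: (\int[m1]_x (f (x, y))%:E)%E => //= *; rewrite ?normr0 leey.
Qed.

End real_fubini.

Section nonlocal_form.
Context {R : realType} {n : nat}.
Local Notation Rn := 'rV[R]_n.
Local Notation leb := (lebesgue_rV n : {measure set Rn -> \bar R}).
Local Notation leb1 := (@lebesgue_measure R).
Local Notation L2 := (L2 leb).
Local Notation nsq := (nsq leb).
Local Notation ig := (ig leb).
Local Notation bvol := (@bvol R n).
Implicit Types (u v w f : Rn -> R).

Lemma Tst_SD M v i : Tst M v -> SD i v (partial i v).
Proof.
move=> T; split; [exact: Tst_L2 T|exact: Tst_L2 (Tst_partial i T)|move=> e e0].
have [c c0 Hc] := rem2_kern i T; set V := bvol (nbox (M + 1)).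
pose C := c ^+ 2 * V + 1.
have V0 : 0 <= V by rewrite ltW// bvol_gt0.
have C0 : 0 < C by rewrite ltr_wpDl// mulr_ge0 ?sqr_ge0.
exists (Num.min 1 (e / C)); first by rewrite lt_min ltr01 divr_gt0.
move=> t; rewrite lt_min => /andP[/ltW t1 te].
apply: (le_trans (nsq_kern (Hc _ t1))).
have t2 : t ^+ 2 <= `|t|.
  by rewrite -[t ^+ 2]real_normK ?num_real// expr2; apply: ler_piMl.
rewrite (_ : _ * bvol _ = (c ^+ 2 * V * t ^+ 2) * t ^+ 2); last by rewrite /V; ring.
rewrite ler_wpM2r ?sqr_ge0//; apply: (@le_trans _ _ (C * `|t|)).
  have A0 : 0 <= c ^+ 2 * V by rewrite mulr_ge0 ?sqr_ge0.
  by apply: ler_pM => //; rewrite ?sqr_ge0// /C lerDl.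
by rewrite mulrC -ler_pdivlMr// ltW.
Qed.

Definition gsq (g : 'I_n -> Rn -> R) : R := \sum_i nsq (g i).

Lemma gsq_ge0 g : 0 <= gsq g.
Proof. by apply: sumr_ge0 => i _; exact: nsq_ge0. Qed.

Lemma nsq_dtr_SD f (g : 'I_n -> Rn -> R) h : L2 f -> (forall i, SD i f (g i)) ->
  nsq (dtr h f) <= 2 * n%:R ^+ 2 * gsq g * `|h| ^+ 2.
Proof.
move=> f2 fg; rewrite (_ : _ * gsq g = n%:R ^+ 2 * (2 * gsq g)); last by ring.
apply: nsq_dtr_all => //; first by rewrite mulr_ge0// gsq_ge0.
move=> i t; apply: (le_trans (SD_bound t (fg i))).
rewrite mulrAC ler_wpM2r ?sqr_ge0// ler_wpM2l// /gsq (bigD1 i)//= lerDl.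
by apply: sumr_ge0 => j _; exact: nsq_ge0.
Qed.

Definition d2 v (h x : Rn) : R := 2 * v x - v (x + h) - v (x - h).

Lemma d2E v h : d2 v h = dtr (- h) (dtr h v).
Proof. by apply/funext => x; rewrite /d2 /dtr subrK; ring. Qed.

Lemma L2_d2 v h : L2 v -> L2 (d2 v h).
Proof. by move=> v2; rewrite d2E; apply: L2_dtr; exact: L2_dtr. Qed.

Lemma Tst_dtr M v h : Tst M v -> exists M', Tst M' (dtr h v) /\
  forall i, partial i (dtr h v) = dtr h (partial i v).
Proof.
move=> T; exists (M + `|h|); split.
  have T1 := Tst_tr h T.
  have T2 : Tst (M + `|h|) v by apply: Tst_le T; rewrite lerDl.
  have := TstD T1 (TstZ (-1) T2).
  by rewrite (_ : (fun x => _ + _) = dtr h v)//; apply/funext => x; rewrite mulN1r.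
move=> i; apply/funext => x; apply: partialE.
have d1 : is_derive x (e_ i) (fun y : Rn => v (y + h)) (partial i v (x + h)).
  by apply/is_derive_tr; apply: derivable_partial; exact: Tst_derivable T.
have d2 : is_derive x (e_ i) v (partial i v x).
  by apply: derivable_partial; exact: Tst_derivable T.
exact: (is_deriveB d1 d2).
Qed.

Lemma nsq_d2 M v : Tst M v -> exists2 C : R, 0 <= C &
  forall h, nsq (d2 v h) <= C * (Num.min 1 (`|h| ^+ 2)) ^+ 2.
Proof.
move=> T; have v2 := Tst_L2 T.
pose N2 := \sum_i gsq (fun j => partial j (partial i v)).
pose C := (2 * n%:R ^+ 2) ^+ 2 * N2.
have N20 : 0 <= N2 by apply: sumr_ge0 => i _; exact: gsq_ge0.
have C0 : 0 <= C by rewrite mulr_ge0// sqr_ge0.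
have le4 h : nsq (d2 v h) <= C * (`|h| ^+ 2) ^+ 2.
  have [M' [T' pE]] := Tst_dtr h T.
  rewrite d2E; apply: (le_trans (nsq_dtr_SD (- h) (L2_dtr h v2) (fun i => Tst_SD i T'))).
  rewrite normrN (_ : C * _ = 2 * n%:R ^+ 2 * (2 * n%:R ^+ 2 * N2 * `|h| ^+ 2) * `|h| ^+ 2); last by rewrite /C; ring.
  rewrite ler_wpM2r ?sqr_ge0// ler_wpM2l ?mulr_ge0 ?sqr_ge0//.
  rewrite /gsq /N2 mulr_sumr mulr_suml; apply: ler_sum => i _; rewrite pE.
  apply: nsq_dtr_SD; first exact: Tst_L2 (Tst_partial i T).
  by move=> j; exact: Tst_SD (Tst_partial i T).
have le0 h : nsq (d2 v h) <= 16 * nsq v.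
  rewrite d2E; apply: (le_trans (nsq_dtr_le _ (L2_dtr h v2))).
  by have := nsq_dtr_le h v2; lra.
exists (C + 16 * nsq v); first by rewrite addr_ge0// mulr_ge0// nsq_ge0.
move=> h; have v0 : 0 <= 16 * nsq v by rewrite mulr_ge0// nsq_ge0.
case: (leP 1 (`|h| ^+ 2)) => h1.
  by rewrite expr1n mulr1 (le_trans (le0 h))// lerDr.
by rewrite (le_trans (le4 h))// ler_wpM2r ?sqr_ge0// lerDl.
Qed.

Definition Dform u v (h : Rn) : R := \int[leb]_x (u x * d2 v h x).

Lemma DformE u v h : L2 u -> L2 v -> Dform u v h = \int[leb]_x (dtr h u x * dtr h v x).
Proof.
move=> u2 v2; have uh := L2_tr h u2; have vh := L2_tr h v2.
have vn := L2_tr (- h) v2.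
have E1 : \int[leb]_x (tr h u x * tr h v x) = \int[leb]_x (u x * v x).
  exact: (Int_shift h (L2M u2 v2)).
have E2 : \int[leb]_x (tr h u x * v x) = \int[leb]_x (u x * tr (- h) v x).
  rewrite -(Int_shift h (L2M u2 vn)); apply: eq_Rintegral => x _.
  by rewrite /tr addrK.
transitivity (\int[leb]_x (u x * v x) - \int[leb]_x (u x * tr h v x) -
   (\int[leb]_x (u x * tr (- h) v x) - \int[leb]_x (u x * v x))).
  rewrite -IntB; [|exact: L2M|exact: L2M]. rewrite -IntB; [|exact: L2M|exact: L2M].
  rewrite -IntB; [|by apply: igB; exact: L2M|by apply: igB; exact: L2M].
  by apply: eq_Rintegral => x _; rewrite /d2 /tr; ring.
transitivity (\int[leb]_x (tr h u x * tr h v x) - \int[leb]_x (u x * tr h v x) -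
   (\int[leb]_x (tr h u x * v x) - \int[leb]_x (u x * v x))); first by rewrite E1 E2.
rewrite -IntB; [|exact: L2M|exact: L2M]. rewrite -IntB; [|exact: L2M|exact: L2M].
rewrite -IntB; [|by apply: igB; exact: L2M|by apply: igB; exact: L2M].
by apply: eq_Rintegral => x _; rewrite /dtr /tr; ring.
Qed.

Lemma Dform_le u v h : L2 u -> L2 v ->
  `|Dform u v h| <= Num.sqrt (nsq (dtr h u) * nsq (dtr h v)).
Proof. by move=> u2 v2; rewrite DformE//; apply: CS_norm; exact: L2_dtr. Qed.

Lemma Dform_sub u v w h : L2 u -> L2 v -> L2 w ->
  Dform u v h - Dform u w h = Dform u (fun x => v x - w x) h.
Proof.
move=> u2 v2 w2; rewrite -IntB; [|by apply: L2M => //; exact: L2_d2|by apply: L2M => //; exact: L2_d2].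
by apply: eq_Rintegral => x _; rewrite /d2; ring.
Qed.

Lemma measurable_enorm : measurable_fun setT (@enorm R n).
Proof.
apply: (@measurableT_comp _ _ _ _ _ _ (@Num.sqrt R)).
  by apply: continuous_measurable_fun; exact: sqrt_continuous.
apply: measurable_sum => i; apply: measurable_funM; exact: (@measurable_rV_coord R n i).
Qed.

Lemma measurable_sphere : measurable (sphere n : set Rn).
Proof.
have := measurable_enorm measurableT (@measurable_set1 R 1).
by rewrite setTI.
Qed.

Lemma sphere_norm_le (t : Rn) : sphere n t -> `|t| <= 1.
Proof.
move=> t1; apply: rV_norm_le => // j.
have d1 : dotrv t t = 1.
  have d0 : 0 <= dotrv t t by apply: sumr_ge0 => i _; rewrite -expr2 sqr_ge0.
  by rewrite -(sqr_sqrtr d0) (_ : Num.sqrt _ = 1) ?expr1n.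
rewrite -(@ler_pXn2r _ 2)// ?nnegrE// expr1n real_normK ?num_real//.
rewrite -d1 /dotrv (bigD1 j)//= -expr2 lerDl.
by apply: sumr_ge0 => i _; rewrite -expr2 sqr_ge0.
Qed.

End nonlocal_form.

Section sigma_finite_product.
Context d1 d2 (T1 : measurableType d1) (T2 : measurableType d2) (R : realType).
Variables (m1 : {sigma_finite_measure set T1 -> \bar R})
  (m2 : {sigma_finite_measure set T2 -> \bar R}).

(* The library's canonical structures on [m1 \x m2] only reach measures of mass
   at most 1; this alias carries the sigma-finite one. *)
Definition prod_sf : set (T1 * T2) -> \bar R := (m1 \x m2)%E.

HB.instance Definition _ := Measure.on prod_sf.

Let prod_sf_sigma_finite : sigma_finite setT prod_sf.
Proof.
have /sigma_finiteP[F [TF ndF Foo]] := sigma_finiteT m1.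
have /sigma_finiteP[G [TG ndG Goo]] := sigma_finiteT m2.
exists (fun k => F k `*` G k).
  apply/esym; rewrite -subTset => -[x y] _.
  have [k _ Fkx] : (\bigcup_k F k) x by rewrite -TF.
  have [l _ Gly] : (\bigcup_k G k) y by rewrite -TG.
  exists (maxn k l) => //; split.
    by move: Fkx; exact/subsetPset/ndF/leq_maxl.
  by move: Gly; exact/subsetPset/ndG/leq_maxr.
move=> k; have [mF Fkoo] := Foo k; have [mG Gkoo] := Goo k; split.
  exact: measurableX.
by rewrite /prod_sf product_measure1E// lte_mul_pinfty// ge0_fin_numE.
Qed.

HB.instance Definition _ := Measure_isSigmaFinite.Build _ _ _ prod_sf
  prod_sf_sigma_finite.

End sigma_finite_product.

Section nonlocal_representation.
Context {R : realType} {n : nat}.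
Local Notation Rn := 'rV[R]_n.
Local Notation leb := (lebesgue_rV n : {measure set Rn -> \bar R}).
Local Notation leb1 := (@lebesgue_measure R).
Local Notation L2 := (L2 leb).
Local Notation nsq := (nsq leb).
Implicit Types (u v w f : Rn -> R).
Variables (s : R) (mu : {finite_measure set Rn -> \bar R}).
Hypothesis s01 : 0 < s < 1.
Local Notation T2 := (Rn * measurableTypeR R)%type.
Definition Pm : {sigma_finite_measure set T2 -> \bar R} := prod_sf mu leb1.
Local Notation P := Pm.

Definition Kn (z : T2) : R := \1_(sphere n) z.1 * kap s z.2.

Lemma Kn_ge0 z : 0 <= Kn z.
Proof. by rewrite mulr_ge0// kap_ge0. Qed.

Lemma measurable_Kn : measurable_fun setT Kn.
Proof.
apply: measurable_funM.
  by apply: measurableT_comp => //; apply: measurable_indic; exact: measurable_sphere.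
by apply: measurableT_comp => //; exact: measurable_kap.
Qed.

Definition Wn (z : T2) : R := Kn z * Num.min 1 (z.2 ^+ 2).

Lemma Wn_ge0 z : 0 <= Wn z.
Proof. by rewrite mulr_ge0 ?Kn_ge0// le_min ler01 sqr_ge0. Qed.

Lemma measurable_Wn : measurable_fun setT Wn.
Proof.
apply: measurable_funM; first exact: measurable_Kn.
by apply: measurable_minr => //; apply: measurable_funX; exact: measurable_snd.
Qed.

Lemma ig_Wn : ig P Wn.
Proof.
have mW : measurable_fun setT (EFin \o Wn) by apply/measurable_EFinP; exact: measurable_Wn.
apply/(integrable12ltyP mu leb1 mW).
have iw := ig_kernel s01; set w := (fun r : R => _) in iw.
have w0 r : 0 <= w r by rewrite mulr_ge0 ?kap_ge0// le_min ler01 sqr_ge0.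
have /integrableP[mw Iw] := iw.
apply: (@le_lt_trans _ _ (\int[mu]_t (\int[leb1]_r `|(w r)%:E|))%E).
  apply: ge0_le_integral => //.
  - by move=> t _; apply: integral_ge0.
  - apply: (measurable_fun_fubini_tonelli_F (m2 := leb1) (abse \o (EFin \o Wn))).
      exact: measurableT_comp.
    by move=> z; exact: abse_ge0.
  move=> t _; apply: ge0_le_integral => //.
  - by apply: measurableT_comp => //; apply: measurableT_comp mW _.
  - exact: measurableT_comp.
  move=> r _ /=; rewrite lee_fin !ger0_norm ?Wn_ge0//.
  rewrite /Wn /Kn/= -mulrA [kap _ _ * _]mulrC -/(w r).
  by apply: ler_piMl; [exact: w0|rewrite indicE; case: (_ \in _)].
have I0 : (0 <= \int[leb1]_r `|(w r)%:E|)%E by exact: integral_ge0.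
rewrite integral_cst//; apply: lte_mul_pinfty => //.
  by rewrite ge0_fin_numE.
by rewrite ltey_eq fin_num_measure.
Qed.

Definition Phi u v (p : Rn * T2) : R := u p.1 * (Kn p.2 * d2 v (p.2.2 *: p.2.1) p.1).

Lemma measurable_shift_prod (c : R) :
  measurable_fun setT (fun p : Rn * T2 => p.1 + (c * p.2.2) *: p.2.1).
Proof.
apply: measurable_fun_rVP => i.
rewrite (_ : _ \o _ = fun p : Rn * T2 => rV_coord i p.1 + c * p.2.2 * rV_coord i p.2.1); last first.
  by apply/funext => z; rewrite /= /rV_coord !mxE.
apply: (@measurable_funD _ _ _ _ (fun p : Rn * T2 => rV_coord i p.1 : R)).
  by apply: measurableT_comp => //; exact: measurable_rV_coord.
apply: (@measurable_funM _ _ _ _ (fun p : Rn * T2 => c * p.2.2)).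
  by apply: measurable_funM => //; apply: measurableT_comp.
by apply: measurableT_comp; [exact: measurable_rV_coord|apply: measurableT_comp].
Qed.

Lemma measurable_d2 v : measurable_fun setT v ->
  measurable_fun setT (fun p : Rn * T2 => d2 v (p.2.2 *: p.2.1) p.1).
Proof.
move=> mv; apply: measurable_funB; first apply: measurable_funB.
- by apply: measurable_funM => //; apply: measurableT_comp.
- apply: (measurableT_comp mv).
  have := measurable_shift_prod 1.
  by under eq_fun do rewrite mul1r.
- apply: (measurableT_comp mv).
  have := measurable_shift_prod (-1).
  by under eq_fun do rewrite mulN1r scaleNr.
Qed.

Lemma measurable_Phi u v : measurable_fun setT u -> measurable_fun setT v ->
  measurable_fun setT (Phi u v).
Proof.
move=> mu_ mv; apply: measurable_funM; first exact: measurableT_comp.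
apply: measurable_funM; last exact: measurable_d2.
by apply: measurableT_comp => //; exact: measurable_Kn.
Qed.

Lemma ig_Phi u v M : L2 u -> Tst M v -> ((lebesgue_rV n) \x P)%E.-integrable setT (EFin \o Phi u v).
Proof.
move=> u2 T; have v2 := Tst_L2 T.
have mPhi : measurable_fun setT (EFin \o Phi u v).
  by apply/measurable_EFinP; apply: measurable_Phi; [exact: u2.1|exact: v2.1].
apply/(integrable21ltyP (lebesgue_rV n) P mPhi).
have [C C0 HC] := nsq_d2 T.
pose A := Num.sqrt (nsq u * C).
have A0 : 0 <= A by exact: sqrtr_ge0.
apply: (@le_lt_trans _ _ (\int[P]_z (A * Wn z)%:E)%E); last first.
  have /integrableP[_] := igZ A ig_Wn.
  rewrite (eq_integral (fun z => (A * Wn z)%:E))// => z _ /=.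
  by rewrite ger0_norm// mulr_ge0// Wn_ge0.
apply: ge0_le_integral => //.
- by move=> z _; apply: integral_ge0.
- apply: (measurable_fun_fubini_tonelli_G (m1 := lebesgue_rV n) (abse \o (EFin \o Phi u v))).
    exact: measurableT_comp.
  by move=> z; exact: abse_ge0.
- by apply/measurable_EFinP; apply: measurable_funM => //; exact: measurable_Wn.
move=> [t r] _; set h := r *: t.
have au2 : L2 (fun x => `|u x|).
  apply: (@L2_le _ _ _ _ 1 _ u) => //; last by move=> x; rewrite mul1r normr_id.
  by apply: measurableT_comp => //; exact: u2.1.
have d22 : L2 (d2 v h) by exact: L2_d2.
have ad2 : L2 (fun x => `|d2 v h x|).
  apply: (@L2_le _ _ _ _ 1 _ (d2 v h)) => //; last by move=> x; rewrite mul1r normr_id.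
  by apply: measurableT_comp => //; exact: d22.1.
have iu := L2M au2 ad2.
rewrite (eq_integral (fun x => (Kn (t, r) * (`|u x| * `|d2 v h x|))%:E)); last first.
  by move=> x _; rewrite /Phi /= (normrM (u x)) (normrM (Kn _)) (ger0_norm (Kn_ge0 _)) mulrCA.
rewrite -EFin_Int; last exact: igZ.
rewrite IntZ// lee_fin /Wn /Kn/= indicE.
have [/set_mem tS|tS] := boolP (t \in sphere n); last by rewrite !mul0r mulr0.
rewrite mul1r [leRHS]mulrCA ler_wpM2l ?kap_ge0//.
apply: (le_trans (ler_norm _)); apply: (le_trans (CS_norm au2 ad2)).
have E f : nsq (fun x => `|f x|) = nsq f.
  by apply: eq_Rintegral => x _; rewrite real_normK ?num_real.
rewrite !E; set mr := Num.min _ _.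
have mr0 : 0 <= mr by rewrite le_min ler01 sqr_ge0.
apply: (@le_trans _ _ (Num.sqrt (nsq u * (C * mr ^+ 2)))).
  rewrite ler_wsqrtr// ler_wpM2l ?nsq_ge0//; apply: (le_trans (HC h)).
  have mh0 : 0 <= Num.min 1 (`|h| ^+ 2) by rewrite le_min ler01 sqr_ge0.
  have mle : Num.min 1 (`|h| ^+ 2) <= mr.
    rewrite le_min ge_min lexx/= ge_min; apply/orP; right.
    rewrite -[r ^+ 2]real_normK ?num_real// lerXn2r ?nnegrE//.
    by rewrite normrZ ler_piMr// sphere_norm_le.
  by rewrite ler_wpM2l// lerXn2r ?nnegrE.
by rewrite mulrA sqrtrM ?mulr_ge0 ?nsq_ge0// sqrtr_sqr ger0_norm.
Qed.

Lemma stable_opE v x : stable_op s mu v x =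
  \int[mu]_t \int[leb1]_r (Kn (t, r) * d2 v (r *: t) x).
Proof.
rewrite /stable_op Rintegral_mkcond; apply: eq_Rintegral => t _.
rewrite patchE; case: ifPn => tS.
  by apply: eq_Rintegral => r _; rewrite /Kn/= indicE tS mul1r /kap /d2; exact: mulrC.
have -> : (fun r => Kn (t, r) * d2 v (r *: t) x) = fun=> 0.
  by apply/funext => r; rewrite /Kn/= indicE (negPf tS) !mul0r.
by rewrite Rintegral_cst// mul0r.
Qed.

Lemma nonlocal_rep u v M : L2 u -> Tst M v ->
  ig P (fun z => Kn z * Dform u v (z.2 *: z.1)) /\
  \int[leb]_x (u x * stable_op s mu v x) =
    \int[P]_z (Kn z * Dform u v (z.2 *: z.1)).
Proof.
move=> u2 T; have v2 := Tst_L2 T; have iP := ig_Phi u2 T.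
have DE z : \int[leb]_x Phi u v (x, z) = Kn z * Dform u v (z.2 *: z.1).
  rewrite /Dform -IntZ; last by apply: L2M => //; exact: L2_d2.
  by apply: eq_Rintegral => x _; rewrite /Phi/= mulrCA.
split.
  by have := ig_fubini2 iP; apply: eq_integrable => // z _ /=; rewrite DE.
transitivity (\int[P]_z \int[leb]_x Phi u v (x, z)); last by apply: eq_Rintegral => z _; exact: DE.
rewrite -[RHS](Int_fubini2 iP) (Int_fubini1 iP).
have mK : measurable_fun setT (fun p : (Rn * Rn) * measurableTypeR R =>
    Kn (p.1.2, p.2) * d2 v (p.2 *: p.1.2) p.1.1).
  apply: (@measurableT_comp _ _ _ _ _ _ (fun p : Rn * T2 => Kn p.2 * d2 v (p.2.2 *: p.2.1) p.1)
     _ (fun p : (Rn * Rn) * measurableTypeR R => (p.1.1, (p.1.2, p.2)))).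
    apply: measurable_funM; last by apply: measurable_d2; exact: v2.1.
    by apply: measurableT_comp => //; exact: measurable_Kn.
  apply/measurable_fun_pairP; split.
    exact: (measurableT_comp measurable_fst measurable_fst).
  apply/measurable_fun_pairP; split; last exact: measurable_snd.
  exact: (measurableT_comp measurable_snd measurable_fst).
apply: Int_ae.
- apply: measurable_funM; first exact: u2.1.
  rewrite (funext (stable_opE v)).
  apply: (@measurable_Int _ _ _ _ _ mu (fun p : Rn * Rn => \int[leb1]_r (Kn (p.2, r) * d2 v (r *: p.2) p.1))).
  exact: (measurable_Int leb1 mK).
- apply: (@measurable_Int _ _ _ _ _ P (Phi u v)).
  by apply: measurable_Phi; [exact: u2.1|exact: v2.1].
- apply: filterS (ae_integrable1 iP) => x ix.
  have [ux|ux] := eqVneq (u x) 0.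
    rewrite ux mul0r (@eq_Rintegral _ _ _ _ _ (fun=> 0)).
      by rewrite Rintegral_cst// mul0r.
    by move=> z _; rewrite /Phi /= ux mul0r.
  have iG : ig P (fun z => Kn z * d2 v (z.2 *: z.1) x).
    have := igZ (u x)^-1 ix; apply: eq_integrable => // z _ /=.
    by rewrite /Phi/= mulKf.
  transitivity (\int[P]_z (u x * (Kn z * d2 v (z.2 *: z.1) x))) => //.
  by rewrite IntZ// (Int_fubini1 iG) stable_opE.
Qed.

End nonlocal_representation.

(** * Cutoff functions *)

Section smoothstep.
Context {R : realType}.
Implicit Types p q t : R.

Definition clamp p : R := Num.max 0 (Num.min p 1).
Definition sst p : R := 3 * clamp p ^+ 2 - 2 * clamp p ^+ 3.
Definition dsst p : R := 6 * clamp p * (1 - clamp p).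

Lemma clampP p : (p <= 0 /\ clamp p = 0) \/ ((0 <= p /\ p <= 1) /\ clamp p = p) \/ (1 <= p /\ clamp p = 1).
Proof.
rewrite /clamp; have [p1|p1] := leP p 1.
  have [p0|p0] := leP 0 p; first by right; left.
  by left; split => //; exact: ltW.
by right; right; split; [exact: ltW|rewrite max_r].
Qed.

Lemma clamp01 p : 0 <= clamp p <= 1.
Proof. by case: (clampP p) => [[_ ->]|[[[h h'] ->]|[_ ->]]]; apply/andP; split; lra. Qed.

Lemma clamp_lip p q : `|clamp p - clamp q| <= `|p - q|.
Proof.
rewrite ler_norml; have := ler_norm (p - q); have := ler_norm (q - p).
rewrite [`|q - p|]distrC; move: `|p - q| => d h1 h2.
apply/andP; split.
all: case: (clampP p) => [[h ->]|[[[h hh] ->]|[h ->]]]; case: (clampP q) => [[h' ->]|[[[h' hh'] ->]|[h' ->]]];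
  lra.
Qed.

Lemma sst_ge0 p : 0 <= sst p.
Proof.
rewrite /sst (_ : _ - _ = clamp p ^+ 2 * (3 - 2 * clamp p)); last by ring.
by rewrite mulr_ge0 ?sqr_ge0//; have /andP[h1 h2] := clamp01 p; lra.
Qed.

Lemma sst_le1 p : sst p <= 1.
Proof.
rewrite /sst -subr_ge0 (_ : _ - _ = (1 - clamp p) ^+ 2 * (1 + 2 * clamp p)); last by ring.
by rewrite mulr_ge0 ?sqr_ge0//; have /andP[h1 h2] := clamp01 p; lra.
Qed.

Lemma sst_norm p : `|sst p| <= 1.
Proof. by rewrite ger0_norm ?sst_ge0 ?sst_le1. Qed.

Lemma sst_eq0 p : p <= 0 -> sst p = 0.
Proof.
rewrite /sst; case: (clampP p) => [[h ->]|[[[h _] ->]|[h ->]]] h'; last by exfalso; lra.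
  by rewrite !expr0n/= !mulr0 subr0.
have -> : p = 0 by lra.
by rewrite !expr0n/= !mulr0 subr0.
Qed.

Lemma sst_eq1 p : 1 <= p -> sst p = 1.
Proof.
rewrite /sst; case: (clampP p) => [[h ->]|[[[_ h] ->]|[h ->]]] h'; first by exfalso; lra.
  by have -> : p = 1; [lra|rewrite !expr1n; lra].
by rewrite !expr1n; lra.
Qed.

Lemma sst_gt0 p : 0 < p -> 0 < sst p.
Proof.
rewrite /sst; case: (clampP p) => [[h ->]|[[[h hh] ->]|[h ->]]] h'; first by exfalso; lra.
  by have -> : 3 * p ^+ 2 - 2 * p ^+ 3 = p ^+ 2 * (3 - 2 * p); [ring|];
     rewrite mulr_gt0 ?exprn_gt0//; lra.
by rewrite !expr1n; lra.
Qed.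

Lemma dsst_ge0 p : 0 <= dsst p.
Proof. by rewrite /dsst; have /andP[h1 h2] := clamp01 p; nra. Qed.

Lemma dsst_norm p : `|dsst p| <= 6.
Proof. by rewrite ger0_norm ?dsst_ge0// /dsst; have /andP[h1 h2] := clamp01 p; nra. Qed.

Lemma sst_lip p q : `|sst p - sst q| <= 6 * `|p - q|.
Proof.
have := clamp_lip p q; rewrite /sst; have := clamp01 p; have := clamp01 q.
move: (clamp p) (clamp q) => c b b01 c01 cb.
rewrite (_ : _ - _ = (3 * (c + b) - 2 * (c ^+ 2 + c * b + b ^+ 2)) * (c - b)); last by ring.
rewrite normrM; apply: ler_pM => //; rewrite ler_norml; apply/andP; split; nra.
Qed.

Lemma sst_mono p q : p <= q -> sst p <= sst q.
Proof.
move=> pq; have cpq : clamp p <= clamp q.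
  by move: pq; case: (clampP p) => [[h ->]|[[[h hh] ->]|[h ->]]]; case: (clampP q) => [[h' ->]|[[[h' hh'] ->]|[h' ->]]];
  lra.
rewrite /sst; have := clamp01 p; have := clamp01 q; move: cpq.
move: (clamp p) (clamp q) => c b cb b01 c01; rewrite -subr_ge0.
rewrite (_ : _ - _ = (3 * (c + b) - 2 * (c ^+ 2 + c * b + b ^+ 2)) * (b - c)); last by ring.
apply: mulr_ge0; last by rewrite subr_ge0.
nra.
Qed.

Lemma sst_taylor p t : `|sst (p + t) - sst p - t * dsst p| <= 9 * t ^+ 2.
Proof.
have := clamp_lip (p + t) p; rewrite (addrAC p t) subrr add0r => L.
have h1 : `|sst (p + t) - sst p - (clamp (p + t) - clamp p) * dsst p| <= 3 * t ^+ 2.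
  move: L; rewrite /sst /dsst; have := clamp01 p; have := clamp01 (p + t).
  move: (clamp p) (clamp (p + t)) => c b b01 c01 L.
  rewrite (_ : _ - _ = (3 - 2 * b - 4 * c) * (b - c) ^+ 2); last by ring.
  rewrite normrM (ger0_norm (sqr_ge0 _)); apply: ler_pM; rewrite ?sqr_ge0//.
    by rewrite ler_norml; apply/andP; split; lra.
  by rewrite -[_ ^+ 2]real_normK ?num_real// -[t ^+ 2]real_normK ?num_real// lerXn2r ?nnegrE.
have h2 : `|(clamp (p + t) - clamp p - t) * dsst p| <= 6 * t ^+ 2.
  have aux (w b q T : R) : 0 <= w -> 0 <= b -> 0 <= q -> w <= T -> b <= T -> q <= 1 ->
      0 <= 6 * (w * b * q) <= 6 * T ^+ 2.
    move=> w0 b0 q0 wT bT q1; rewrite !mulr_ge0//= ler_wpM2l// -[leRHS]mulr1 expr2.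
    by apply: ler_pM => //; rewrite ?mulr_ge0//; exact: ler_pM.
  rewrite /dsst ler_norml.
  case: (clampP p) => [[h ->]|[[[h hh] ->]|[h ->]]]; rewrite ?mulr0 ?mul0r ?subrr ?mulr0;
    try by (have := sqr_ge0 t; lra).
  have t0 := sqr_ge0 t; case: (clampP (p + t)) => [[h' ->]|[[[h' hh'] ->]|[h' ->]]].
  - have /andP[] : 0 <= 6 * ((- (p + t)) * p * (1 - p)) <= 6 * (- t) ^+ 2 by apply: aux; lra.
    by rewrite sqrrN => u0 u1; apply/andP; split; lra.
  - rewrite (_ : p + t - p - t = 0); [|by ring].
    by rewrite mul0r; apply/andP; split; lra.
  - have /andP[] : 0 <= 6 * ((p + t - 1) * (1 - p) * p) <= 6 * t ^+ 2 by apply: aux; lra.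
    by move=> u0 u1; apply/andP; split; lra.
rewrite (_ : _ - _ = (sst (p + t) - sst p - (clamp (p + t) - clamp p) * dsst p) +
  (clamp (p + t) - clamp p - t) * dsst p); last by ring.
by rewrite (le_trans (ler_normD _ _))//; move: h1 h2; lra.
Qed.

Lemma is_derive_quad (f : R -> R) p df : (forall t, `|f (p + t) - f p - t * df| <= 9 * t ^+ 2) ->
  is_derive p (1 : R) f df.
Proof.
move=> H; apply/is_deriveP => e e0; exists (e / 9); first by rewrite divr_gt0.
move=> t te; rewrite [t *: 1]mulr1; apply: (le_trans (H t)).
rewrite -[t ^+ 2]real_normK ?num_real// expr2 mulrA ler_wpM2r//.
by move: te; lra.
Qed.

Lemma measurable_dsst : measurable_fun setT dsst.
Proof.
have mc : measurable_fun setT clamp by apply: measurable_maxr => //; exact: measurable_minr.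
by apply: measurable_funM; [exact: measurable_funM|exact: measurable_funB].
Qed.

Definition cutF (d t : R) : R := sst (- t - d).
Definition dcutF (d t : R) : R := - dsst (- t - d).
Definition cutH (p : R) : R := 1 - sst p.
Definition dcutH (p : R) : R := - dsst p.

Lemma is_derive_cutF d t : is_derive t (1 : R) (cutF d) (dcutF d t).
Proof.
apply: is_derive_quad => h; rewrite /cutF /dcutF.
rewrite (_ : - (t + h) - d = - t - d + - h); last by ring.
by rewrite mulrN -mulNr; have := sst_taylor (- t - d) (- h); rewrite sqrrN.
Qed.

Lemma is_derive_cutH p : is_derive p (1 : R) cutH (dcutH p).
Proof.
apply: is_derive_quad => h; rewrite /cutH /dcutH -normrN.
by rewrite (_ : - (_ - _) = sst (p + h) - sst p - h * dsst p); [exact: sst_taylor|ring].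
Qed.

Lemma measurable_dcutF d : measurable_fun setT (dcutF d).
Proof.
rewrite (_ : dcutF d = fun t => - (dsst \o (fun t => - t - d)) t)//.
apply: measurableT_comp => //; apply: measurableT_comp; first exact: measurable_dsst.
by apply: measurable_funB => //; exact: measurableT_comp.
Qed.

Lemma measurable_dcutH : measurable_fun setT dcutH.
Proof. by apply: measurableT_comp => //; exact: measurable_dsst. Qed.

Lemma cutF_lip d s t : `|cutF d s - cutF d t| <= 6 * `|s - t|.
Proof. by apply: (le_trans (sst_lip _ _)); rewrite (_ : - s - d - (- t - d) = - (s - t)) ?normrN//; ring. Qed.

Lemma cutH_lip s t : `|cutH s - cutH t| <= 6 * `|s - t|.
Proof.
by rewrite (_ : cutH s - cutH t = - (sst s - sst t)); [rewrite normrN; exact: sst_lip|rewrite /cutH; ring].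
Qed.

Lemma cutH_norm p : `|cutH p| <= 1.
Proof.
by rewrite /cutH ger0_norm; have := sst_ge0 p; have := sst_le1 p; lra.
Qed.

Lemma measurable_cutF d : measurable_fun setT (cutF d).
Proof.
apply: continuous_measurable_fun => t; apply: differentiable_continuous.
by apply/derivable1_diffP; have [] := is_derive_cutF d t.
Qed.

Lemma measurable_cutH : measurable_fun setT cutH.
Proof.
apply: continuous_measurable_fun => t; apply: differentiable_continuous.
by apply/derivable1_diffP; have [] := is_derive_cutH t.
Qed.

End smoothstep.

Section H1_functions.
Context {R : realType} {n : nat}.
Local Notation Rn := 'rV[R]_n.
Local Notation leb := (lebesgue_rV n : {measure set Rn -> \bar R}).
Local Notation L2 := (L2 leb).
Local Notation nsq := (nsq leb).
Implicit Types (u f : Rn -> R) (g : Rn -> Rn).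

Lemma Lfun_L2 f : f \in Lfun (lebesgue_rV n) 2%:E -> L2 f.
Proof.
move=> /[dup] fL /Lfun2_integrable_sqr fi; split; last exact: fi.
by move: fL; rewrite inE => /andP[/= + _]; rewrite inE.
Qed.

Lemma H1_wgradP u : H1 u -> H1_gradient u (wgrad u).
Proof. by move=> [_ ex]; exact: (xgetPex (fun=> 0) ex). Qed.

Lemma H1_L2 u : H1 u -> L2 u.
Proof. by move=> [/Lfun_L2]. Qed.

Lemma H1_wgrad_L2 u i : H1 u -> L2 (fun x => wgrad u x 0 i).
Proof. by move=> /H1_wgradP[/(_ i)/Lfun_L2]. Qed.

Lemma H1_SD u i : H1 u -> SD i u (fun x => wgrad u x 0 i).
Proof.
move=> uH; apply: WD_SD; [exact: H1_L2|exact: H1_wgrad_L2|].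
by move=> phi T; have [_ W] := H1_wgradP uH; exact: W.
Qed.

Lemma H1_normsq_le u (e : R) : H1 u -> (H1_normsq u < e%:E)%E ->
  nsq u <= e /\ forall i, nsq (fun x => wgrad u x 0 i) <= e.
Proof.
move=> uH ue; have u2 := H1_L2 uH.
have E x : enorm (wgrad u x) ^+ 2 = \sum_i wgrad u x 0 i ^+ 2.
  rewrite /enorm sqr_sqrtr; last by apply: sumr_ge0 => i _; rewrite -expr2 sqr_ge0.
  by apply: eq_bigr => i _; rewrite expr2.
have mE : measurable_fun setT (fun x => (u x ^+ 2 + enorm (wgrad u x) ^+ 2)%:E).
  apply/measurable_EFinP; apply: measurable_funD.
    by apply: measurable_funX; exact: u2.1.
  under eq_fun do rewrite E.
  apply: measurable_sum => i; apply: measurable_funX; exact: (H1_wgrad_L2 i uH).1.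
have key f : L2 f -> (forall x, f x ^+ 2 <= u x ^+ 2 + enorm (wgrad u x) ^+ 2) -> nsq f <= e.
  move=> [mf f2] H; rewrite -lee_fin EFin_Int//; apply: le_trans (ltW ue).
  apply: ge0_le_integral => //.
  - by move=> x _; rewrite lee_fin sqr_ge0.
  - by apply/measurable_EFinP; exact: measurable_funX.
  - by move=> x _; rewrite lee_fin; exact: H.
split; first by apply: key => // x; rewrite lerDl sqr_ge0.
move=> i; apply: key; first exact: H1_wgrad_L2.
move=> x; rewrite E (bigD1 i)//= addrCA lerDl addr_ge0 ?sqr_ge0//.
by apply: sumr_ge0 => j _; rewrite sqr_ge0.
Qed.

End H1_functions.

Section truncation.
Context {R : realType} {n : nat}.
Local Notation Rn := 'rV[R]_n.
Local Notation leb := (lebesgue_rV n : {measure set Rn -> \bar R}).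
Local Notation L2 := (L2 leb).
Local Notation nsq := (nsq leb).
Implicit Types (u f phi v : Rn -> R).

Lemma cutF0 (d t : R) : - d <= t -> cutF d t = 0.
Proof. by move=> dt; apply: sst_eq0; lra. Qed.

Lemma L2_cutF (d : R) u : 0 < d -> L2 u -> L2 (fun x => cutF d (u x)).
Proof.
move=> d0 u2; apply: (@L2_le _ _ _ _ 6 _ u) => //.
  by apply: measurableT_comp; [exact: measurable_cutF|exact: u2.1].
move=> x; have := cutF_lip d (u x) 0; rewrite (@cutF0 d 0)//; first by rewrite !subr0.
by rewrite oppr_le0 ltW.
Qed.

Lemma L2_mul_bounded (B : R) f g : measurable_fun setT f -> (forall x, `|f x| <= B) ->
  L2 g -> L2 (fun x => f x * g x).
Proof.
move=> mf fB g2; apply: (@L2_le _ _ _ _ B _ g) => //.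
  by apply: measurable_funM => //; exact: g2.1.
by move=> x; rewrite normrM ler_wpM2r.
Qed.

Lemma cutF_norm (d t : R) : `|cutF d t| <= 1.
Proof. exact: sst_norm. Qed.

Lemma dcutF_norm (d t : R) : `|dcutF d t| <= 6.
Proof. by rewrite normrN; exact: dsst_norm. Qed.

Lemma dcutH_norm (t : R) : `|dcutH t| <= 6.
Proof. by rewrite normrN; exact: dsst_norm. Qed.

Definition cutoff (d : R) phi u : Rn -> R := fun x => cutH (phi x) * cutF d (u x).

Definition dcutoff (d : R) phi u (i : 'I_n) : Rn -> R := fun x =>
  dcutH (phi x) * wgrad phi x 0 i * cutF d (u x) +
  cutH (phi x) * (dcutF d (u x) * wgrad u x 0 i).

Lemma L2_cutoff d phi u : 0 < d -> H1 phi -> H1 u -> L2 (cutoff d phi u).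
Proof.
move=> d0 Hphi Hu; apply: (@L2_mul_bounded 1).
- by apply: measurableT_comp; [exact: measurable_cutH|exact: (H1_L2 Hphi).1].
- by move=> x; exact: cutH_norm.
- exact: L2_cutF (H1_L2 Hu).
Qed.

Lemma L2_dcutoff1 d phi u i : 0 < d -> H1 phi -> H1 u ->
  L2 (fun x => dcutH (phi x) * wgrad phi x 0 i * cutF d (u x)).
Proof.
move=> d0 Hphi Hu; have mp := (H1_L2 Hphi).1; have mu_ := (H1_L2 Hu).1.
rewrite (_ : (fun x => _) = fun x => (dcutH (phi x) * cutF d (u x)) * wgrad phi x 0 i); last first.
  by apply/funext => x; rewrite mulrAC.
apply: (@L2_mul_bounded 6); last exact: H1_wgrad_L2.
  apply: measurable_funM; first by apply: measurableT_comp mp; exact: measurable_dcutH.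
  by apply: measurableT_comp mu_; exact: measurable_cutF.
move=> x; rewrite normrM -[leRHS]mulr1; apply: ler_pM => //; [exact: dcutH_norm|exact: cutF_norm].
Qed.

Lemma L2_dcutF d u i : H1 u -> L2 (fun x => dcutF d (u x) * wgrad u x 0 i).
Proof.
move=> Hu; apply: (@L2_mul_bounded 6); last exact: H1_wgrad_L2.
  by apply: measurableT_comp; [exact: measurable_dcutF|exact: (H1_L2 Hu).1].
by move=> x; exact: dcutF_norm.
Qed.

Lemma L2_dcutoff2 d phi u i : H1 phi -> H1 u ->
  L2 (fun x => cutH (phi x) * (dcutF d (u x) * wgrad u x 0 i)).
Proof.
move=> Hphi Hu; apply: (@L2_mul_bounded 1); last exact: L2_dcutF.
  by apply: measurableT_comp; [exact: measurable_cutH|exact: (H1_L2 Hphi).1].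
by move=> x; exact: cutH_norm.
Qed.

Lemma L2_dcutoff d phi u i : 0 < d -> H1 phi -> H1 u -> L2 (dcutoff d phi u i).
Proof. by move=> *; apply: L2D; [exact: L2_dcutoff1|exact: L2_dcutoff2]. Qed.

Lemma WD_cutoff d phi u i : 0 < d -> H1 phi -> H1 u ->
  WD i (cutoff d phi u) (dcutoff d phi u i).
Proof.
move=> d0 Hphi Hu.
have [h [h0 hc Dphi Du]] := SD_HasD2 (H1_SD i Hphi) (H1_SD i Hu).
apply: (HasD_WD h0 hc); [exact: L2_cutoff|exact: L2_dcutoff|].
apply: (HasD_prod h0 hc Dphi Du (is_derive_cutH) (is_derive_cutF d) measurable_dcutH
  (measurable_dcutF d) (cutH_norm) (cutF_norm d) cutH_lip (cutF_lip d)).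
Qed.

Lemma WD_cutF d u i : 0 < d -> H1 u ->
  WD i (fun x => cutF d (u x)) (fun x => dcutF d (u x) * wgrad u x 0 i).
Proof.
move=> d0 Hu; have [h [h0 hc _ Du]] := SD_HasD2 (H1_SD i Hu) (H1_SD i Hu).
apply: (HasD_WD h0 hc); [exact: L2_cutF (H1_L2 Hu)|exact: L2_dcutF|].
have := HasD_prod h0 hc Du Du (H := cst 1) (H' := cst 0) (BH := 1) (LH := 0)
  (F := cutF d) (F' := dcutF d) (BF := 1) (LF := 6).
rewrite (_ : (fun x => _ * _) = (fun x => cutF d (u x))); last by apply/funext => x; rewrite mul1r.
rewrite (_ : (fun x => _ + _) = (fun x => dcutF d (u x) * wgrad u x 0 i)); last first.
  by apply/funext => x; rewrite !mul0r add0r mul1r.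
apply.
- exact: is_derive_cutF.
- by [].
- exact: measurable_dcutF.
- by move=> t; rewrite normr1.
- exact: cutF_norm.
- by move=> s t; rewrite subrr normr0 mul0r.
- exact: cutF_lip.
Qed.

End truncation.

Section approximation.
Context {R : realType} {n : nat}.
Local Notation Rn := 'rV[R]_n.
Local Notation leb := (lebesgue_rV n : {measure set Rn -> \bar R}).
Local Notation L2 := (L2 leb).
Local Notation nsq := (nsq leb).
Implicit Types (u f phi v : Rn -> R) (K G Omega : set Rn).

Lemma within_le_closed G v (c : R) : open G -> {within ~` G, continuous v} ->
  closed [set x | ~ G x /\ v x <= c].
Proof.
move=> oG cv; rewrite -openC openE => x /=.
rewrite /interior; have [Gx|nGx] := pselect (G x).
  by move=> _; apply: filterS (open_nbhs_nbhs (conj oG Gx)) => y Gy [].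
move=> H; have vx : c < v x by rewrite ltNge; apply/negP => vc; exact: H.
move/subspace_continuousP : cv => /(_ x nGx) /(_ _ (lt_nbhsr vx)).
rewrite /nbhs/= /within/= => W.
by apply: filterS W => y Wy [nGy]; rewrite leNgt => /negP; apply; exact: Wy.
Qed.

Lemma compact_sub_open K Omega : compact K -> open Omega -> K `<=` Omega ->
  exists2 r : R, 0 < r & forall x y, K x -> `|y - x| < r -> Omega y.
Proof.
move=> cK oO KO.
have H := (compact_near_coveringP K).1 cK R (0 : R)^'+
  (fun r x => forall y : Rn, `|y - x| < r -> Omega y) _.
have {}H : \forall r \near (0 : R)^'+, K `<=` (fun x => forall y : Rn, `|y - x| < r -> Omega y).
  apply: H => x Kx; have /nbhs_rVP[e e0 He] := open_nbhs_nbhs (conj oO (KO _ Kx)).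
  have e2 : 0 < e / 2 by rewrite divr_gt0.
  exists ([set x' : Rn | `|x - x'| < e / 2], [set r | r < e / 2]) => /=.
    split; last exact: nbhs_right_lt.
    by apply/nbhs_ballP; exists (e / 2) => // z; rewrite -ball_normE.
  move=> [x' r] [/= xx' re] y yx'; apply: He.
  rewrite -(subrK x' y) -addrA (le_lt_trans (ler_normD _ _))//.
  by rewrite distrC in xx'; move: xx' yx' re; lra.
have W : nbhs (0 : R)^'+ ([set r | 0 < r] `&` (fun r => K `<=` (fun x => forall y : Rn, `|y - x| < r -> Omega y))).
  by apply: filterI => //; exact: nbhs_right_gt.
have [r [r0 Hr]] := @filter_ex _ _ _ _ W.
by exists r => // x y Kx; exact: Hr.
Qed.

Lemma mollify (f : Rn -> R) (gf : 'I_n -> Rn -> R) K Omega (e : R) : 0 < e -> L2 f ->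
  (forall i, L2 (gf i)) -> (forall i, WD i f (gf i)) -> (forall x, 0 <= f x) ->
  (forall x, f x != 0 -> K x) -> compact K -> open Omega -> K `<=` Omega ->
  exists v, [/\ exists M, Tst M v, test_function Omega v, forall x, 0 <= v x
   & [/\ nsq (fun x => v x - f x) <= e,
      forall i, nsq (fun x => partial i v x - gf i x) <= e
    & forall h, nsq (dtr h v) <= 2 * n%:R ^+ 2 * gsq gf * `|h| ^+ 2]].
Proof.
move=> e0 f2 g2 fg f0 fK cK oO KO.
have [r1 r10 H1] := compact_sub_open cK oO KO.
have [r2 r20 H2] := mollifier_approx f2 e0.
have [r3 H3] := choice (fun i => let: ex_intro2 r r0 Hr := mollifier_approx (g2 i) e0 in
  ex_intro (fun r => 0 < r /\ forall r' rho, r' <= r -> mollifier r' rho ->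
    nsq (fun x => cvl (gf i) rho x - gf i x) <= e) r (conj r0 Hr)).
pose r := \big[Num.min/Num.min (r1 / 2) r2]_i r3 i.
have r0 : 0 < r.
  rewrite /r; elim/big_ind : _ => [|x y x0 y0|i _]; last by have [] := H3 i.
    by rewrite lt_min r20 divr_gt0.
  by rewrite lt_min x0.
have rr1 : r <= r1 / 2 by apply: (le_trans (bigmin_le_id _ _ _ _)); rewrite ge_min lexx.
have rr2 : r <= r2 by apply: (le_trans (bigmin_le_id _ _ _ _)); rewrite ge_min lexx orbT.
have rr3 i : r <= r3 i by exact: bigmin_le_cond.
have [rho mrho] := mollifier_exists (n := n) r0; have [[M T] rho0 rho1 rhor] := mrho.
pose v := cvl f rho; have [v2 _] := mollifier_contract mrho f2.
have dv i : partial i v = cvl (gf i) rho.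
  apply/funext => x; rewrite (WD_cvl x f2 (g2 i) (fg i) T).
  by apply: partialE; exact: is_derive_conv T.
have vO x : v x != 0 -> exists2 y, K y & `|y - x| < r.
  apply: contra_neqP => H; rewrite /v /cvl.
  under eq_Rintegral => y _.
    rewrite (_ : _ * _ = 0); last first.
      have [->|/rhor yr] := eqVneq (rho y) 0; first by rewrite mulr0.
      have [->|/fK Kxy] := eqVneq (f (x + y)) 0; first by rewrite mul0r.
      by exfalso; apply: H; exists (x + y) => //; rewrite addrAC subrr add0r.
    over.
  by rewrite /Rintegral integral0_eq.
have clO : closure [set x | v x != 0] `<=` [set x | exists2 y, K y & `|y - x| < 2 * r].
  move=> x /(_ [set y | `|y - x| < r]) [].
    apply/nbhs_ballP; exists r => // z; rewrite -ball_normE/= distrC; exact.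
  move=> y [/vO[z Kz zy] /= yx]; exists z => //.
  by rewrite -(subrK y z) -addrA (le_lt_trans (ler_normD _ _))//; move: zy yx; lra.
exists v; split.
- have [N [_ HN]] := compact_bounded cK; exists (N + 1 + r); split.
    by move=> k; exact: Coo_conv T _.
  move=> x /vO[y /(HN (N + 1)) Ky yx]; have := ler_normB y (y - x).
  rewrite opprB addrC subrK => /le_trans; apply; apply: lerD; last exact: ltW.
  by apply: Ky; rewrite ltrDl.
- split; [by move=> k; exact: Coo_conv T _| |].
    have [N [_ HN]] := compact_bounded cK.
    apply: (@compact_norm_le _ _ (N + 1 + 2 * r)); first exact: closed_closure.
    move=> x /clO[y /(HN (N + 1)) Ky yx]; have := ler_normB y (y - x).
    rewrite opprB addrC subrK => /le_trans; apply; apply: lerD; last exact: ltW.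
    by apply: Ky; rewrite ltrDl.
  move=> x /clO[y Ky yx]; apply: (H1 y) => //; rewrite distrC.
  by apply: (lt_le_trans yx); move: rr1; lra.
- by move=> x; apply: Int_ge0 => y; rewrite mulr_ge0.
split.
- exact: H2 mrho.
- by move=> i; rewrite dv; have [_ H] := H3 i; exact: H mrho.
- move=> h; rewrite (_ : dtr h v = cvl (dtr h f) rho); last first.
    by apply/funext => x; rewrite -conv_dtr//; exact: Tst_L2 T.
  have [_ /le_trans] := mollifier_contract mrho (L2_dtr h f2); apply.
  by apply: nsq_dtr_SD => // i; exact: WD_SD.
Qed.

End approximation.

Section test_functions.
Context {R : realType} {n : nat}.
Local Notation Rn := 'rV[R]_n.
Local Notation leb := (lebesgue_rV n : {measure set Rn -> \bar R}).
Local Notation L2 := (L2 leb).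
Local Notation ig := (ig leb).
Local Notation nsq := (nsq leb).
Implicit Types (u f phi v : Rn -> R) (K G Omega : set Rn).

Lemma cutF_ge0 (d t : R) : 0 <= cutF d t.
Proof. exact: sst_ge0. Qed.

Lemma cutH_ge0 (t : R) : 0 <= cutH t.
Proof. by rewrite subr_ge0 sst_le1. Qed.

Lemma cutH_eq0 (t : R) : 1 <= t -> cutH t = 0.
Proof. by move=> t1; rewrite /cutH sst_eq1// subrr. Qed.

Lemma cutH_sub1 (t : R) : `|cutH t - 1| <= 6 * `|t|.
Proof.
have -> : cutH t - 1 = cutH t - cutH 0 by rewrite /cutH (sst_eq0 (lexx 0)) subr0.
by apply: (le_trans (cutH_lip _ _)); rewrite subr0.
Qed.

Lemma nsq_ae f g : L2 f -> measurable_fun setT g -> {ae leb, forall x, f x = g x} ->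
  L2 g /\ nsq g = nsq f.
Proof.
move=> [mf f2] mg fg; have fg2 : {ae leb, forall x, f x ^+ 2 = g x ^+ 2}.
  by apply: filterS fg => x ->.
have mg2 : measurable_fun setT (fun x => g x ^+ 2) by exact: measurable_funX.
split; first by split => //; exact: ig_ae fg2.
by apply/esym; apply: Int_ae => //; exact: measurable_funX.
Qed.

Lemma nsq_le_cst (c : R) f g : L2 f -> L2 g -> (forall x, `|f x| <= c * `|g x|) ->
  nsq f <= c ^+ 2 * nsq g.
Proof.
move=> f2 g2 fg; rewrite -nsqZ//; apply: nsq_le => //; first exact: L2Z.
by move=> x; rewrite normrM (le_trans (fg x))// ler_wpM2r// ler_norm.
Qed.

Lemma nsq_dcutoff d phi u i : 0 < d -> H1 phi -> H1 u ->
  nsq (dcutoff d phi u i) <= 72 * nsq (fun x => wgrad phi x 0 i) + 72 * nsq (fun x => wgrad u x 0 i).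
Proof.
move=> d0 Hphi Hu.
have := nsqD_le (L2_dcutoff1 i d0 Hphi Hu) (L2_dcutoff2 d i Hphi Hu).
have h1 := @nsq_le_cst 6 _ _ (L2_dcutoff1 i d0 Hphi Hu) (H1_wgrad_L2 i Hphi).
have h2 := @nsq_le_cst 6 _ _ (L2_dcutoff2 d i Hphi Hu) (H1_wgrad_L2 i Hu).
have {}h1 := h1 _; have {}h2 := h2 _.
move/le_trans; apply; apply: (@le_trans _ _ (2 * (6 ^+ 2 * nsq (fun x => wgrad phi x 0 i)) +
  2 * (6 ^+ 2 * nsq (fun x => wgrad u x 0 i)))); last by lra.
apply: lerD; rewrite ler_wpM2l//.
  apply: h1 => x; rewrite !normrM -[leRHS]mulr1; apply: ler_pM => //.
    by rewrite ler_wpM2r// dcutH_norm.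
  exact: cutF_norm.
apply: h2 => x; rewrite !normrM -[leRHS]mul1r; apply: ler_pM => //; first exact: cutH_norm.
by rewrite ler_wpM2r// dcutF_norm.
Qed.

Lemma CS_le (B : R) f g : L2 f -> L2 g -> 0 <= B -> nsq g <= B ^+ 2 ->
  \int[leb]_x (f x * g x) <= B * Num.sqrt (nsq f).
Proof.
move=> f2 g2 B0 gB; apply: (le_trans (ler_norm _)); apply: (le_trans (CS_norm f2 g2)).
rewrite sqrtrM ?nsq_ge0// mulrC ler_wpM2r ?sqrtr_ge0//.
by rewrite -(ger0_norm B0) -sqrtr_sqr ler_sqrt// sqr_ge0.
Qed.

Variables (Omega : set Rn) (oO : open Omega) (bO : bounded_set Omega).
Variables (a : Rn -> R) (ap : R) (ma : measurable_fun setT a).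
Hypotheses (a_ge0 : forall x, 0 <= a x) (a_le : forall x, a x <= ap).
Variables (u : Rn -> R) (uH : H1 u) (hext : H1_nonneg_on (~` Omega) u).
Variables (d : R) (d0 : 0 < d).

Local Notation g i := (fun x => wgrad u x 0 i).

Lemma L2_ag i : L2 (fun x => a x * g i x).
Proof.
apply: (@L2_mul_bounded _ _ ap) => //; last exact: H1_wgrad_L2.
by move=> x; rewrite ger0_norm.
Qed.

Definition cutI phi : R :=
  \int[leb]_x (\sum_i (a x * g i x) * (cutH (phi x) * (dcutF d (u x) * g i x))).

Definition cutC : R := 74 + 2 * n%:R ^+ 2 * (72 * n%:R + 72 * gsq (fun i => g i))
  + 7 * \sum_i Num.sqrt (nsq (fun x => a x * g i x)).

Lemma test_step (e : R) : 0 < e -> e <= 1 -> exists v phi,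
  [/\ test_function Omega v, exists M, Tst M v, forall x, 0 <= v x & H1 phi /\ nsq phi <= e ^+ 2]
  /\ [/\ nsq (fun x => v x - cutF d (u x)) <= cutC * e ^+ 2,
     forall h, nsq (dtr h v) <= cutC * `|h| ^+ 2
   & \int[leb]_x (a x * dotrv (wgrad u x) (gradient v x)) <= cutC * e + cutI phi].
Proof.
move=> e0 e1; have [w [qw wu wO]] := hext.
have e20 : 0 < e ^+ 2 by rewrite exprn_gt0.
have [G [oG [cG [phi [Hphi phiG phie]]]]] := qw _ e20.
have [nphi ngphi] := H1_normsq_le Hphi phie.
pose K := [set x | ~ G x /\ w x <= - d].
have clK : closed K by exact: within_le_closed.
have KO : K `<=` Omega.
  move=> x [_ wx]; apply: contrapT => /wO; rewrite leNgt => /negP; apply.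
  by rewrite (le_lt_trans wx)// oppr_lt0.
have cK : compact K.
  have [M [_ HM]] := bO; apply: (@compact_norm_le _ _ (M + 1)) => // x /KO; apply: HM.
  by rewrite ltrDl.
have mK : measurable K.
  by rewrite -[K]setCK; apply: measurableC; apply: open_measurable_rV; rewrite openC.
have zeta2 := L2_cutoff d0 Hphi uH; have gz2 i := L2_dcutoff i d0 Hphi uH.
pose z x := \1_K x * cutoff d phi u x.
have mz : measurable_fun setT z.
  by apply: measurable_funM; [exact: measurable_indic|exact: zeta2.1].
have zae : {ae leb, forall x, cutoff d phi u x = z x}.
  apply: filterS2 wu phiG => x wux Gx; rewrite /z indicE.
  have [|xK] := boolP (x \in K); first by rewrite mul1r.
  rewrite mul0r /cutoff; have [Gx'|nGx] := pselect (G x).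
    by rewrite cutH_eq0 ?mul0r//; exact: Gx.
  rewrite cutF0 ?mulr0// -wux ltW// ltNge; apply/negP => wd.
  by move: xK; rewrite notin_setE; apply.
have [z2 _] := nsq_ae zeta2 mz zae.
have zWD i : WD i z (dcutoff d phi u i).
  move=> psi T; rewrite -(WD_cutoff i d0 Hphi uH T).
  have [M TM] := test_Tst T; have mp := (Tst_L2 (Tst_partial i TM)).1.
  apply: Int_ae; [exact: measurable_funM|by apply: measurable_funM => //; exact: zeta2.1|].
  by apply: filterS zae => x ->.
have z0 x : 0 <= z x.
  by rewrite /z mulr_ge0// mulr_ge0 ?cutH_ge0 ?cutF_ge0.
have zK x : z x != 0 -> K x.
  by rewrite /z indicE; have [/set_mem//|_] := boolP (x \in K); rewrite mul0r eqxx.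
have [v [[M T] tO v0 [vz vg vh]]] := mollify e20 z2 gz2 zWD z0 zK cK oO KO.
have v2 := Tst_L2 T; have U2 := L2_cutF d0 (H1_L2 uH).
have S0 : 0 <= \sum_i Num.sqrt (nsq (fun x => a x * g i x)).
  by apply: sumr_ge0 => i _; exact: sqrtr_ge0.
have gu0 : 0 <= gsq (fun i => g i) by exact: gsq_ge0.
have nn0 : 0 <= 2 * n%:R ^+ 2 * (72 * n%:R + 72 * gsq (fun i => g i)).
  by rewrite mulr_ge0// ?mulr_ge0 ?sqr_ge0// addr_ge0// mulr_ge0.
exists v, phi; do 2 split => //.
- by exists M.
- have dz : nsq (fun x => z x - cutF d (u x)) <= 6 ^+ 2 * nsq phi.
    have zae' : {ae leb, forall x, cutoff d phi u x - cutF d (u x) = z x - cutF d (u x)}.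
      by apply: filterS zae => x ->.
    have [_ ->] := nsq_ae (L2B zeta2 U2) (L2B z2 U2).1 zae'.
    apply: nsq_le_cst; [exact: L2B|exact: H1_L2|move=> x].
    rewrite (_ : _ - _ = (cutH (phi x) - 1) * cutF d (u x)); last by rewrite /cutoff; ring.
    rewrite normrM -[leRHS]mulr1.
    by apply: ler_pM => //; [exact: cutH_sub1|exact: cutF_norm].
  have := nsqD_le (L2B v2 z2) (L2B z2 U2).
  rewrite (@eq_nsq _ _ _ _ _ (fun x => v x - cutF d (u x))); last by move=> x; ring.
  move/le_trans; apply; apply: (@le_trans _ _ (74 * e ^+ 2)); first by move: vz dz nphi; lra.
  by rewrite ler_wpM2r ?(ltW e20)// /cutC; move: S0 nn0; lra.
- move=> h; apply: (le_trans (vh h)); rewrite ler_wpM2r ?sqr_ge0//.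
  apply: (@le_trans _ _ (2 * n%:R ^+ 2 * (72 * n%:R + 72 * gsq (fun i => g i)))); last first.
    by rewrite /cutC; move: S0; lra.
  rewrite ler_wpM2l ?mulr_ge0 ?sqr_ge0//.
  apply: (@le_trans _ _ (\sum_(i < n) (72 + 72 * nsq (g i)))).
    apply: ler_sum => i _; apply: (le_trans (nsq_dcutoff i d0 Hphi uH)).
    rewrite lerD2r -[leRHS]mulr1 ler_wpM2l//; apply: (le_trans (ngphi i)).
    by rewrite expr_le1// ltW.
  by rewrite big_split/= -mulr_sumr sumr_const card_ord -[72 *+ n]mulr_natr.
- have E : \int[leb]_x (a x * dotrv (wgrad u x) (gradient v x)) =
      \sum_i \int[leb]_x ((a x * g i x) * partial i v x).
    rewrite -Int_sum; last first.
      by move=> i; apply: L2M; [exact: L2_ag|exact: Tst_L2 (Tst_partial i T)].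
    apply: eq_Rintegral => x _; rewrite /dotrv mulr_sumr; apply: eq_bigr => i _.
    by rewrite mxE mulrA.
  have EI : cutI phi = \sum_i \int[leb]_x ((a x * g i x) * (cutH (phi x) * (dcutF d (u x) * g i x))).
    by apply: Int_sum => i; apply: L2M; [exact: L2_ag|exact: L2_dcutoff2].
  rewrite E EI -lerBlDr -sumrB.
  apply: (@le_trans _ _ (\sum_i (7 * e * Num.sqrt (nsq (fun x => a x * g i x))))); last first.
    rewrite -mulr_sumr mulrAC ler_wpM2r ?(ltW e0)// /cutC.
    by move: nn0; lra.
  apply: ler_sum => i _.
  have p2 := Tst_L2 (Tst_partial i T).
  have g1 := L2_dcutoff1 i d0 Hphi uH; have g2 := L2_dcutoff2 d i Hphi uH.
  rewrite -IntB; [|exact: L2M (L2_ag i) p2|exact: L2M (L2_ag i) g2].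
  rewrite (@eq_Rintegral _ _ _ _ _ (fun x => (a x * g i x) * (partial i v x - dcutoff d phi u i x)
    + (a x * g i x) * (dcutH (phi x) * wgrad phi x 0 i * cutF d (u x)))); last first.
    by move=> x _; rewrite /dcutoff; ring.
  rewrite IntD; [|exact: L2M (L2_ag i) (L2B p2 (gz2 i))|exact: L2M (L2_ag i) g1].
  rewrite (_ : 7 * e = e + 6 * e); last by ring.
  rewrite mulrDl; apply: lerD; first by apply: CS_le; [exact: L2_ag|exact: L2B|exact: ltW|exact: vg].
  apply: CS_le; [exact: L2_ag|by []|by rewrite mulr_ge0// ltW|].
  rewrite exprMn; apply: (@le_trans _ _ (6 ^+ 2 * nsq (fun x => wgrad phi x 0 i))); last first.
    by rewrite ler_wpM2l.
  apply: nsq_le_cst => //; first exact: H1_wgrad_L2.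
  move=> x; rewrite !normrM -[leRHS]mulr1; apply: ler_pM => //.
    by rewrite ler_wpM2r// dcutH_norm.
  exact: cutF_norm.
Qed.

End test_functions.

Section energy.
Context {R : realType} {n : nat}.
Local Notation Rn := 'rV[R]_n.
Local Notation leb := (lebesgue_rV n : {measure set Rn -> \bar R}).
Local Notation leb1 := (@lebesgue_measure R).
Local Notation L2 := (L2 leb).
Local Notation nsq := (nsq leb).
Implicit Types (u f phi v : Rn -> R) (K G Omega : set Rn).

Lemma cvg_half (x : nat -> R) (l C : R) :
  (forall k, `|x k - l| <= C * (1 / 2) ^+ k) -> x k @[k --> \oo] --> l.
Proof.
move=> H; apply/cvgrPdist_le => e e0.
have : geometric C (1 / 2) k @[k --> \oo] --> (0 : R).
  by apply: cvg_geometric; rewrite ger0_norm; lra.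
move/cvgrPdist_le => /(_ e e0); apply: filterS => k; rewrite sub0r normrN distrC.
by apply: le_trans; apply: (le_trans (H k)); rewrite /geometric/=; exact: ler_norm.
Qed.

Lemma Dform_cutF_le0 (d : R) u h : 0 < d -> L2 u ->
  Dform u (fun x => cutF d (u x)) h <= 0.
Proof.
move=> d0 u2; have U2 := L2_cutF d0 u2; rewrite DformE//.
have -> : (0 : R) = \int[leb]_x (0 : R) by rewrite /Rintegral integral0_eq.
apply: Int_le; [by apply: L2M; exact: L2_dtr|exact: ig0|move=> x].
rewrite /dtr; have [uu|uu] := leP (u x) (u (x + h)).
  by apply: mulr_ge0_le0; rewrite ?subr_ge0// subr_le0; apply: sst_mono; lra.
by apply: mulr_le0_ge0; rewrite ?subr_le0 ?subr_ge0 ?(ltW uu)//; apply: sst_mono; lra.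
Qed.

Lemma nsq_dtr_min f (A B r : R) (h : Rn) : L2 f -> nsq f <= B -> 0 <= A -> 0 <= B ->
  nsq (dtr h f) <= A * `|h| ^+ 2 -> `|h| <= `|r| ->
  nsq (dtr h f) <= (A + 4 * B) * Num.min 1 (r ^+ 2).
Proof.
move=> f2 fB A0 B0 fA hr; have := nsq_dtr_le h f2 => f4.
rewrite /Num.min; case: ifP => _; first by move: fB f4; lra.
apply: (le_trans fA); apply: ler_pM => //; rewrite ?sqr_ge0//; first by lra.
by rewrite -[r ^+ 2]real_normK ?num_real// lerXn2r ?nnegrE.
Qed.

Lemma Dform_min f v (A B A' B' r : R) (h : Rn) : L2 f -> L2 v ->
  nsq f <= B -> nsq v <= B' -> 0 <= A -> 0 <= A' ->
  nsq (dtr h f) <= A * `|h| ^+ 2 -> nsq (dtr h v) <= A' * `|h| ^+ 2 -> `|h| <= `|r| ->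
  `|Dform f v h| <= (A + 4 * B + A' + 4 * B') * Num.min 1 (r ^+ 2).
Proof.
move=> f2 v2 fB vB A0 A0' fA vA hr; apply: (le_trans (Dform_le h f2 v2)).
have B0 : 0 <= B by exact: le_trans (nsq_ge0 _ _) fB.
have B0' : 0 <= B' by exact: le_trans (nsq_ge0 _ _) vB.
have h1 := nsq_dtr_min f2 fB A0 B0 fA hr; have h2 := nsq_dtr_min v2 vB A0' B0' vA hr.
have p0 := nsq_ge0 leb (dtr h f); have q0 := nsq_ge0 leb (dtr h v).
apply: (@le_trans _ _ (nsq (dtr h f) + nsq (dtr h v))); last by move: h1 h2; lra.
rewrite -(ger0_norm (addr_ge0 p0 q0)) -sqrtr_sqr ler_sqrt ?sqr_ge0//.
move: p0 q0; move: (nsq _) (nsq _) => p q p0 q0; rewrite sqrrD.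
have := mulr_ge0 p0 q0; have := sqr_ge0 p; have := sqr_ge0 q; lra.
Qed.

Lemma nsq_dtr_H1 u h : H1 u ->
  nsq (dtr h u) <= 2 * n%:R ^+ 2 * gsq (fun i x => wgrad u x 0 i) * `|h| ^+ 2.
Proof. by move=> uH; apply: nsq_dtr_SD; [exact: H1_L2|move=> i; exact: H1_SD]. Qed.

Variables (s : R) (mu : {finite_measure set Rn -> \bar R}) (s01 : 0 < s < 1).
Variables (Omega : set Rn) (oO : open Omega) (bO : bounded_set Omega).
Variables (a : Rn -> R) (am ap : R) (ma : measurable_fun setT a).
Hypotheses (am0 : 0 < am) (a_bnd : forall x, am <= a x <= ap).
Variables (u : Rn -> R) (uH : H1 u) (hext : H1_nonneg_on (~` Omega) u).
Hypothesis hE : weak_supersolution s mu a Omega u.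
Variables (d : R) (d0 : 0 < d).
Local Notation g i := (fun x => wgrad u x 0 i).
Local Notation U := (fun x => cutF d (u x)).
Local Notation P := (Pm mu).

Let a0 x : 0 <= a x.
Proof. by have /andP[h _] := a_bnd x; rewrite (le_trans _ h)// ltW. Qed.

Let a1 x : a x <= ap.
Proof. by have /andP[] := a_bnd x. Qed.

Definition cutJ : R := \int[leb]_x (\sum_i (a x * g i x) * (dcutF d (u x) * g i x)).

Lemma cvg_cutI (phi : nat -> Rn -> R) : (forall k, H1 (phi k)) ->
  (forall k, nsq (phi k) <= ((1 / 2) ^+ k) ^+ 2) ->
  cutI a u d (phi k) @[k --> \oo] --> cutJ.
Proof.
move=> pH pn.
have [] := @fast_cvg _ _ R leb phi.
- by move=> k; exact: H1_L2.
- move=> k; apply: (le_trans (pn k)); rewrite expr2.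
  have h0 : 0 <= (1 / 2 : R) ^+ k by rewrite exprn_ge0// divr_ge0.
  by apply: ler_piMl => //; rewrite exprn_ile1//; lra.
move=> _ p0.
have mag i : measurable_fun setT (fun x => a x * g i x).
  by have [] := L2_ag ma a0 a1 uH i.
have mdg i : measurable_fun setT (fun x => dcutF d (u x) * g i x) by have [] := L2_dcutF d i uH.
have [|||||_ c] := @dct _ _ R leb
  (fun k x => \sum_i (a x * g i x) * (cutH (phi k x) * (dcutF d (u x) * g i x)))
  (fun x => \sum_i (a x * g i x) * (dcutF d (u x) * g i x))
  (fun x => \sum_i `|(a x * g i x) * (dcutF d (u x) * g i x)|).
- move=> k; apply: measurable_sum => i; apply: measurable_funM => //.
  by have [] := L2_dcutoff2 d i (pH k) uH.
- by apply: measurable_sum => i; exact: measurable_funM.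
- apply: ig_sum => i; apply: ig_norm; apply: L2M; [exact: (L2_ag ma a0 a1 uH i)|exact: L2_dcutF].
- apply: filterS p0 => x px.
  apply: cvg_big => [|i _]; first exact: add_continuous.
  apply: cvgM; first exact: cvg_cst.
  rewrite -[X in _ --> X]mul1r; apply: cvgM; last exact: cvg_cst.
  apply/cvgrPdist_le => e e0.
  move/cvgrPdist_le : px => /(_ (e / 6)) []; first by rewrite divr_gt0.
  move=> N _ HN; exists N => // k /HN /=; rewrite sub0r normrN distrC => h.
  by apply: (le_trans (cutH_sub1 _)); move: h; lra.
- apply: aeW => x k; apply: (le_trans (ler_norm_sum _ _ _)); apply: ler_sum => i _.
  rewrite mulrCA normrM; apply: ler_piMl => //; exact: cutH_norm.
exact: c.
Qed.

Lemma cutJ_eq0 : cutJ = 0.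
Proof.
have u2 := H1_L2 uH; have U2 := L2_cutF d0 u2.
have e0 k : 0 < (1 / 2 : R) ^+ k by rewrite exprn_gt0// divr_gt0.
have e1 k : (1 / 2 : R) ^+ k <= 1 by rewrite exprn_ile1//; lra.
have /choice[v Hv] : forall k, exists v, _ := fun k => test_step oO bO ma a0 a1 uH hext d0 (e0 k) (e1 k).
have /choice[phi {}Hv] := Hv.
set C := cutC a u in Hv.
have C0 : 0 <= C.
  have [_ [h _ _]] := Hv 0; move: h; rewrite expr0 expr1n mulr1; apply: le_trans; exact: nsq_ge0.
have vU k : nsq (fun x => v k x - U x) <= C * ((1 / 2) ^+ k) ^+ 2 by have [_ []] := Hv k.
have vT k : exists M, Tst M (v k) by have [[]] := Hv k.
have v2 k : L2 (v k) by have [M T] := vT k; exact: Tst_L2 T.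
have g0 : 0 <= gsq (fun i => g i) by exact: gsq_ge0.
have wn0 : 0 <= 2 * n%:R ^+ 2 * gsq (fun i => g i) by rewrite !mulr_ge0.
pose D := 2 * n%:R ^+ 2 * gsq (fun i => g i) + 4 * nsq u + C + 4 * (2 * C + 2 * nsq U).
have vB k : nsq (v k) <= 2 * C + 2 * nsq U.
  have := nsqD_le (L2B (v2 k) U2) U2; rewrite (@eq_nsq _ _ _ _ _ (v k)); last first.
    by move=> x; ring.
  move/le_trans; apply; rewrite lerD2r ler_wpM2l//; apply: (le_trans (vU k)).
  by rewrite ler_piMr// expr_le1//; exact: ltW.
have AD k (z : Rn * measurableTypeR R) : `|Kn s z * Dform u (v k) (z.2 *: z.1)| <= D * Wn s z.
  rewrite normrM (ger0_norm (Kn_ge0 _ _)) /Wn mulrCA.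
  have [zs|zs] := pselect (sphere n z.1); last first.
    by rewrite /Kn indicE memNset// !mul0r.
  rewrite ler_wpM2l ?Kn_ge0//; apply: Dform_min => //.
  - exact: nsq_dtr_H1.
  - by have [_ []] := Hv k.
  - by rewrite normrZ ler_piMr//; exact: sphere_norm_le.
have [Mk TM] := choice vT; have nr k := nonlocal_rep mu s01 u2 (TM k).
pose A0 := \int[P]_z (Kn s z * Dform u U (z.2 *: z.1)).
have [iA cA] : ig P (fun z => Kn s z * Dform u U (z.2 *: z.1)) /\
    \int[P]_z (Kn s z * Dform u (v k) (z.2 *: z.1)) @[k --> \oo] --> A0.
  have cz (z : Rn * measurableTypeR R) : Kn s z * Dform u (v k) (z.2 *: z.1) @[k --> \oo] -->
      Kn s z * Dform u U (z.2 *: z.1).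
    apply: cvgM; first exact: cvg_cst.
    apply: (@cvg_half _ _ (Num.sqrt (4 * nsq (dtr (z.2 *: z.1) u) * C))) => k.
    rewrite Dform_sub//; apply: (le_trans (Dform_le _ u2 (L2B (v2 k) U2))).
    set X := 4 * _ * _; have X0 : 0 <= X by rewrite /X !mulr_ge0// nsq_ge0.
    have key Y : 0 <= Y -> Num.sqrt Y * (1 / 2) ^+ k = Num.sqrt (Y * ((1 / 2) ^+ k) ^+ 2).
      by move=> Y0; rewrite sqrtrM// sqrtr_sqr ger0_norm// ltW.
    rewrite key// ler_sqrt; last by rewrite mulr_ge0// sqr_ge0.
    rewrite /X [4 * _]mulrC -!mulrA ler_wpM2l ?nsq_ge0//.
    by apply: (le_trans (nsq_dtr_le _ (L2B (v2 k) U2))); rewrite ler_wpM2l.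
  have mk k : measurable_fun setT (fun z : Rn * measurableTypeR R => Kn s z * Dform u (v k) (z.2 *: z.1)).
    by have [/ig_meas] := nr k.
  apply: (@dct _ _ R P (fun k z => Kn s z * Dform u (v k) (z.2 *: z.1))
    (fun z => Kn s z * Dform u U (z.2 *: z.1)) (fun z => D * Wn s z) mk).
  - by apply: (measurable_fun_cvg mk) => z _; exact: cz.
  - by apply: igZ; exact: ig_Wn.
  - by apply: aeW => z; exact: cz.
  - by apply: aeW => z k; exact: AD.
have A0le : A0 <= 0.
  rewrite -oppr_ge0 /A0.
  rewrite -mulN1r -IntZ//; apply: Int_ge0 => z.
  by rewrite mulN1r oppr_ge0 mulr_ge0_le0 ?Kn_ge0// Dform_cutF_le0.
have Jle : cutJ <= 0.
  have -> : (0 : R) = \int[leb]_x (0 : R) by rewrite /Rintegral integral0_eq.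
  apply: Int_le; [|exact: ig0|move=> x].
    by apply: ig_sum => i; apply: L2M; [exact: (L2_ag ma a0 a1 uH i)|exact: L2_dcutF].
  apply: sumr_le0 => i _; rewrite (_ : _ * _ = a x * wgrad u x 0 i ^+ 2 * dcutF d (u x)); last by ring.
  by apply: mulr_ge0_le0; [rewrite mulr_ge0 ?sqr_ge0|rewrite oppr_le0 dsst_ge0].
have cJ : cutI a u d (phi k) @[k --> \oo] --> cutJ.
  by apply: cvg_cutI => k; have [[_ _ _ []]] := Hv k.
have ce : C * (1 / 2) ^+ k @[k --> \oo] --> (0 : R).
  apply: (@cvg_half _ _ C) => k.
  by rewrite subr0 ger0_norm// mulr_ge0// ltW.
have AJ : 0 <= A0 + (0 + cutJ).
  have c : \int[P]_z (Kn s z * Dform u (v k) (z.2 *: z.1)) + (C * (1 / 2) ^+ k + cutI a u d (phi k))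
      @[k --> \oo] --> A0 + (0 + cutJ) by apply: cvgD => //; exact: cvgD.
  rewrite -(cvg_lim _ c)//.
  apply: limr_ge; first exact: cvgP c.
  apply: nearW => k; have [[tk _ vk _] [_ _ bk]] := Hv k; have [_ rk] := nr k.
  by apply: (le_trans (hE tk vk)); rewrite rk lerD2l.
by apply/eqP; rewrite eq_le Jle/=; move: AJ A0le; lra.
Qed.

Lemma dcutF_grad0 i : {ae leb, forall x, dcutF d (u x) * wgrad u x 0 i = 0}.
Proof.
have iJ : ig leb (fun x => \sum_i (a x * g i x) * (dcutF d (u x) * g i x)).
  by apply: ig_sum => j; apply: L2M; [exact: (L2_ag ma a0 a1 uH j)|exact: L2_dcutF].
have t0 x j : 0 <= - ((a x * g j x) * (dcutF d (u x) * g j x)).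
  rewrite (_ : _ * _ = a x * wgrad u x 0 j ^+ 2 * dcutF d (u x)); last by ring.
  by rewrite oppr_ge0; apply: mulr_ge0_le0; [rewrite mulr_ge0 ?sqr_ge0|rewrite oppr_le0 dsst_ge0].
have nn x : 0 <= - 1 * \sum_i (a x * g i x) * (dcutF d (u x) * g i x).
  by rewrite mulN1r -sumrN; apply: sumr_ge0 => j _; exact: t0.
have := Int_ae0 (igZ (- 1) iJ) nn; rewrite IntZ// -/cutJ cutJ_eq0 mulr0 => /(_ erefl).
apply: filterS => x /eqP; rewrite mulN1r -sumrN psumr_eq0 => [|j _]; last exact: t0.
move=> /allP/(_ i (mem_index_enum _))/=; rewrite oppr_eq0.
have ax : a x != 0 by apply: lt0r_neq0; have /andP[h _] := a_bnd x; exact: lt_le_trans h.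
rewrite -mulrA mulf_eq0 (negPf ax)/= mulrCA mulf_eq0 => /orP[/eqP ->|]; first by rewrite mul0r.
by rewrite mulf_eq0 orbb => /eqP ->; rewrite mulr0.
Qed.

End energy.

Section conclusion.
Context {R : realType} {n : nat}.
Local Notation Rn := 'rV[R]_n.
Local Notation leb := (lebesgue_rV n : {measure set Rn -> \bar R}).
Local Notation L2 := (L2 leb).
Local Notation nsq := (nsq leb).

Lemma enorm_le_norm (x : Rn) : enorm x <= n%:R * `|x|.
Proof.
have nx : 0 <= n%:R * `|x| by rewrite mulr_ge0.
rewrite /enorm -(ger0_norm nx) -sqrtr_sqr ler_sqrt ?sqr_ge0//.
apply: (@le_trans _ _ (\sum_(i < n) `|x| ^+ 2)).
  apply: ler_sum => i _; rewrite -expr2 -[x 0 i ^+ 2]real_normK ?num_real//.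
  by rewrite lerXn2r ?nnegrE// coord_le_norm.
rewrite sumr_const card_ord -[leLHS]mulr_natl exprMn ler_wpM2r ?sqr_ge0//.
by rewrite -natrX ler_nat; case: (n) => // k; rewrite expnS expn1 leq_pmulr.
Qed.

Lemma holder_loc_continuous (alpha : R) (a : Rn -> R) : 0 < alpha ->
  holder_loc alpha a -> continuous a.
Proof.
move=> al0 Ha; apply: continuous_eps => x e e0.
have cB : compact [set y : Rn | `|y| <= `|x| + 1].
  by apply: (compact_norm_le (M := `|x| + 1)) => //; exact: closed_norm_le.
have [C HC] := Ha _ cB.
have C0 : 0 < `|C| + 1 by rewrite ltr_wpDl.
pose t := (e / (`|C| + 1)) `^ alpha^-1.
have t0 : 0 < t by rewrite powR_gt0// divr_gt0.
have n1 : 0 < n%:R + 1 :> R by rewrite ltr_wpDl.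
exists (Num.min 1 (t / (n%:R + 1))); first by rewrite lt_min ltr01 divr_gt0.
move=> y; rewrite lt_min => /andP[y1 yt].
apply: (le_trans (HC y x _ _)).
- by rewrite /= -(subrK x y) (le_trans (ler_normD _ _))// addrC lerD2l ltW.
- by rewrite /= lerDl.
have et : enorm (y - x) <= t.
  apply: (le_trans (enorm_le_norm _)); rewrite ltr_pdivlMr// in yt.
  by apply: le_trans (ltW yt); rewrite mulrC ler_wpM2l// lerDl.
have pe : enorm (y - x) `^ alpha <= e / (`|C| + 1).
  apply: (@le_trans _ _ (t `^ alpha)).
    by apply: ge0_ler_powR => //; rewrite ?nnegrE; [exact: ltW|exact: sqrtr_ge0|exact: ltW].
  by rewrite /t -powRrM mulVf ?lt0r_neq0// powRr1// divr_ge0// ltW.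
apply: (@le_trans _ _ ((`|C| + 1) * enorm (y - x) `^ alpha)).
  by rewrite ler_wpM2r ?powR_ge0// (le_trans (ler_norm C))// lerDl.
by rewrite mulrC -ler_pdivlMr.
Qed.

(* A function with vanishing derivative along [e_ i] is invariant under
   translations along [e_ i], which move its support off itself. *)
Lemma WD0_bounded_support i (M : R) (f : Rn -> R) : L2 f -> WD i f (fun=> 0) ->
  (forall x, f x != 0 -> `|x| <= M) -> {ae leb, forall x, f x = 0}.
Proof.
move=> f2 W fM.
have D := WD_SD f2 (L20 _) W.
pose h : Rn := (2 * `|M| + 1) *: e_ i.
have nh : 2 * `|M| + 1 <= `|h|.
  by apply: le_trans (coord_le_norm _ i); rewrite !mxE !eqxx/= mulr1 ler_norm.
have d0 : nsq (dtr h f) <= 0.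
  have := SD_bound (2 * `|M| + 1) D; by rewrite nsq0 mulr0.
have f0 : nsq f <= 0.
  apply: le_trans d0; apply: nsq_le => //; first exact: L2_dtr.
  move=> x; rewrite /dtr; have [->|/fM xM] := eqVneq (f x) 0; first by rewrite normr0.
  have [->|/fM xhM] := eqVneq (f (x + h)) 0; first by rewrite sub0r normrN.
  exfalso; have := ler_normB (x + h) x; rewrite addrAC subrr add0r.
  by move: nh xM xhM (ler_norm M); lra.
have nf : nsq f = 0 by apply/eqP; rewrite eq_le f0 nsq_ge0.
have := Int_ae0 f2.2 (fun x => sqr_ge0 (f x)) nf.
by apply: filterS => x /eqP; rewrite sqrf_eq0 => /eqP.
Qed.

End conclusion.

Section lower_bound.
Context {R : realType} {n : nat}.
Local Notation Rn := 'rV[R]_n.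
Local Notation leb := (lebesgue_rV n : {measure set Rn -> \bar R}).
Local Notation L2 := (L2 leb).
Local Notation nsq := (nsq leb).

Lemma supersolution_ge (s : R) (mu : {finite_measure set Rn -> \bar R}) (Omega : set Rn)
    (a : Rn -> R) (am ap : R) (u : Rn -> R) (d : R) :
  (0 < n)%N -> 0 < s < 1 -> open Omega -> bounded_set Omega -> measurable_fun setT a ->
  0 < am -> (forall x, am <= a x <= ap) -> H1 u -> H1_nonneg_on (~` Omega) u ->
  weak_supersolution s mu a Omega u -> 0 < d ->
  {ae leb, forall x, Omega x -> - d <= u x}.
Proof.
move=> n0 s01 oO bO ma am0 a_bnd uH hext hE d0; pose i := Ordinal n0.
have [w [_ wu wO]] := hext; have U2 := L2_cutF d0 (H1_L2 uH).
pose f x := \1_Omega x * cutF d (u x).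
have mO : measurable Omega by exact: open_measurable_rV.
have mf : measurable_fun setT f.
  by apply: measurable_funM; [exact: measurable_indic|exact: U2.1].
have Uf : {ae leb, forall x, cutF d (u x) = f x}.
  apply: filterS wu => x wux; rewrite /f indicE; have [|xO] := boolP (x \in Omega).
    by rewrite mul1r.
  rewrite mul0r cutF0// -wux (le_trans (y := 0)) ?oppr_le0 ?(ltW d0)//.
  by apply: wO; move: xO; rewrite notin_setE.
have [f2 _] := nsq_ae U2 mf Uf.
have W : WD i f (fun=> 0).
  move=> psi T; have [M TM] := test_Tst T; have mp := (Tst_L2 (Tst_partial i TM)).1.
  have mpsi := (Tst_L2 TM).1.
  have Z := dcutF_grad0 s01 oO bO ma am0 a_bnd uH hext hE d0 i.
  transitivity (\int[leb]_x (cutF d (u x) * partial i psi x)).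
    apply: Int_ae; [exact: measurable_funM|by apply: measurable_funM => //; exact: U2.1|].
    by apply: filterS Uf => x ->.
  rewrite (WD_cutF i d0 uH T); congr (- _); apply: Int_ae.
  - by apply: measurable_funM => //; have [] := L2_dcutF d i uH.
  - by apply: measurable_funM.
  - by apply: filterS Z => x ->.
have [M [_ HM]] := bO.
have fM x : f x != 0 -> `|x| <= M + 1.
  rewrite /f indicE; have [/set_mem xO _|_] := boolP (x \in Omega).
    by apply: HM xO; rewrite ltrDl.
  by rewrite mul0r eqxx.
have f0 := WD0_bounded_support f2 W fM.
apply: filterS2 Uf f0 => x Ux fx _; rewrite leNgt; apply/negP => ux.
by have := @sst_gt0 R (- u x - d); rewrite -/(cutF d (u x)) Ux fx ltxx => /(_ ltac:(lra)).
Qed.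

End lower_bound.

Theorem theorem1p3 (R : realType) (n : nat) (hn : (0 < n)%N)
  (Omega : set 'rV[R]_n) (hOmega : bounded_domain Omega)
  (s : R) (hs : 0 < s < 1)
  (mu : {finite_measure set 'rV[R]_n -> \bar R}) (hmu : elliptic mu)
  (alpha : R) (halpha : 0 < alpha < 1)
  (a : 'rV[R]_n -> R) (ha : holder_loc alpha a)
  (am ap : R) (ham : 0 < am) (hab : forall x, am <= a x <= ap)
  (u : 'rV[R]_n -> R) (hu : H1 u)
  (hE : weak_supersolution s mu a Omega u)
  (hext : H1_nonneg_on (~` Omega) u) :
  {ae lebesgue_rV n, forall x, Omega x -> 0 <= u x}.
Proof.
have [oO _ _ bO] := hOmega; have /andP[al0 _] := halpha.
have ma : measurable_fun setT a.
  by apply: continuous_measurable_rV; exact: holder_loc_continuous al0 ha.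
have : {ae lebesgue_rV n, forall x, forall k, Omega x -> - k.+1%:R^-1 <= u x}.
  by apply: ae_foralln => k; apply: supersolution_ge hn hs oO bO ma ham hab hu hext hE _; rewrite invr_gt0.
apply: filterS => x ux xO; rewrite leNgt; apply/negP => u0.
have v0 : 0 < - u x by rewrite oppr_gt0.
have := ux (truncn (- u x)^-1) xO; rewrite leNgt => /negP; apply.
by rewrite ltrNr invf_plt ?posrE// truncnS_gt.
Qed.
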